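(* For every $\gamma>0$ there exists $n_0$ such that the following holds. Suppose $\mathcal H$ is a $3$-uniform hypergraph on $n>n_0$ vertices with $n$ even and \[\delta_1(\mathcal H)>\left(\frac{7}{16}+\gamma\right)\binom{n}{2}.\] Then $\mathcal H$ contains a loose Hamilton cycle.
   Context: A $3$-uniform hypergraph $\mathcal H=(V,E)$ has $E\subseteq\binom{V}{3}$. For $v\in V$, $\deg(v)$ is the number of edges containing $v$, and $\delta_1(\mathcal H)=\min_{v\in V}\deg(v)$ is the minimum vertex degree. A $3$-uniform hypergraph $\mathcal C$ is a loose cycle if there is a cyclic ordering of its vertices such that every edge consists of $3$ consecutive vertices, every vertex lies in an edge, and two consecutive edges (in the order inherited from the vertex ordering) intersect in exactly one vertex. A loose Hamilton cycle of $\mathcal H$ is a subhypergraph of $\mathcal H$ that is a loose cycle covering all vertices of $\mathcal H$. *)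

(* Defs.v *)
From mathcomp Require Import all_boot all_order all_algebra.
From mathcomp Require Import reals.

Set Implicit Arguments.
Unset Strict Implicit.
Unset Printing Implicit Defensive.

Section Hypergraphs.
Variable V : finType.

(* The ambient type V need not be the vertex set: this lets a hypergraph and its
   subhypergraphs inhabit the same type. *)
Record hypergraph3 := Hypergraph3 {
  vertices : {set V};
  edges : {set {set V}};
  edgesP : forall e, e \in edges -> e \subset vertices /\ #|e| = 3 }.

Definition subhypergraph (C H : hypergraph3) : Prop :=
  vertices C \subset vertices H /\ edges C \subset edges H.

Definition degree (H : hypergraph3) (v : V) : nat :=
  #|[set e in edges H | v \in e]|.

(* The default #|edges H| bounds every degree, so it only matters when there are
   no vertices. *)
Definition min_degree (H : hypergraph3) : nat :=
  \big[minn/#|edges H|]_(v in vertices H) degree H v.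

(* For 3 <= size s, the three cyclically consecutive entries of s at positions
   i, i+1, i+2 modulo size s. *)
Definition triple (s : seq V) (i : nat) : {set V} :=
  [set:: take 3 (rot (i %% size s) s)].

(* f is the next edge after e in the cyclic order of the edges inherited from s:
   going around s from the starting position of e, the first starting position
   of an edge that is met is that of f. *)
Definition consecutive_edges (E : {set {set V}}) (s : seq V) (e f : {set V})
    : Prop :=
  [/\ e \in E, f \in E, e != f &
    exists i d : nat,
      [/\ i < size s, 0 < d < size s, e = triple s i, f = triple s (i + d) &
        forall k, 0 < k < d -> triple s (i + k) \notin E]].

(* s lists the vertices in the cyclic ordering. *)
Definition loose_cycle (C : hypergraph3) : Prop :=
  exists s : seq V,
    [/\ uniq s /\ s =i vertices C,
        forall e, e \in edges C -> exists2 i, i < size s & e = triple s i,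
        forall v, v \in vertices C -> exists2 e, e \in edges C & v \in e &
        forall e f, consecutive_edges (edges C) s e f -> #|e :&: f| = 1].

Definition loose_Hamilton_cycle (H C : hypergraph3) : Prop :=
  [/\ subhypergraph C H, loose_cycle C & vertices C = vertices H].

End Hypergraphs.

(* Main.v *)
Require Import Defs.
From mathcomp Require Import all_boot all_order all_algebra.
From mathcomp Require Import reals.
From mathcomp Require Import ring lra zify.
From mathcomp Require boolp.
Set Implicit Arguments.
Unset Strict Implicit.
Unset Printing Implicit Defensive.
Import Order.TTheory GRing.Theory Num.Theory.
Local Open Scope ring_scope.

(** The absorption method, without regularity lemma and without probability.

    An absorber of two vertices [x], [y] is a loose path [v1 .. v7] such that
    [v1 v3 v2 x v4 y v6 v5 v7] is a loose path too.  Every pair has linearly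
    many disjoint absorbers in a fixed small family, and every pair of vertices
    is joined by linearly many of the disjoint triples of a fixed small
    reservoir; both families are chosen greedily, minimising the potential
    [sum_i 2^-(number of chosen tuples good for i)].

    Almost all other vertices are covered by disjoint complete tripartite
    hypergraphs with parts of sizes [t], [t], [2t], which contain loose paths on
    all but one of their vertices.  Such a tiling at a large scale is improved
    at a smaller scale: cut the parts of the tiles and the uncovered set into
    equal blobs, and call a triple of blobs an edge if it is dense.  Degree
    [7/16] of the uncovered blobs gives [k <= 3] tiles and [k + 1] disjoint edges,
    each with an uncovered blob, meeting no other tile: the bipartite graphs
    between two tiles (four blobs each) that are popular among the uncovered
    blobs have more than 7 edges on average, so some have a 3-matching or contain
    a [K_{2,4}], and two of the latter pointing to the same tile give 4 disjoint
    edges on 3 tiles.  Erdos' theorem on complete tripartite subgraphs then turns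
    these edges into small tiles covering more vertices than those they replace.
    Boundedly many rounds suffice.

    Finally, the absorbers and the long paths are joined into a cycle through the
    reservoir, and the few remaining vertices are absorbed in pairs. *)

(** * Counting *)

(** The constant 7/16 is a 4 x 4 phenomenon. Without augmentations, a typical uncovered blob sees at
    most about 7 of the 16 blob pairs between two tiles, a quarter of the pairs formed by a tile
    blob and an uncovered blob, and no pair of uncovered blobs. With m tiles and u uncovered blobs
    this makes about 7 m^2 + 2 m u ordered pairs, against 7/16 (4 m + u)^2 = 7 m^2 + 7/2 m u + 7/16
    u^2. So [gamma] has to beat lower-order terms only; connectors and absorbers need 7/16 alone.

    The proportion 1 : 1 : 2 makes an augmentation profitable. The double part of each new tile is
    placed in the uncovered blob of an edge, so that a tile blob loses at most one unit. Then k
    tiles lose k units, keep their proportions, and k + 1 edges bring k + 1 units.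

    Regularity is avoided because density alone, measured against the full size of the blobs, yields
    small complete pieces, and the improved tiling has the same form as the old one.

    Parity enters only at the end: a closed loose path has even length, so n even leaves an even
    number of vertices to absorb in pairs. *)

Lemma eventually_ge (R : realType) (K c : R) : 0 < c ->
  exists n0 : nat, forall n : nat, (n0 <= n)%N -> K <= c * n%:R.
Proof.
move=> c0; exists (Num.truncn (`|K| / c)).+1 => n hn.
have h1 : `|K| / c < n%:R.
  apply: lt_le_trans (truncnS_gt _) _; by rewrite ler_nat.
apply: (le_trans (ler_norm K)).
by rewrite mulrC -ler_pdivrMr // ltW.
Qed.

Lemma card_pair (A B : finType) (P : A -> B -> bool) :
  #|[set p : A * B | P p.1 p.2]| = (\sum_a #|[set b | P a b]|)%N.
Proof.
rewrite -sum1_card (eq_bigl (fun p : A * B => P p.1 p.2)); last first.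
  by move=> p; rewrite inE.
rewrite -(pair_big_dep xpredT P (fun _ _ => 1%N)) /=.
apply: eq_bigr => a _; rewrite -sum1_card.
by apply: eq_bigl => b; rewrite inE.
Qed.

Lemma card_pair_ge (R : realType) (A B : finType) (X : {set A})
    (P : A -> B -> bool) (k l : R) :
  0 <= l -> k <= #|X|%:R -> (forall a, a \in X -> l <= #|[set b | P a b]|%:R) ->
  k * l <= #|[set p : A * B | P p.1 p.2]|%:R.
Proof.
move=> l0 hk hl; rewrite card_pair natr_sum.
apply: (le_trans (ler_wpM2r l0 hk)).
rewrite (bigID (mem X)) /=.
apply: (@le_trans _ _ (\sum_(i in X) #|[set b | P i b]|%:R)); last first.
  by rewrite lerDl sumr_ge0.
apply: (@le_trans _ _ (\sum_(i in X) l)); last exact: ler_sum.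
by rewrite sumr_const mulr_natl.
Qed.

Lemma card_pair_le (R : realType) (A B : finType) (X : {set A})
    (P : A -> B -> bool) (l : R) :
  (forall a b, P a b -> a \in X) ->
  (forall a, a \in X -> #|[set b | P a b]|%:R <= l) ->
  #|[set p : A * B | P p.1 p.2]|%:R <= #|X|%:R * l.
Proof.
move=> hX hl; rewrite card_pair natr_sum (bigID (mem X)) /=.
rewrite [X in _ + X]big1 => [|a aX].
  rewrite addr0; apply: (@le_trans _ _ (\sum_(i in X) l)); first exact: ler_sum.
  by rewrite sumr_const mulr_natl.
rewrite (_ : [set b | P a b] = set0) ?cards0 //.
apply/setP=> b; rewrite !inE; apply/negP => /hX; exact/negP.
Qed.

Lemma card_swap (A B : finType) (P : A -> B -> bool) :
  #|[set p : A * B | P p.1 p.2]| = #|[set p : B * A | P p.2 p.1]|.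
Proof.
pose f (p : A * B) := (p.2, p.1).
have fI : injective f by move=> [a b] [c d] [-> ->].
rewrite -(card_imset _ fI); apply: eq_card => -[b a]; rewrite !inE /=.
apply/imsetP/idP => [[[c d]]|h]; first by rewrite inE /= => h [-> ->].
by exists (a, b); rewrite ?inE.
Qed.

Lemma card_setD_ge (R : realType) (T : finType) (X W : {set T}) :
  #|X|%:R - #|W|%:R <= #|X :\: W|%:R :> R.
Proof.
rewrite lerBlDr -natrD ler_nat -(cardsID W X) addnC leq_add2l.
exact: subset_leq_card (subsetIr _ _).
Qed.

Lemma card_setI_ge (R : realType) (T : finType) (X Y S : {set T}) :
  X \subset S -> Y \subset S ->
  #|X|%:R + #|Y|%:R - #|S|%:R <= #|X :&: Y|%:R :> R.
Proof.
move=> XS YS; rewrite lerBlDr -!natrD ler_nat -cardsUI addnC leq_add2l.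
by apply: subset_leq_card; rewrite subUset XS.
Qed.

Lemma disjointUl (T : finType) (A B C : {set T}) :
  [disjoint A :|: B & C] = [disjoint A & C] && [disjoint B & C].
Proof. by rewrite -!setI_eq0 setIUl setU_eq0. Qed.

Lemma disjointUr (T : finType) (A B C : {set T}) :
  [disjoint C & A :|: B] = [disjoint C & A] && [disjoint C & B].
Proof. by rewrite -!setI_eq0 setIUr setU_eq0. Qed.

(** Edges are handled as a relation on ordered triples; these two transpositions generate all
    permutations. *)
Definition sym3 (V : Type) (e : V -> V -> V -> bool) :=
  (forall x y z, e x y z = e y x z) /\ (forall x y z, e x y z = e x z y).

Section Links.
Variables (R : realType) (V : finType) (e : V -> V -> V -> bool) (S : {set V}).

Definition nbs x y := [set z in S | e x y z].
Definition link x := [set p : V * V | [&& p.1 \in S, p.2 \in S & e x p.1 p.2]].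
(** The link consists of ordered pairs, so density [d] corresponds to vertex degree about [d] times
    n choose 2. *)
Definition mindeg (d : R) := forall x, x \in S ->
  d * #|S|%:R ^+ 2 <= #|link x|%:R.

Definition rich (c : R) x := [set y in S | c * #|S|%:R <= #|nbs x y|%:R].
End Links.

(** * Connectors *)

Section Abundance.
Variables (R : realType) (V : finType) (e : V -> V -> V -> bool) (S : {set V}).
Hypothesis esym : sym3 e.
Notation n := (#|S|%:R : R).
Notation eps := (1 / 1000 : R).
Notation kap := (1 / 2000 : R).

Definition fresh (W : {set V}) (s : seq V) :=
  uniq s && all (fun v => (v \in S) && (v \notin W)) s.

Definition excl (X W : {set V}) (s : seq V) :=
  [set v in X | (v \notin W) && (v \notin s)].

Lemma freshS W v s :
  fresh W (v :: s) = [&& v \in S, v \notin W, v \notin s & fresh W s].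
Proof.
by rewrite /fresh /=; case: (v \in S); case: (v \in W); case: (v \in s);
  rewrite ?andbF.
Qed.

Lemma card_excl (X W : {set V}) s : #|X|%:R - #|W|%:R - (size s)%:R <= #|excl X W s|%:R :> R.
Proof.
have := card_setD_ge R X (W :|: [set:: s]).
have -> : X :\: (W :|: [set:: s]) = excl X W s.
  by apply/setP=> v; rewrite !inE negb_or andbC.
have h : (#|W :|: [set:: s]| <= #|W| + size s)%N.
  apply: (leq_trans (leq_card_setU _ _)); rewrite leq_add2l cardsE.
  exact: card_size.
have : #|W :|: [set:: s]|%:R <= #|W|%:R + (size s)%:R :> R.
  by rewrite -natrD ler_nat.
lra.
Qed.

(** One bound serves every choice in a connector or an absorber, since these have at most 7
    vertices. *)
Lemma excl_ge (X W : {set V}) s (c : R) :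
  #|W|%:R + 7 <= c -> (size s <= 7)%N -> 2 * c <= #|X|%:R ->
  c <= #|excl X W s|%:R.
Proof.
move=> h1 h2 h3; have := card_excl X W s.
have : (size s)%:R <= 7 :> R by rewrite ler_nat.
lra.
Qed.

Lemma in_excl (X W : {set V}) s v :
  (v \in excl X W s) = [&& v \in X, v \notin W & v \notin s].
Proof. by rewrite inE. Qed.

Lemma in_nbs x y z : (z \in nbs e S x y) = (z \in S) && e x y z.
Proof. by rewrite inE. Qed.

Lemma in_rich (c : R) x y :
  (y \in rich e S c x) = (y \in S) && (c * n <= #|nbs e S x y|%:R).
Proof. by rewrite inE. Qed.

Lemma nbsS x y : nbs e S x y \subset S.
Proof. by apply/subsetP=> z; rewrite inE => /andP[]. Qed.

Lemma richS (c : R) x : rich e S c x \subset S.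
Proof. by apply/subsetP=> z; rewrite inE => /andP[]. Qed.

Lemma poor_le (c : R) x : 0 <= c ->
  #|[set p in link e S x | p.1 \notin rich e S c x]|%:R <= c * n ^+ 2.
Proof.
move=> c0; rewrite expr2 mulrCA.
rewrite (_ : [set p in link e S x | p.1 \notin rich e S c x] = [set p | [&& p.1 \in S, p.1
    \notin rich e S c x, p.2 \in S & e x p.1 p.2]]); last first.
  by apply/setP=> p; rewrite !inE; case: (p.1 \in S); case: (p.2 \in S);
    case: (e _ _ _); case: (_ <= _).
apply: (card_pair_le (P := fun a b => [&& a \in S, a \notin rich e S c x, b \in S & e x a b])
    (X := S)) => [a b /and4P[]//|a aS].
case: (boolP (a \in rich e S c x)) => ha.
  rewrite (_ : [set b | _] = set0) ?cards0 ?mulr_ge0 //.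
  by apply/setP=> b; rewrite !inE /= andbF.
rewrite (_ : [set b | _] = nbs e S x a); last by apply/setP=> b; rewrite !inE aS.
by move: ha; rewrite inE aS /= -ltNge => /ltW.
Qed.

Lemma link_swap x (P : V -> V -> bool) :
  #|[set p in link e S x | P p.1 p.2]| = #|[set p in link e S x | P p.2 p.1]|.
Proof.
pose Q a b := [&& a \in S, b \in S & e x a b] && P a b.
rewrite (_ : [set p in link e S x | P p.1 p.2] = [set p | Q p.1 p.2]); last first.
  by apply/setP=> p; rewrite !inE.
rewrite (card_swap Q); apply: eq_card => p; rewrite !inE; congr (_ && _).
by rewrite andbCA (esym.2 x).
Qed.

(** All but [2 * eps * n ^+ 2] pairs of the link have both ends in the rich set [G], so [#|G|] is at
    least about the square root of 7/16 times [n]; and (21/32)^2 = 441/1024 lies just below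
    448/1024. Two rich sets thus share at least 5/16 of [S]. *)
Lemma rich_large x : mindeg e S (7 / 16 : R) -> x \in S ->
  21 / 32 * n <= #|rich e S eps x|%:R.
Proof.
move=> hd xS; have hx := hd _ xS.
pose G := rich e S eps x.
have sub : link e S x \subset setX G G :|: [set p in link e S x | p.1 \notin G]
   :|: [set p in link e S x | p.2 \notin G].
  move: (G) => G0; apply/subsetP=> -[p q]; rewrite !inE /= => ->.
  by case: (p \in G0); case: (q \in G0).
have h1 := @poor_le eps x ltac:(lra).
have h2 := h1; rewrite (link_swap x (fun a b => a \notin G)) in h2.
have h3 : #|link e S x|%:R <= #|G|%:R ^+ 2 + eps * n ^+ 2 + eps * n ^+ 2.
  apply: (@le_trans _ _ (#|setX G G|%:R + #|[set p in link e S x | p.1 \notin G]|%:R + #|[set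
      p in link e S x | p.2 \notin G]|%:R)).
    rewrite -!natrD ler_nat; apply: (leq_trans (subset_leq_card sub)).
    apply: (leq_trans (leq_card_setU _ _)); rewrite leq_add2r.
    exact: leq_card_setU.
  by rewrite cardsX natrM -expr2; apply: lerD => //; apply: lerD.
rewrite leNgt; apply/negP=> h4; rewrite -/G in h4.
have g0 : 0 <= #|G|%:R :> R by [].
have n0 : 0 < n by nra.
have : #|G|%:R ^+ 2 <= (21 / 32 * n) ^+ 2 by rewrite lerXn2r ?nnegrE //; lra.
nra.
Qed.

(** The middle vertex [y] comes first because it is chosen first: it has to be rich with both ends,
    after which [x] and [z] are independent choices in two large neighbourhoods. *)
Definition connector (a b : V) (W : {set V}) : {set V * (V * V)} :=
  [set t | let: (y, (x, z)) := t in [&& fresh W [:: z; x; y], e a x y & e y z b]].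

Lemma card_connector a b (W : {set V}) : mindeg e S (7 / 16 : R) ->
  a \in S -> b \in S -> #|W|%:R + 7 <= kap * n ->
  (kap * n) ^+ 3 <= #|connector a b W|%:R.
Proof.
move=> hd aS bS hW.
have k0 : 0 <= kap * n by rewrite mulr_ge0 //; lra.
rewrite (_ : (kap * n) ^+ 3 = (kap * n) * ((kap * n) * (kap * n))); last by ring.
pose Y := excl (rich e S eps a :&: rich e S eps b) W [::].
pose P y x z := [&& fresh W [:: z; x; y], e a x y & e y z b].
pose Q y (p : V * V) := P y p.1 p.2.
rewrite (_ : connector a b W = [set t | Q t.1 t.2]); last first.
  by apply/setP=> -[y [x z]]; rewrite !inE.
apply: (@card_pair_ge _ _ _ Y Q); first exact: mulr_ge0.
  apply: excl_ge => //.
  have := card_setI_ge R (richS eps a) (richS eps b).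
  have := rich_large hd aS; have := rich_large hd bS; have : 0 <= n by [].
  clear; lra.
move=> y; rewrite in_excl inE !in_rich -!andbA => /and5P[yS ya _ yb /andP[yW _]].
apply: (@card_pair_ge _ _ _ (excl (nbs e S a y) W [:: y])) => //.
  by apply: excl_ge => //; move: ya; clear; lra.
move=> x; rewrite in_excl in_nbs -andbA => /and4P[xS ex xW xy].
apply: (@le_trans _ _ #|excl (nbs e S b y) W [:: x; y]|%:R).
  by apply: excl_ge => //; move: yb; clear; lra.
rewrite ler_nat; apply: subset_leq_card; apply/subsetP=> z.
rewrite in_excl in_nbs -andbA => /and4P[zS ez zW zxy].
rewrite inE /P !freshS zS zW zxy xS xW xy yS yW /=.
by rewrite (esym.2 a) ex /= (esym.2 y) (esym.1 y) ez.
Qed.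

End Abundance.

(** * Absorbers *)

Section Absorbers.
Variables (R : realType) (V : finType) (e : V -> V -> V -> bool) (S : {set V}).
Hypothesis esym : sym3 e.
Notation n := (#|S|%:R : R).
Notation eps := (1 / 1000 : R).
Notation kap := (1 / 2000 : R).

(* [(v4, (v6, ((v3, v5), (v2, (v1, v7)))))]: the vertices of an absorber in the
   order in which they are chosen when absorbers are counted. *)
Definition septuple : finType := (V * (V * ((V * V) * (V * (V * V)))))%type.

(** Absorbing keeps the two outer edges, reordered, and replaces [v3 v4 v5] by [v2 x v4] and
    [v4 y v6]. The ends [v1] and [v7] stay. *)
Definition absorber (x y : V) (W : {set V}) : {set septuple} :=
  [set t | let: (v4, (v6, ((v3, v5), (v2, (v1, v7))))) := t in
    [&& fresh S W [:: v7; v1; v2; v5; v3; v6; v4],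
        [&& e v1 v2 v3, e v3 v4 v5 & e v5 v6 v7], e v2 x v4 & e v4 y v6]].

(** Supplies [v3] and [v5] around [v4], with [v5] rich towards [v6] so that [v7] exists. Pairs whose
    second vertex is not rich make up at most 11/32 of all ordered pairs, less than 7/16. *)
Lemma card_link_rich v u (W : {set V}) (s : seq V) :
  mindeg e S (7 / 16 : R) -> v \in S -> u \in S ->
  #|W|%:R + 7 <= kap * n -> (size s <= 2)%N ->
  (kap * n) ^+ 2 <= #|[set p | [&& p \in link e S v, p.2 \in rich e S eps u,
     p.1 \notin W, p.2 \notin W, p.1 \notin s & p.2 \notin p.1 :: s]]|%:R.
Proof.
move=> hd vS uS hW hs.
set Q := [set p | _].
pose X := W :|: [set:: s].
have cX : #|X|%:R <= #|W|%:R + 2 :> R.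
  rewrite -natrD ler_nat; apply: (leq_trans (leq_card_setU _ _)).
  rewrite leq_add2l cardsE; exact: (leq_trans (card_size _)).
pose B1 := [set p | (p.1 \in S) && (p.2 \in S :\: rich e S eps u)].
pose B2 := [set p | (p.1 \in X) && (p.2 \in S)].
pose B3 := [set p | (p.1 \in S) && (p.2 \in X)].
pose B4 := [set p | (p.1 \in S) && (p.2 == p.1)].
have sub : link e S v \subset Q :|: (B1 :|: (B2 :|: (B3 :|: B4))).
  apply/subsetP=> -[p q] hp; move: (hp).
  rewrite inE /= => /and3P[pS qS epq].
  rewrite !in_setU [_ \in Q]inE hp inE.
  rewrite [_ \in B2]inE [_ \in B3]inE [_ \in B4]inE /= !in_setU !inE /= pS qS /=.
  case: (_ <= _); case: (p \in W); case: (q \in W); case: (p \in s);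
  case: (q \in s); case: (q == p) => //=.
have b1 : #|B1|%:R <= 11 / 32 * n ^+ 2.
  rewrite (_ : B1 = setX S (S :\: rich e S eps u)); last first.
    by apply/setP=> -[p q]; rewrite !inE.
  have hs' : rich e S eps u :&: S = rich e S eps u.
    by apply/setIidPl; apply: richS.
  have := cardsID (rich e S eps u) S; rewrite setIC hs' => h.
  rewrite cardsX natrM.
  have : #|rich e S eps u|%:R + #|S :\: rich e S eps u|%:R = n by rewrite -natrD h.
  have := rich_large esym hd uS; have : 0 <= n by [].
  clear; nra.
have b2 : #|B2|%:R <= (#|W|%:R + 2) * n.
  rewrite (_ : B2 = setX X S); last by apply/setP=> -[p q]; rewrite !inE.
  by rewrite cardsX natrM ler_wpM2r.
have b3 : #|B3|%:R <= (#|W|%:R + 2) * n.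
  rewrite (_ : B3 = setX S X); last by apply/setP=> -[p q]; rewrite !inE.
  by rewrite cardsX natrM mulrC ler_wpM2r.
have b4 : #|B4|%:R <= n * 1.
  apply: (@card_pair_le _ _ _ S (fun p q => (p \in S) && (q == p))) => [a b /andP[]//|a aS].
  rewrite (_ : [set b | _] = [set a]) ?cards1 //.
  by apply/setP=> b; rewrite !inE aS.
have : #|link e S v|%:R <= #|Q|%:R + (#|B1|%:R + (#|B2|%:R + (#|B3|%:R + #|B4|%:R))) :> R.
  rewrite -!natrD ler_nat; apply: (leq_trans (subset_leq_card sub)).
  do 3! (apply: (leq_trans (leq_card_setU _ _)); rewrite leq_add2l).
  exact: leq_card_setU.
have := hd _ vS; move: b1 b2 b3 b4 hW.
have : 0 <= n by [].
have : 0 <= #|W|%:R :> R by [].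
clear.
move: (#|link _ _ _|%:R) (#|Q|%:R) (#|B1|%:R) (#|B2|%:R) (#|B3|%:R) (#|B4|%:R) (#|W|%:R) n.
move=> l q b1 b2 b3 b4 w m w0 m0 h1 h2 h3 h4 h5 h6 h7.
have : (w + 7) * m <= 1 / 2000 * m * m by rewrite ler_wpM2r.
rewrite exprMn; nra.
Qed.

(** The threshold 3/8 exceeds 1 - 21/32 = 11/32, so the neighbourhood of [x] and [v4] meets the rich
    set of [v3] in linearly many vertices; this is where [v2] is found. *)
Lemma card_absorber1 x y (W : {set V}) : mindeg e S (7 / 16 : R) ->
  x \in S -> y \in S -> #|W|%:R + 7 <= kap * n ->
  2 * (kap * n) <= #|rich e S (3 / 8 : R) x :&: rich e S eps y|%:R ->
  (kap * n) ^+ 7 <= #|absorber x y W|%:R.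
Proof.
move=> hd xS yS hW hX.
have k0 : 0 <= kap * n by rewrite mulr_ge0 //; lra.
have sz : (7%N)%:R = 7 :> R by [].
pose P7 v4 v6 v3 v5 v2 v1 v7 := (v4, (v6, ((v3, v5), (v2, (v1, v7))))) \in absorber x y W.
pose P6 v4 v6 v3 v5 v2 (p : V * V) := P7 v4 v6 v3 v5 v2 p.1 p.2.
pose P5 v4 v6 v3 v5 (p : V * (V * V)) := P6 v4 v6 v3 v5 p.1 p.2.
pose P4 v4 v6 (p : (V * V) * (V * (V * V))) := P5 v4 v6 p.1.1 p.1.2 p.2.
pose P3 v4 (p : V * ((V * V) * (V * (V * V)))) := P4 v4 p.1 p.2.
rewrite (_ : absorber x y W = [set t | P3 t.1 t.2]); last first.
  by apply/setP=> -[v4 [v6 [[v3 v5] [v2 [v1 v7]]]]]; rewrite [in RHS]inE.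
rewrite (_ : (kap * n) ^+ 7 = (kap * n) * ((kap * n) * ((kap * n) ^+ 2 * ((kap * n) * ((kap *
    n) * (kap * n)))))); last by ring.
apply: (@card_pair_ge _ _ _ (excl (rich e S (3 / 8 : R) x :&: rich e S eps y) W [::]) P3).
- by do ?[exact: k0 | apply: exprn_ge0 | apply: mulr_ge0].
- exact: excl_ge.
move=> v4; rewrite in_excl inE !in_rich -!andbA => /and5P[v4S v4x _ v4y /andP[v4W v4s]].
apply: (@card_pair_ge _ _ _ (excl (nbs e S y v4) W [:: v4]) (P4 v4)).
- by do ?[exact: k0 | apply: exprn_ge0 | apply: mulr_ge0].
- by apply: excl_ge => //; move: v4y; clear; lra.
move=> v6; rewrite in_excl in_nbs -andbA => /and4P[v6S e6 v6W v6s].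
apply: (@card_pair_ge _ _ _ _ (fun q => P5 v4 v6 q.1 q.2) _ _ _ (@card_link_rich v4 v6 W [::
    v6; v4] hd v4S v6S hW isT)).
  by do ?[exact: k0 | apply: exprn_ge0 | apply: mulr_ge0].
move=> [v3 v5]; rewrite inE [_ \in link _ _ _]inE /= => /and5P[/and3P[v3S v5S e345] v5r v3W
    v5W /andP[v3s v5s]].
move: v5r; rewrite in_rich => /andP[_ v5r].
have h3 : 2 * (kap * n) <= #|nbs e S x v4 :&: rich e S eps v3|%:R.
  have := card_setI_ge R (nbsS e S x v4) (richS e S eps v3).
  have := rich_large esym hd v3S; move: v4x.
  have : 0 <= n by [].
  clear; lra.
apply: (@card_pair_ge _ _ _ (excl (nbs e S x v4 :&: rich e S eps v3) W [:: v5; v3; v6; v4])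
    (P6 v4 v6 v3 v5)).
- exact: mulr_ge0.
- exact: excl_ge.
move=> v2; rewrite in_excl inE in_nbs in_rich -!andbA => /and5P[v2S e2 _ v23 /andP[v2W v2s]].
apply: (@card_pair_ge _ _ _ (excl (nbs e S v3 v2) W [:: v2; v5; v3; v6; v4]) (P7 v4 v6 v3 v5
    v2)).
- by [].
- by apply: excl_ge => //; move: v23; clear; lra.
move=> v1; rewrite in_excl in_nbs -!andbA => /and4P[v1S e1 v1W v1s].
apply: (@le_trans _ _ #|excl (nbs e S v6 v5) W [:: v1; v2; v5; v3; v6; v4]|%:R).
  by apply: excl_ge => //; move: v5r; clear; lra.
rewrite ler_nat; apply: subset_leq_card; apply/subsetP=> v7.
rewrite in_excl in_nbs -andbA => /and4P[v7S e7 v7W v7s].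
rewrite inE /P7 inE !freshS v7S v7W v7s v1S v1W v1s v2S v2W v2s v5S v5W v5s.
rewrite v3S v3W v3s v6S v6W v6s v4S v4W v4s /=.
have [s1 s2] := esym.
have -> : e v1 v2 v3 by rewrite s1 s2 s1.
by rewrite s1 e345 s1 e7 s1 s2 e2 s1 e6.
Qed.

(** Reading an absorber backwards exchanges the roles of [x] and [y]. *)
Lemma card_absorber_rev x y (W : {set V}) :
  #|absorber x y W| = #|absorber y x W|.
Proof.
pose f (t : septuple) : septuple := let: (v4, (v6, ((v3, v5), (v2, (v1, v7))))) := t in
  (v4, (v2, ((v5, v3), (v6, (v7, v1))))).
have fK : involutive f by move=> [v4 [v6 [[v3 v5] [v2 [v1 v7]]]]].
have [s1 s2] := esym.
have r13 a b c : e a b c = e c b a by rewrite s1 s2 s1.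
have sub a b t : t \in absorber a b W -> f t \in absorber b a W.
  case: t => [v4 [v6 [[v3 v5] [v2 [v1 v7]]]]]; rewrite !inE.
  case/and3P=> hf /and3P[h1 h2 h3] /andP[h4 h5].
  apply/and3P; split.
  - suff hp : perm_eq [:: v7; v1; v2; v5; v3; v6; v4] [:: v1; v7; v6; v3; v5; v2; v4].
      by move: hf; rewrite /fresh (perm_uniq hp) (perm_all _ hp).
    apply/permP=> p /=.
    move: (nat_of_bool (p v7)) (nat_of_bool (p v1)) (nat_of_bool (p v2)) => a1 a2 a3.
    move: (nat_of_bool (p v5)) (nat_of_bool (p v3)) (nat_of_bool (p v6)) => a4 a5 a6.
    by move: (nat_of_bool (p v4)) => a7; clear; lia.
  - by rewrite r13 h3 r13 h2 r13 h1.
  - by rewrite r13 h5 r13 h4.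
apply/eqP; rewrite eqn_leq; apply/andP; split.
  rewrite -(card_imset _ (inv_inj fK)); apply: subset_leq_card.
  by apply/subsetP=> _ /imsetP[t ht ->]; apply: sub.
rewrite -(card_imset _ (inv_inj fK)); apply: subset_leq_card.
by apply/subsetP=> _ /imsetP[t ht ->]; apply: sub.
Qed.

(** [card_absorber1] applies to [(x, y)] or to [(y, x)]. If both failed, the vertices of codegree
    3/8 with one of them would nearly avoid the rich set of the other, and the link of the one with
    the smaller rich set would be too small. *)
Lemma card_absorber x y (W : {set V}) : mindeg e S (7 / 16 : R) ->
  x \in S -> y \in S -> #|W|%:R + 7 <= kap * n ->
  (kap * n) ^+ 7 <= #|absorber x y W|%:R.
Proof.
move=> hd xS yS hW.
have n0 : 0 <= n by [].
case: (lerP (2 * (kap * n)) #|rich e S (3 / 8 : R) x :&: rich e S eps y|%:R) => [|hx].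
  exact: card_absorber1.
case: (lerP (2 * (kap * n)) #|rich e S (3 / 8 : R) y :&: rich e S eps x|%:R) => [|hy].
  by rewrite card_absorber_rev; apply: card_absorber1.
exfalso.
have key u v : u \in S -> v \in S ->
    #|rich e S (3 / 8 : R) u :&: rich e S eps v|%:R < 2 * (kap * n) ->
    7 / 16 * n ^+ 2 <= (n - #|rich e S eps v|%:R + 2 * (kap * n)) * #|rich e S eps u|%:R
      + (#|rich e S eps u|%:R + #|rich e S eps v|%:R - n) * (3 / 8 * n) + 2 * eps * n ^+ 2.
  move=> uS vS huv.
  set A := rich e S eps u; set T := rich e S (3 / 8 : R) u.
  have TA : T \subset A.
    apply/subsetP=> z; rewrite !in_rich => /andP[-> /=]; apply: le_trans.
    by rewrite ler_wpM2r //; lra.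
  have hT : #|T|%:R <= n - #|rich e S eps v|%:R + 2 * (kap * n).
    have := card_setI_ge R (richS e S (3 / 8 : R) u) (richS e S eps v).
    by move: huv; rewrite -/T; clear; lra.
  have hAv : #|rich e S eps v|%:R >= 21 / 32 * n by apply: rich_large.
  have hA : #|A|%:R >= 21 / 32 * n by apply: rich_large.
  (* A pair of the link goes from [T] to [A], or starts in [A :\: T], where fewer than [3 / 8 * n]
     continuations exist, or has an end outside [A]. *)
  pose B1 := [set p | (p.1 \in T) && (p.2 \in A)].
  pose B2 := [set p | (p.1 \in A :\: T) && (p.2 \in nbs e S u p.1)].
  pose B3 := [set p in link e S u | p.1 \notin A].
  pose B4 := [set p in link e S u | p.2 \notin A].
  have sub : link e S u \subset B1 :|: (B2 :|: (B3 :|: B4)).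
    apply/subsetP=> -[p q] hp; move: (hp).
    rewrite inE /= => /and3P[pS qS epq].
    rewrite !in_setU [_ \in B1]inE [_ \in B2]inE [_ \in B3]inE [_ \in B4]inE hp.
    rewrite /= in_setD in_nbs qS epq.
    by case: (p \in T); case: (p \in A); case: (q \in A).
  have b1 : #|B1|%:R = #|T|%:R * #|A|%:R :> R.
    have -> : B1 = setX T A by apply/setP=> -[p q]; rewrite in_setX inE.
    by rewrite cardsX natrM.
  have b2 : #|B2|%:R <= #|A :\: T|%:R * (3 / 8 * n).
    apply: (@card_pair_le _ _ _ (A :\: T) (fun p q => (p \in A :\: T) && (q \in nbs e S u
        p))) => [a b /andP[]//|a aAT].
    rewrite (_ : [set b | _] = nbs e S u a); last first.
      by apply/setP=> b; rewrite inE aAT.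
    move: aAT; rewrite inE !in_rich => /and3P[h aS _].
    by move: h; rewrite aS /= -ltNge => /ltW.
  have e0 : 0 <= eps by rewrite divr_ge0.
  have b3 : #|B3|%:R <= eps * n ^+ 2 by apply: poor_le.
  have b4 : #|B4|%:R <= eps * n ^+ 2.
    have := poor_le e S u e0.
    by rewrite (link_swap S esym u (fun a b => a \notin A)).
  have cA : #|T|%:R + #|A :\: T|%:R = #|A|%:R :> R.
    by rewrite -natrD -(cardsID T A) (setIidPr TA).
  have : #|link e S u|%:R <= #|B1|%:R + (#|B2|%:R + (#|B3|%:R + #|B4|%:R)) :> R.
    rewrite -!natrD ler_nat; apply: (leq_trans (subset_leq_card sub)).
    do 2! (apply: (leq_trans (leq_card_setU _ _)); rewrite leq_add2l).
    exact: leq_card_setU.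
  have := hd _ uS; rewrite b1.
  have T0 : 0 <= #|T|%:R :> R by [].
  move: b2 b3 b4 cA hT hAv hA T0 n0; clear.
  move: (#|link _ _ _|%:R) (#|B2|%:R) (#|B3|%:R) (#|B4|%:R) (#|T|%:R) (#|A|%:R)
    (#|A :\: T|%:R) (#|rich _ _ _ v|%:R) n.
  move=> l b2 b3 b4 t a d b m h1 h2 h3 h4 h5 h6 h7 h8 h9 h10 h11.
  have hd : d = a - t by lra.
  rewrite hd in h1.
  have : t * (a - 3 / 8 * m) <= (m - b + 2 * (1 / 2000 * m)) * (a - 3 / 8 * m).
    by apply: ler_wpM2r => //; lra.
  nra.
have kx := key x y xS yS hx; have ky := key y x yS xS hy.
have ax := rich_large esym hd xS; have ay := rich_large esym hd yS.
have lx : #|rich e S eps x|%:R <= n by rewrite ler_nat subset_leq_card // richS.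
have ly : #|rich e S eps y|%:R <= n by rewrite ler_nat subset_leq_card // richS.
have n1 : 0 < n.
  rewrite lt_neqAle n0 andbT eq_sym pnatr_eq0 cards_eq0.
  by apply/eqP=> S0; rewrite S0 inE in xS.
move: kx ky ax ay lx ly n1; clear.
move: (#|rich _ _ _ x|%:R) (#|rich _ _ _ y|%:R) n => a b m.
wlog : a b / b <= a => [h|hab] kx ky ax ay lx ly m0.
  case: (lerP b a) => [/h|/ltW/h]; first exact.
  by apply.
(* Apart from the term with 1/2000, the left side decreases in [a], and at [a = b] it is
   [25 / 64 * m ^+ 2 - (b - 7 / 8 * m) ^+ 2]; but 7/16 is 28/64. *)
have h1 : (m - a + 2 * (1 / 2000 * m)) * b + (a + b - m) * (3 / 8 * m) <=
    25 / 64 * m ^+ 2 + 2 / 2000 * m ^+ 2.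
  have : 0 <= (b - 7 / 8 * m) ^+ 2 by apply: sqr_ge0.
  have : 0 <= (a - b) * (b - 3 / 8 * m) by apply: mulr_ge0; lra.
  have : m * b <= m * m by apply: ler_wpM2l => //; apply: ltW.
  nra.
have : 0 < m ^+ 2 by rewrite exprn_gt0.
move: ky h1; rewrite [b + a]addrC; lra.
Qed.
End Absorbers.

(** * Greedy selection of disjoint families *)

Section Selection.
Variables (R : realType) (V T I : finType) (supp : T -> {set V}).
Variables (J : {set I}) (B : I -> {set T}).

Let weight (s : seq T) : R := \sum_(i in J) (1 / 2) ^+ count (mem (B i)) s.

(** Averaging: among the tuples still disjoint from everything used, a proportion at least [c] is
    good for a given [i] and halves its term. Hence some tuple multiplies the potential by at most
    [1 - c / 2]. *)
Lemma greedy_family (W0 : {set V}) (N c : R) (K k m : nat) :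
  (0 < #|J|)%N -> 0 < N -> 0 < c ->
  (forall i t, i \in J -> t \in B i -> (#|supp t| <= k)%N) ->
  #|\bigcup_(i in J) B i|%:R <= N ->
  (forall (W : {set V}) i, i \in J -> (#|W| <= K)%N ->
     c * N <= #|[set t in B i | [disjoint supp t & W]]|%:R) ->
  (#|W0| + k * m <= K)%N ->
  exists s, [/\ size s = m,
    pairwise (fun t t' => [disjoint supp t & supp t']) s,
    {in s, forall t, [disjoint supp t & W0]},
    {in s, forall t, exists2 i, i \in J & t \in B i} &
    weight s <= #|J|%:R * (1 - c / 2) ^+ m].
Proof.
move=> J0 N0 c0 hk hN hB; elim: m => [|m IH] hm.
  exists [::]; split => //; rewrite /weight /= expr0 mulr1.
  by rewrite (eq_bigr (fun=> 1)) ?sumr_const // => i _; rewrite expr0.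
have [|s [ss sd sW sB sw]] := IH; first by lia.
pose W := W0 :|: \bigcup_(t <- s) supp t.
have cW : (#|W| <= K)%N.
  apply: leq_trans (leq_card_setU _ _) _.
  suff : (#|\bigcup_(t <- s) supp t| <= k * size s)%N by rewrite ss; lia.
  have : {in s, forall t, #|supp t| <= k}%N.
    by move=> t /sB[i iJ ti]; apply: (hk i).
  elim: (s) => [|t s' IHs] h; first by rewrite big_nil cards0.
  rewrite big_cons; apply: leq_trans (leq_card_setU _ _) _.
  have h1 := h t (mem_head _ _).
  have h2 : (#|\bigcup_(t0 <- s') supp t0| <= k * size s')%N.
    by apply: IHs => t' ht'; apply: h; rewrite inE ht' orbT.
  by rewrite /= mulnS; lia.
pose L := [set t in \bigcup_(i in J) B i | [disjoint supp t & W]].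
have LN : #|L|%:R <= N.
  apply: le_trans hN; rewrite ler_nat; apply: subset_leq_card.
  by apply/subsetP=> t; rewrite inE => /andP[].
have LB i : i \in J -> [set t in L | t \in B i] = [set t in B i | [disjoint supp t & W]].
  move=> iJ; apply/setP=> t; rewrite !inE.
  case tB: (t \in B i); rewrite ?andbT ?andbF //=.
  by rewrite (_ : _ \in _) //; apply/bigcupP; exists i.
have [i0 i0J] := card_gt0P J0.
have L0 : 0 < #|L|%:R :> R.
  apply: (@lt_le_trans _ _ (c * N)); first exact: mulr_gt0.
  apply: (le_trans (hB W i0 i0J cW)); rewrite ler_nat -LB //.
  by apply: subset_leq_card; apply/subsetP=> t; rewrite inE => /andP[].
have key : \sum_(t in L) weight (t :: s) <= \sum_(t in L) ((1 - c / 2) * weight s).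
  rewrite sumr_const -[X in _ <= X]mulr_natl /weight exchange_big mulrCA mulr_sumr mulr_sumr /=.
  apply: ler_sum => i iJ.
  set f := (1 / 2) ^+ _.
  have f0 : 0 <= f by rewrite exprn_ge0 // divr_ge0.
  rewrite (eq_bigr (fun t => f - f / 2 * (t \in B i)%:R)); last first.
    move=> t _; rewrite exprD -/f; case: (t \in B i) => /=; first by field.
    by rewrite expr0; ring.
  rewrite sumrB sumr_const -mulr_sumr -natr_sum.
  rewrite (_ : (\sum_(t in L) (t \in B i))%N = #|[set t in L | t \in B i]|); last first.
    rewrite -sum1_card big_mkcond [RHS]big_mkcond /=; apply: eq_bigr => t _.
    by rewrite [in RHS]inE; case: (t \in L); case: (t \in B i).
  rewrite LB //; have hBi := hB W i iJ cW.
  rewrite -(mulr_natl f).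
  have : c * #|L|%:R <= #|[set t in B i | [disjoint supp t & W]]|%:R.
    by apply: le_trans hBi; rewrite ler_pM2l.
  move: f0; clear; move: f (#|_|%:R) (#|L|%:R) => f b l f0 h.
  have : f * (c * l) <= f * b by rewrite ler_wpM2l.
  lra.
have [t tL ht] : exists2 t, t \in L & weight (t :: s) <= (1 - c / 2) * weight s.
  apply/exists_inP; apply: contraT; rewrite negb_exists_in => /forall_inP h.
  have [t1 t1L] : exists t, t \in L by apply/card_gt0P; rewrite -(ltr_nat R).
  move: key; rewrite leNgt => /negP[]; apply: ltr_sum.
    by apply/hasP; exists t1; rewrite ?mem_index_enum.
  by move=> t /h; rewrite -ltNge.
move: (tL); rewrite inE disjoint_sym => /andP[/bigcupP[i iJ ti] /=].
rewrite disjointUl => /andP[tW ts].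
exists (t :: s); split.
- by rewrite /= ss.
- rewrite /= sd andbT; apply/allP=> t' t's /=.
  rewrite disjoint_sym; apply: disjointWl ts.
  by rewrite bigcup_seq; apply: (bigcup_sup t').
- by move=> t'; rewrite inE => /orP[/eqP->|/sW//]; rewrite disjoint_sym.
- by move=> t'; rewrite inE => /orP[/eqP->|/sB//]; exists i.
apply: (le_trans ht); rewrite exprS mulrCA.
(* Multiplying the induction hypothesis needs [1 - c / 2] non-negative; [c > 2] would ask for more
   good tuples than [L] contains. *)
case: (lerP 0 (1 - c / 2)) => h; first by rewrite ler_wpM2l.
exfalso; move: L0 (hB W i iJ cW); rewrite -LB //.
have : #|[set t0 in L | t0 \in B i]|%:R <= #|L|%:R :> R.
  by rewrite ler_nat subset_leq_card //; apply/subsetP=> u; rewrite inE => /andP[].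
have : c * #|L|%:R <= c * N by rewrite ler_pM2l.
move: h; clear; move: (#|_|%:R) (#|L|%:R) => b l; nra.
Qed.

End Selection.

(** The square is the number of ordered pairs of vertices to be served. In terms of [b], about n /
    (3 Q), the left side is quadratic and the right side at least (b + 1)^3. *)
Lemma sq_lt_exp2 (Q : nat) : (0 < Q)%N ->
  exists n0, forall n, (n0 <= n)%N -> (n ^ 2 < 2 ^ (n %/ Q))%N.
Proof.
move=> Q0; exists (Q * (27 * Q ^ 2 + 3))%N => n hn.
pose a := (n %/ Q)%N; pose b := (a %/ 3)%N.
have hn2 : (n < Q * a.+1)%N by rewrite mulnC ltn_ceil.
have ha : (27 * Q ^ 2 + 3 <= a)%N by rewrite leq_divRL // mulnC.
have hb : (9 * Q ^ 2 < b.+1)%N by rewrite ltnS leq_divRL //; move: ha; clear; lia.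
have hab : (a.+1 <= 3 * b.+1)%N by rewrite mulnC; apply: ltn_ceil.
have h2a : ((b.+1) ^ 3 <= 2 ^ a)%N.
  apply: (@leq_trans (2 ^ (b * 3))); last by rewrite leq_exp2l // leq_trunc_div.
  by rewrite expnM leq_exp2r // ltn_expl.
apply: leq_trans h2a; apply: (@leq_ltn_trans ((Q * (3 * b.+1)) ^ 2)).
  rewrite leq_exp2r //; apply: (leq_trans (ltnW hn2)).
  by rewrite leq_mul2l hab orbT.
by rewrite !expnMn mulnA expnS ltn_pmul2r ?expn_gt0 // mulnC.
Qed.

(** Bernoulli for [1 + c / 2], whose product with [1 - c / 2] is at most 1. The value 1/4 rather
    than 1/2 leaves room for the factor [#|J|] in [selection]. *)
Lemma small_power (R : realType) (c : R) : 0 < c -> c <= 1 ->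
  exists2 q, (0 < q)%N & (1 - c / 2) ^+ q <= 1 / 4.
Proof.
move=> c0 c1; have [q hq] := @eventually_ge R 8 c c0; exists q.+1 => //.
have bern m : 1 + m%:R * (c / 2) <= (1 + c / 2) ^+ m.
  elim: m => [|m IH]; first by rewrite mul0r addr0 expr0.
  have m0 : 0 <= m%:R :> R by [].
  have : (1 + c / 2) * (1 + m%:R * (c / 2)) <= (1 + c / 2) ^+ m.+1.
    by rewrite exprS ler_wpM2l //; lra.
  have : 0 <= m%:R * (c * c) by rewrite !mulr_ge0 // ltW.
  by rewrite -(natr1 m); clear; lra.
have h4 : 4 <= (1 + c / 2) ^+ q.+1.
  apply: le_trans (bern q.+1); have := hq q.+1 (leqnSn q); lra.
have h1 : (1 - c / 2) ^+ q.+1 * (1 + c / 2) ^+ q.+1 <= 1.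
  rewrite -exprMn exprn_ile1 //; nra.
have h0 : 0 <= (1 - c / 2) ^+ q.+1 by rewrite exprn_ge0 //; lra.
move: h4 h1 h0; clear; move: (_ ^+ q.+1) (_ ^+ q.+1) => x y; nra.
Qed.

(** With r about n / Q, after [q * r] greedy choices the potential is at most [#|J|] times 4^-r,
    hence below 2^-r, while an [i] with fewer than r good tuples would contribute 2^-r alone. *)
Lemma selection (R : realType) (c eps : R) (k : nat) :
  0 < c -> c <= 1 -> 0 < eps ->
  exists Q n0 : nat, (0 < Q)%N /\
  forall n : nat, (n0 <= n)%N ->
  forall (V T I : finType) (supp : T -> {set V}) (J : {set I})
    (B : I -> {set T}) (W0 : {set V}) (N : R),
  (0 < #|J| <= n ^ 2)%N -> 0 < N ->
  (forall i t, i \in J -> t \in B i -> (#|supp t| <= k)%N) ->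
  #|\bigcup_(i in J) B i|%:R <= N ->
  (forall (W : {set V}) i, i \in J -> #|W|%:R <= #|W0|%:R + eps * n%:R ->
     c * N <= #|[set t in B i | [disjoint supp t & W]]|%:R) ->
  exists s, [/\ (k * size s)%:R <= eps * n%:R,
    pairwise (fun t t' => [disjoint supp t & supp t']) s,
    {in s, forall t, [disjoint supp t & W0]},
    {in s, forall t, exists2 i, i \in J & t \in B i} &
    {in J, forall i, n %/ Q <= count (mem (B i)) s}%N].
Proof.
move=> c0 c1 e0; have [q q0 hq] := small_power c0 c1.
(* [Q] is so large that [k * q] vertices for each of n / Q steps stay within [eps * n]. *)
have [Q hQ] := @eventually_ge R (k * q)%:R eps e0.
have [n0 hn0] := sq_lt_exp2 (ltn0Sn Q).
exists Q.+1, n0; split=> // n hn V T I supp J B W0 N /andP[J0 Jn] N0 hk hN hB.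
pose r := (n %/ Q.+1)%N; pose m := (q * r)%N.
have hm : (k * m)%:R <= eps * n%:R.
  have h1 : (r * Q.+1 <= n)%N by apply: leq_trunc_div.
  have h2 := hQ Q.+1 (leqnSn Q).
  have : (r * Q.+1)%:R <= n%:R :> R by rewrite ler_nat.
  have r0 : 0 <= r%:R :> R by [].
  have : (k * q)%:R * r%:R <= eps * Q.+1%:R * r%:R by apply: ler_wpM2r.
  rewrite /m mulnA !natrM.
  have h3 : eps * (r%:R * Q.+1%:R) <= eps * n%:R ->
    k%:R * q%:R * r%:R <= eps * Q.+1%:R * r%:R ->
    k%:R * q%:R * r%:R <= eps * n%:R :> R.
    by move=> h h'; apply: (le_trans h'); rewrite -mulrA [_ * r%:R]mulrC.
  by move=> h h'; apply: h3 => //; rewrite ler_pM2l.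
have [||s [ss s1 s2 s3 s4]] := @greedy_family R V T I supp J B W0 N c (#|W0| + k * m) k m J0
    N0 c0 hk hN.
- move=> W i iJ hW; apply: hB => //.
  by apply: (@le_trans _ _ (#|W0| + k * m)%:R); rewrite ?ler_nat // natrD lerD2l.
- by [].
exists s; split => //; first by rewrite ss.
move=> i iJ; rewrite leqNgt; apply/negP=> hlt.
have h1 : (1 / 2 : R) ^+ count (mem (B i)) s <= #|J|%:R * (1 - c / 2) ^+ m.
  apply: le_trans s4; rewrite (bigD1 i) //= lerDl sumr_ge0 // => j _.
  by rewrite exprn_ge0 // divr_ge0.
have h2 : (1 - c / 2) ^+ m <= (1 / 4 : R) ^+ r.
  rewrite /m exprM lerXn2r // nnegrE ?divr_ge0 // exprn_ge0 //; lra.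
have h3 : (1 / 2 : R) ^+ r <= (1 / 2) ^+ count (mem (B i)) s.
  rewrite ler_wiXn2l ?divr_ge0 //; first by lra.
  exact: ltnW.
have h4 : #|J|%:R < 2 ^+ r :> R.
  by rewrite -natrX ltr_nat; apply: leq_ltn_trans Jn (hn0 _ hn).
have h5 : (1 / 2 : R) ^+ r <= #|J|%:R * (1 / 4) ^+ r.
  apply: (le_trans h3); apply: (le_trans h1); exact: ler_wpM2l.
have : (1 / 2 : R) ^+ r < 2 ^+ r * (1 / 4) ^+ r.
  by apply: (le_lt_trans h5); rewrite ltr_pM2r // exprn_gt0 // divr_gt0.
by rewrite -exprMn (_ : 2 * (1 / 4) = 1 / 2 :> R) ?ltxx //; lra.
Qed.

(** * Complete tripartite subgraphs and tiles *)

Lemma ex_subset (T : finType) (A : {set T}) k : (k <= #|A|)%N ->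
  exists2 B : {set T}, B \subset A & #|B| = k.
Proof.
move=> kA; exists [set:: take k (enum A)].
  by apply/subsetP=> x; rewrite inE => /mem_take; rewrite mem_enum.
rewrite cardsE; have := take_uniq k (enum_uniq A) => /card_uniqP ->.
by rewrite size_take_min -cardE; apply/minn_idPl.
Qed.

Lemma sum_card_in (T : finType) (A : {set T}) (P : T -> bool) :
  (\sum_(x in A) P x)%N = #|[set x in A | P x]|.
Proof.
rewrite -sum1_card big_mkcond [RHS]big_mkcond /=; apply: eq_bigr => x _.
by rewrite [in RHS]inE; case: (x \in A); case: (P x).
Qed.

(* Restricting first to the [b] with many neighbours in [A] makes the degree
   condition survive every later shrinking of the second side. *)
Lemma pigeonhole (R : realType) (eta : R) (t : nat) : 0 < eta ->
  exists (c : R) (T0 : nat), 0 < c /\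
  forall (X Y : finType) (A : {set X}) (B : {set Y}) (f : X -> Y -> bool),
  (T0 <= #|A|)%N ->
  eta * #|A|%:R * #|B|%:R <= (\sum_(a in A) \sum_(b in B) f a b)%:R ->
  exists A' : {set X}, [/\ A' \subset A, #|A'| = t &
    c * #|B|%:R <= #|[set b in B | [forall a in A', f a b]]|%:R].
Proof.
move=> e0; have [n0 hn0] := @eventually_ge R (4 * t%:R) eta e0.
exists (eta / 2 * (eta / 4) ^+ t), (n0 + t.+1)%N; split.
  by rewrite mulr_gt0 ?exprn_gt0 // divr_gt0.
move=> X Y A B f hA hAB.
have A0 : 0 < #|A|%:R :> R by rewrite ltr0n; lia.
have At : 4 * t%:R <= eta * #|A|%:R by apply: hn0; lia.
have ltA : (t < #|A|)%N by lia.
pose N b := [set a in A | f a b].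
pose B' := [set b in B | eta / 2 * #|A|%:R <= #|N b|%:R].
have hB' : eta / 2 * #|B|%:R <= #|B'|%:R.
  have h1 : (\sum_(a in A) \sum_(b in B) f a b)%:R <=
      #|B'|%:R * #|A|%:R + #|B|%:R * (eta / 2 * #|A|%:R) :> R.
    rewrite exchange_big natr_sum /=.
    rewrite (eq_bigr (fun b => #|N b|%:R)); last by move=> b _; rewrite sum_card_in.
    rewrite (big_setID B') /=; apply: lerD.
      apply: (@le_trans _ _ (\sum_(b in B :&: B') #|A|%:R)).
        apply: ler_sum => b _; rewrite ler_nat subset_leq_card //.
        by apply/subsetP=> a; rewrite inE => /andP[].
      rewrite sumr_const -[X in X <= _]mulr_natl ler_wpM2r // ler_nat subset_leq_card //.
      exact: subsetIr.
    apply: (@le_trans _ _ (\sum_(b in B :\: B') (eta / 2 * #|A|%:R))).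
      apply: ler_sum => b; rewrite !inE => /andP[h bB]; move: h.
      by rewrite bB /= -ltNge => /ltW.
    rewrite sumr_const -[X in X <= _]mulr_natl ler_wpM2r //.
      by rewrite mulr_ge0 ?divr_ge0 // ltW.
    by rewrite ler_nat subset_leq_card // subsetDl.
  rewrite -(ler_pM2r A0); move: (le_trans hAB h1); clear.
  by move: (#|A|%:R) (#|B|%:R) (#|B'|%:R) => a b b'; lra.
suff step k : (k <= t)%N -> exists A' : {set X}, [/\ A' \subset A, #|A'| = k &
    eta / 2 * (eta / 4) ^+ k * #|B|%:R <= #|[set b in B' | [forall a in A', f a b]]|%:R].
  have [A' [h1 h2 h3]] := step t (leqnn t); exists A'; split=> //.
  apply: (le_trans h3); rewrite ler_nat subset_leq_card //.
  by apply/subsetP=> b; rewrite !inE => /andP[/andP[-> _] ->].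
elim: k => [_|k IH hk].
  exists set0; split; rewrite ?sub0set ?cards0 // expr0 mulr1.
  apply: (le_trans hB'); rewrite ler_nat subset_leq_card //.
  apply/subsetP=> b hb; rewrite inE hb /=; apply/forall_inP=> a.
  by rewrite inE.
have [|A' [h1 h2 h3]] := IH; first exact: ltnW.
set Bk := [set b in B' | _] in h3.
have cD : #|A :\: A'|%:R = #|A|%:R - k%:R :> R.
  by rewrite cardsD (setIidPr h1) h2 natrB //; lia.
have kt : k%:R <= t%:R :> R by rewrite ler_nat ltnW.
(* The [k] vertices chosen so far cost each [b] at most [eta / 4 * #|A|] of its neighbours, because
   [4 * t <= eta * #|A|]. *)
have hsum : #|Bk|%:R * (eta / 4 * #|A|%:R) <=
    \sum_(a in A :\: A') #|[set b in Bk | f a b]|%:R.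
  rewrite (eq_bigr (fun a => (\sum_(b in Bk) f a b)%:R)); last first.
    by move=> a _; rewrite sum_card_in.
  rewrite -natr_sum exchange_big natr_sum /=.
  rewrite mulr_natl -sumr_const; apply: ler_sum => b bBk.
  rewrite sum_card_in.
  have : #|N b|%:R - #|A'|%:R <= #|[set a in A :\: A' | f a b]|%:R :> R.
    apply: (le_trans (card_setD_ge R _ _)); rewrite ler_nat subset_leq_card //.
    by apply/subsetP=> a; rewrite !inE => /and3P[-> -> ->].
  have : eta / 2 * #|A|%:R <= #|N b|%:R.
    by move: bBk; rewrite inE => /andP[]; rewrite inE => /andP[].
  rewrite h2; move: At kt; clear.
  by move: (#|_|%:R) (#|_|%:R) (#|A|%:R) => a b' c; lra.
have [a aA ha] : exists2 a, a \in A :\: A' & eta / 4 * #|Bk|%:R <= #|[set b in Bk | f a b]|%:R.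
  apply/exists_inP; apply: contraT; rewrite negb_exists_in => /forall_inP h.
  have [a1 a1A] : exists a, a \in A :\: A'.
    by apply/card_gt0P; rewrite cardsD (setIidPr h1) h2 subn_gt0 (leq_trans hk) // ltnW.
  have : \sum_(a in A :\: A') #|[set b in Bk | f a b]|%:R <
      \sum_(a in A :\: A') (eta / 4 * #|Bk|%:R).
    apply: ltr_sum; first by apply/hasP; exists a1; rewrite ?mem_index_enum.
    by move=> a /h; rewrite -ltNge.
  rewrite sumr_const -[X in _ < X]mulr_natl cD => hlt.
  have := le_lt_trans hsum hlt.
  have : 0 <= k%:R * (eta / 4 * #|Bk|%:R) by rewrite mulr_ge0 // mulr_ge0 // divr_ge0 // ltW.
  clear; move: (#|A|%:R) (#|Bk|%:R) (k%:R) => a b c; lra.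
exists (a |: A'); move: (aA); rewrite inE => /andP[aA' aA2]; split.
- by rewrite subUset sub1set aA2.
- by rewrite cardsU1 aA' h2.
apply: (@le_trans _ _ #|[set b in Bk | f a b]|%:R).
  apply: le_trans ha; rewrite exprS.
  have : eta / 4 * (eta / 2 * (eta / 4) ^+ k * #|B|%:R) <= eta / 4 * #|Bk|%:R.
    by rewrite ler_wpM2l // divr_ge0 // ltW.
  by apply: le_trans; rewrite le_eqVlt; apply/orP; left; apply/eqP; ring.
rewrite ler_nat subset_leq_card //; apply/subsetP=> b; rewrite inE.
case/andP=> hb fab; move: hb; rewrite /Bk inE => /andP[bB' /forall_inP hb].
rewrite inE bB' /=; apply/forall_inP=> a2; rewrite in_setU1 => /orP[/eqP->//|].
exact: hb.
Qed.

Definition e3 (V : finType) (e : V -> V -> V -> bool) (X Y Z : {set V}) : nat :=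
  (\sum_(x in X) \sum_(y in Y) \sum_(z in Z) e x y z)%N.

Lemma e3_le (V : finType) (e : V -> V -> V -> bool) (X Y Z : {set V}) :
  (e3 e X Y Z <= #|X| * (#|Y| * #|Z|))%N.
Proof.
rewrite -sum_nat_const; apply: leq_sum => x _.
rewrite -sum_nat_const; apply: leq_sum => y _.
by rewrite -sum1_card; apply: leq_sum => z _; case: e.
Qed.

Lemma e3_rot (V : finType) (e : V -> V -> V -> bool) (X Y Z : {set V}) :
  sym3 e -> e3 e X Y Z = e3 e Y Z X.
Proof.
case=> s1 s2; rewrite /e3 exchange_big; apply: eq_bigr => y _ /=.
rewrite exchange_big; apply: eq_bigr => z _ /=.
by apply: eq_bigr => x _; rewrite s1 s2.
Qed.

Lemma e3_swap (V : finType) (e : V -> V -> V -> bool) (X Y Z : {set V}) :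
  sym3 e -> e3 e X Y Z = e3 e X Z Y.
Proof.
case=> s1 s2; rewrite /e3; apply: eq_bigr => x _; rewrite exchange_big.
by apply: eq_bigr => z _; apply: eq_bigr => y _; rewrite s2.
Qed.

Lemma e3_setD (V : finType) (e : V -> V -> V -> bool) (X Y Z W : {set V}) :
  (e3 e X Y Z <= e3 e (X :\: W) Y Z + #|X :&: W| * (#|Y| * #|Z|))%N.
Proof.
rewrite {1}/e3 (big_setID W) /= addnC leq_add2l; exact: e3_le.
Qed.

(** Two applications of [pigeonhole]: [X] against the pairs in [setX Y Z], then [Y] against [Z] in
    the graph of the pairs joined to all of [X']. Measuring density against [T ^ 3] forces every
    part to have at least [eta * T] elements. *)
Lemma box (R : realType) (eta : R) (t : nat) : 0 < eta ->
  exists T0 : nat, forall (V : finType) (e : V -> V -> V -> bool)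
    (X Y Z : {set V}) (T : nat), (T0 <= T)%N ->
  (#|X| <= T)%N -> (#|Y| <= T)%N -> (#|Z| <= T)%N ->
  eta * T%:R ^+ 3 <= (e3 e X Y Z)%:R ->
  exists X' Y' Z' : {set V}, [/\ [/\ X' \subset X, Y' \subset Y & Z' \subset Z],
    [/\ #|X'| = t, #|Y'| = t & #|Z'| = (2 * t)%N] &
    forall x y z, x \in X' -> y \in Y' -> z \in Z' -> e x y z].
Proof.
move=> e0.
have [c1 [T1 [c1p h1]]] := @pigeonhole R eta t e0.
have [c2 [T2 [c2p h2]]] := @pigeonhole R c1 t c1p.
have [n1 hn1] := @eventually_ge R (T1 + T2)%:R eta e0.
have [n2 hn2] := @eventually_ge R (2 * t)%:R (c2 * eta) (mulr_gt0 c2p e0).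
exists (n1 + n2).+1 => V e X Y Z T hT hX hY hZ hE.
have T0 : 0 < T%:R :> R by rewrite ltr0n; apply: leq_trans hT.
have Tn1 : (n1 <= T)%N by apply: leq_trans hT; rewrite leqW // leq_addr.
have Tn2 : (n2 <= T)%N by apply: leq_trans hT; rewrite leqW // leq_addl.
have hle : (e3 e X Y Z)%:R <= #|X|%:R * (#|Y|%:R * #|Z|%:R) :> R.
  by rewrite -!natrM ler_nat e3_le.
have xT : #|X|%:R <= T%:R :> R by rewrite ler_nat.
have yT : #|Y|%:R <= T%:R :> R by rewrite ler_nat.
have zT : #|Z|%:R <= T%:R :> R by rewrite ler_nat.
have aux (a b d : R) : 0 <= a -> 0 <= b -> 0 <= d -> b <= T%:R -> d <= T%:R ->
    eta * T%:R ^+ 3 <= a * (b * d) -> eta * T%:R <= a.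
  move=> a0 b0 d0 bT dT h; have T2p : 0 < T%:R ^+ 2 :> R by rewrite exprn_gt0.
  rewrite -(ler_pM2r T2p); apply: le_trans (_ : _ <= a * (b * d)) _.
    by rewrite -mulrA -exprS.
  by rewrite ler_wpM2l // expr2 ler_pM.
have hall := le_trans hE hle.
have ex : eta * T%:R <= #|X|%:R by apply: aux hall.
have ey : eta * T%:R <= #|Y|%:R.
  by apply: (@aux _ #|X|%:R #|Z|%:R) => //; rewrite (mulrCA #|Y|%:R).
have ez : eta * T%:R <= #|Z|%:R.
  by apply: (@aux _ #|X|%:R #|Y|%:R) => //; rewrite (mulrC #|Z|%:R) -mulrA.
have big (A : {set V}) : eta * T%:R <= #|A|%:R -> (T1 + T2 <= #|A|)%N.
  by move=> h; rewrite -(ler_nat R); apply: le_trans h; apply: hn1.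
have [||X' [X'X cX' hX']] := h1 V (V * V)%type X (setX Y Z) (fun x p => e x p.1 p.2).
- by apply: leq_trans (big X ex); rewrite leq_addr.
- apply: le_trans (_ : eta * T%:R ^+ 3 <= _).
    rewrite cardsX natrM -mulrA ler_pM2l // !exprS expr0 mulr1.
    by rewrite ler_pM ?mulr_ge0 // ler_pM.
  apply: (le_trans hE); rewrite ler_nat; apply: leq_sum => x _.
  by rewrite pair_big_dep /= eq_leq //; apply: eq_bigl => p; rewrite !inE.
set P := [set _ in _ | _] in hX'.
have [||Y' [Y'Y cY' hY']] := h2 V V Y Z (fun y z => (y, z) \in P).
- by apply: leq_trans (big Y ey); rewrite leq_addl.
- rewrite -mulrA -natrM -cardsX; apply: (le_trans hX').
  rewrite ler_nat pair_big_dep /= -sum1_card big_mkcond [leqRHS]big_mkcond /=.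
  apply: leq_sum => -[y z] _; case hp : (_ \in P) => //=.
  by move: hp; rewrite inE => /andP[]; rewrite in_setX /= => /andP[-> ->].
set Z1 := [set _ in _ | _] in hY'.
have hZ1 : (2 * t <= #|Z1|)%N.
  rewrite -(ler_nat R); apply: le_trans hY'.
  apply: (@le_trans _ _ (c2 * eta * T%:R)); first exact: hn2.
  by rewrite -mulrA ler_pM2l.
have [Z' Z'Z cZ'] := ex_subset hZ1.
exists X', Y', Z'; split; first split=> //.
- by apply: (subset_trans Z'Z); apply/subsetP=> z; rewrite inE => /andP[].
- by [].
move=> x y z xX yY /(subsetP Z'Z); rewrite inE => /andP[_ /forall_inP/(_ y yY)].
by rewrite inE => /andP[_ /forall_inP/(_ x xX)].
Qed.

Lemma disjointD (T : finType) (X Y : {set T}) : [disjoint X & Y :\: X].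
Proof.
rewrite -setI_eq0; apply/eqP/setP=> v; rewrite !inE.
by case: (v \in X).
Qed.

Lemma set_ind (T : finType) (K : {set T} -> Prop) : K set0 ->
  (forall i (P : {set T}), i \notin P -> K P -> K (i |: P)) -> forall P, K P.
Proof.
move=> K0 KS P; move En : #|P| => n; elim: n P En => [|n IH] P.
  by move/cards0_eq=> ->.
move=> hP; have [i iP] : exists i, i \in P by apply/card_gt0P; rewrite hP.
rewrite -(setD1K iP); apply: KS; first by rewrite !inE eqxx.
by apply: IH; have := cardsD1 i P; rewrite iP hP add1n => -[].
Qed.

(** * Families of disjoint tiles *)

Section Packing.
Variables (V : finType) (e : V -> V -> V -> bool).

(* Blobs 2 and 3 together form the part of size [2 t]. *)
Definition tile (t : nat) (Q : 'I_4 -> {set V}) : Prop :=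
  [/\ forall p, #|Q p| = t, forall p q, p != q -> [disjoint Q p & Q q] &
   forall a b c (p : 'I_4), a \in Q 0 -> b \in Q 1 -> (1 < p)%N -> c \in Q p -> e a b c].

Definition packs (t k : nat) (X : {set V}) : Prop :=
  exists f : 'I_k -> 'I_4 -> {set V}, [/\ forall i, tile t (f i),
    forall i j p q, i != j -> [disjoint f i p & f j q] &
    forall i p, f i p \subset X].

Lemma packs0 t X : packs t 0 X.
Proof. by exists (fun _ _ => set0); split=> -[]. Qed.

Lemma packsS t k (X Y : {set V}) : X \subset Y -> packs t k X -> packs t k Y.
Proof.
move=> XY [f [h1 h2 h3]]; exists f; split=> // i p.
exact: subset_trans (h3 i p) XY.
Qed.

Lemma packsU t k l (X Y : {set V}) : [disjoint X & Y] ->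
  packs t k X -> packs t l Y -> packs t (k + l) (X :|: Y).
Proof.
move=> dXY [f [f1 f2 f3]] [g [g1 g2 g3]].
exists (fun i => match split i with inl a => f a | inr b => g b end); split.
- by move=> i; case: split.
- move=> i j p q; rewrite -(inj_eq (can_inj (@splitK k l))).
  case: (split i) => a; case: (split j) => b; rewrite ?(inj_eq unsplit_inj) //.
  + by move=> h; apply: f2.
  + by move=> _; apply: disjointWl (f3 a p) (disjointWr (g3 b q) dXY).
  + move=> _; rewrite disjoint_sym.
    by apply: disjointWl (f3 b q) (disjointWr (g3 a p) dXY).
  + by move=> h; apply: g2.
- by move=> i p; case: split => a; rewrite subsetU // ?f3 ?g3 ?orbT.
Qed.

Lemma packs_leq t k l X : (k <= l)%N -> packs t l X -> packs t k X.
Proof.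
move=> kl [f [h1 h2 h3]]; exists (fun i => f (widen_ord kl i)); split=> //.
by move=> i j p q ij; apply: h2.
Qed.

Lemma packs_big (I : finType) (P : {set I}) t k (F : I -> {set V}) :
  (forall i, i \in P -> packs t k (F i)) ->
  (forall i j, i \in P -> j \in P -> i != j -> [disjoint F i & F j]) ->
  packs t (#|P| * k) (\bigcup_(i in P) F i).
Proof.
elim/set_ind: P => [|i P iP IH] h1 h2; first by rewrite cards0 big_set0; apply: packs0.
rewrite cardsU1 iP big_setU1 //= mulnDl mul1n; apply: packsU.
- rewrite bigcup_disjoint // => j jP; apply: h2; rewrite ?setU11 ?setU1r //.
  by apply: contraNneq iP => ->.
- by apply: h1; rewrite setU11.
- apply: IH => [j jP|j l jP lP]; first by apply: h1; rewrite setU1r.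
  by apply: h2; rewrite setU1r.
Qed.

(** Serves for a single box, for the remains of a damaged tile, and for cutting a tile to a smaller
    scale. *)
Lemma packs_complete t k (A B C : {set V}) :
  (k * t <= #|A|)%N -> (k * t <= #|B|)%N -> (2 * (k * t) <= #|C|)%N ->
  [disjoint A & B] -> [disjoint A & C] -> [disjoint B & C] ->
  (forall a b c, a \in A -> b \in B -> c \in C -> e a b c) ->
  packs t k (A :|: B :|: C).
Proof.
elim: k A B C => [|k IH] A B C hA hB hC dAB dAC dBC hE; first exact: packs0.
rewrite mulSn in hA hB; rewrite (mulSn k) mulnDr in hC.
have aux (a b c : nat) : (a + b <= c)%N -> (b <= c - a)%N.
  by move=> h; rewrite -(addKn a b) leq_sub2r.
have [hA1 hB1 hC1] := And3 (leq_trans (leq_addr _ _) hA) (leq_trans (leq_addr _ _) hB)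
    (leq_trans (leq_addr _ _) hC).
have ht : (t + t <= #|C|)%N by rewrite addnn -mul2n.
have [A1 A1A cA1] : exists2 A1 : {set V}, A1 \subset A & #|A1| = t by apply: ex_subset.
have [B1 B1B cB1] : exists2 B1 : {set V}, B1 \subset B & #|B1| = t by apply: ex_subset.
have [C1 C1C cC1] : exists2 C1 : {set V}, C1 \subset C & #|C1| = t.
  by apply: ex_subset; apply: leq_trans ht; apply: leq_addr.
have cD (X Y : {set V}) : X \subset Y -> #|Y :\: X| = (#|Y| - #|X|)%N.
  by move=> h; rewrite cardsD (setIidPr h).
have [C2 C2C cC2] : exists2 C2 : {set V}, C2 \subset C :\: C1 & #|C2| = t.
  by apply: ex_subset; rewrite cD // cC1; apply: aux.
have C2C' : C2 \subset C by apply: (subset_trans C2C); apply: subsetDl.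
have dC12 : [disjoint C1 & C2].
  by apply: (disjointWr C2C); apply: disjointD.
have := IH (A :\: A1) (B :\: B1) (C :\: (C1 :|: C2)).
rewrite !cD // ?subUset ?C1C ?C2C' // cA1 cB1.
have -> : #|C1 :|: C2| = (2 * t)%N.
  by rewrite cardsU (disjoint_setI0 dC12) cards0 cC1 cC2 subn0 addnn -mul2n.
move=> /(_ (aux _ _ _ hA) (aux _ _ _ hB) (aux _ _ _ hC)).
have dW (X Y X1 Y1 : {set V}) : [disjoint X & Y] -> X1 \subset X -> Y1 \subset Y -> [disjoint
    X1 & Y1].
  by move=> d h1 h2; apply: (disjointWl h1); apply: (disjointWr h2).
move=> /(_ (dW _ _ _ _ dAB (subsetDl _ _) (subsetDl _ _)) (dW _ _ _ _ dAC (subsetDl _ _)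
    (subsetDl _ _)) (dW _ _ _ _ dBC (subsetDl _ _) (subsetDl _ _))).
have hE' a b c : a \in A :\: A1 -> b \in B :\: B1 -> c \in C :\: (C1 :|: C2) -> e a b c.
  by move=> /setDP[? _] /setDP[? _] /setDP[? _]; apply: hE.
move=> /(_ hE') hp.
pose Q (p : 'I_4) := nth set0 [:: A1; B1; C1; C2] p.
have hQ : packs t 1 (A1 :|: B1 :|: (C1 :|: C2)).
  exists (fun=> Q); split.
  - move=> _; split.
    + by move=> [[|[|[|[|//]]]] ?].
    + move=> [[|[|[|[|//]]]] i] [[|[|[|[|//]]]] j] //= _;
        rewrite /Q /=; first [exact: dC12 | by rewrite disjoint_sym; exact: dC12 | by apply:
            dW dAB _ _ | by apply: dW dAC _ _ | by apply: dW dBC _ _ | by rewrite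
            disjoint_sym; apply: dW dAB _ _ | by rewrite disjoint_sym; apply: dW dAC _ _ | by
            rewrite disjoint_sym; apply: dW dBC _ _].
    + move=> a b c [[|[|[|[|//]]]] i] //= /(subsetP A1A) aA /(subsetP B1B) bB _.
        by move=> /(subsetP C1C); apply: hE.
      by move=> /(subsetP C2C'); apply: hE.
  - by move=> i j; rewrite !ord1.
  - by move=> _ [[|[|[|[|//]]]] i]; rewrite /Q /=; apply/subsetP=> v; rewrite !inE => ->;
      rewrite ?orbT.
rewrite -add1n; apply: (packsS _ (packsU _ hQ hp)).
  apply/subsetP=> v; rewrite !in_setU !in_setD !in_setU.
  move: (subsetP A1A v) (subsetP B1B v) (subsetP C1C v) (subsetP C2C' v).
  move=> /implyP + /implyP + /implyP + /implyP.
  by case: (v \in A1); case: (v \in B1); case: (v \in C1); case: (v \in C2);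
    case: (v \in A); case: (v \in B); case: (v \in C).
rewrite !disjointUl !disjointUr.
have d3 : [disjoint C1 :|: C2 & C :\: (C1 :|: C2)] by apply: disjointD.
rewrite disjointUl in d3; case/andP: d3 => -> ->.
rewrite !disjointD /=.
repeat (apply/andP; split) => //; first
  [ by apply: dW dAB _ _ => //; apply: subsetDl
  | by apply: dW dAC _ _ => //; apply: subsetDl
  | by apply: dW dBC _ _ => //; apply: subsetDl
  | by rewrite disjoint_sym; apply: dW dAB _ _ => //; apply: subsetDl
  | by rewrite disjoint_sym; apply: dW dAC _ _ => //; apply: subsetDl
  | by rewrite disjoint_sym; apply: dW dBC _ _ => //; apply: subsetDl ].
Qed.
End Packing.

(** [X] moves to the last place because [box] takes its doubled part there; it alone may lose
    [2 * w] vertices. *)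
Lemma e3_setD3 (V : finType) (e : V -> V -> V -> bool) (X Y Z W : {set V}) (T w : nat) :
  sym3 e -> (#|X| <= T)%N -> (#|Y| <= T)%N -> (#|Z| <= T)%N ->
  (#|W :&: X| <= 2 * w)%N -> (#|W :&: Y| <= w)%N -> (#|W :&: Z| <= w)%N ->
  (e3 e X Y Z <= e3 e (Y :\: W) (Z :\: W) (X :\: W) + 4 * w * T ^ 2)%N.
Proof.
move=> es hX hY hZ wX wY wZ.
have cD (A : {set V}) : (#|A| <= T)%N -> (#|A :\: W| <= T)%N.
  by apply: leq_trans; rewrite subset_leq_card // subsetDl.
have st (A B C : {set V}) m : (#|W :&: A| <= m)%N -> (#|B| <= T)%N -> (#|C| <= T)%N ->
    (e3 e A B C <= e3 e (A :\: W) B C + m * T ^ 2)%N.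
  move=> h1 h2 h3; apply: (leq_trans (e3_setD e A B C W)).
  by rewrite leq_add2l leq_mul // 1?setIC // leq_mul.
rewrite -(e3_rot (X :\: W)) //.
rewrite (e3_rot X) //; apply: (leq_trans (st _ _ _ _ wY hZ hX)).
rewrite (e3_rot (Y :\: W)) //.
apply: (@leq_trans (e3 e (Z :\: W) X (Y :\: W) + w * T ^ 2 + w * T ^ 2)).
  by rewrite leq_add2r; apply: st => //; apply: cD.
rewrite (e3_rot (Z :\: W)) //.
apply: (@leq_trans (e3 e (X :\: W) (Y :\: W) (Z :\: W) + 2 * w * T ^ 2 + w * T ^ 2 + w * T ^
    2)).
  by rewrite !leq_add2r; apply: st => //; apply: cD.
by clear; nia.
Qed.

(** Boxes are taken out one after the other; together they destroy at most [4 * (q * t) * T ^ 2]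
    triples, half of the density. [X] is meant to be the uncovered blob: it pays the doubled parts,
    so that [Y] and [Z] lose only [q * t] each. *)
Lemma box_pack (R : realType) (eta : R) (t : nat) : 0 < eta ->
  exists T0 : nat, forall (V : finType) (e : V -> V -> V -> bool)
    (X Y Z : {set V}) (T : nat), sym3 e -> (T0 <= T)%N ->
  (#|X| <= T)%N -> (#|Y| <= T)%N -> (#|Z| <= T)%N ->
  [disjoint X & Y] -> [disjoint X & Z] -> [disjoint Y & Z] ->
  eta * T%:R ^+ 3 <= (e3 e X Y Z)%:R ->
  forall q, (8 * (q * t))%:R <= eta * T%:R ->
  exists W : {set V}, [/\ W \subset X :|: Y :|: Z, (#|W :&: Y| <= q * t)%N,
    (#|W :&: Z| <= q * t)%N & packs e t q W].
Proof.
move=> e0; have e20 : 0 < eta / 2 by rewrite divr_gt0.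
have [T0 hbox] := box t e20.
exists T0 => V e X Y Z T es hT hX hY hZ dXY dXZ dYZ hE q.
suff gen : (8 * (q * t))%:R <= eta * T%:R ->
  exists W : {set V}, [/\ W \subset X :|: Y :|: Z, (#|W :&: X| <= 2 * (q * t))%N,
    (#|W :&: Y| <= q * t)%N, (#|W :&: Z| <= q * t)%N & packs e t q W].
  by move=> /gen[W [h1 h2 h3 h4 h5]]; exists W.
elim: q => [_|q IH hq].
  by exists set0; rewrite sub0set !set0I cards0; split=> //; apply: packs0.
have hq' : (8 * (q * t))%:R <= eta * T%:R.
  by apply: le_trans hq; rewrite ler_nat leq_mul2l /= leq_mul2r leqnSn orbT.
have [W [WS WX WY WZ pW]] := IH hq'.
have cD (A : {set V}) : (#|A| <= T)%N -> (#|A :\: W| <= T)%N.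
  by apply: leq_trans; rewrite subset_leq_card // subsetDl.
have [|Y' [Z' [X' [[sY sZ sX] [cY cZ cX] hE']]]] :=
  hbox V e (Y :\: W) (Z :\: W) (X :\: W) T hT (cD _ hY) (cD _ hZ) (cD _ hX).
  have := e3_setD3 es hX hY hZ WX WY WZ; rewrite -(ler_nat R) natrD [(_ * T ^ 2)%:R]natrM natrX.
  have T20 : 0 <= T%:R ^+ 2 :> R by rewrite exprn_ge0.
  have : (8 * (q * t))%:R * T%:R ^+ 2 <= eta * T%:R ^+ 3.
    by rewrite [_ ^+ 3]exprS mulrA ler_wpM2r.
  move: hE; rewrite ?natrX !natrM ?natrX; clear.
  move: (e3 _ _ _ _)%:R (e3 _ _ _ _)%:R => a b.
  move: (T%:R ^+ 3) (T%:R ^+ 2) (q%:R) (t%:R) => c d x y; lra.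
have dW (A B A1 B1 : {set V}) : [disjoint A & B] -> A1 \subset A -> B1 \subset B -> [disjoint
    A1 & B1].
  by move=> d h1 h2; apply: (disjointWl h1); apply: (disjointWr h2).
have sY' := subset_trans sY (subsetDl _ _).
have sZ' := subset_trans sZ (subsetDl _ _).
have sX' := subset_trans sX (subsetDl _ _).
have dYX : [disjoint Y & X] by rewrite disjoint_sym.
have dZX : [disjoint Z & X] by rewrite disjoint_sym.
have hp : packs e t 1 (Y' :|: Z' :|: X').
  apply: packs_complete => //; rewrite ?cY ?cZ ?cX ?mul1n //.
  - exact: dW dYZ sY' sZ'.
  - exact: dW dYX sY' sX'.
  - exact: dW dZX sZ' sX'.
have cI (A B A1 B1 C1 : {set V}) m k : A1 \subset A -> [disjoint B1 & A] -> [disjoint C1 & A] ->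
    #|A1| = m -> (#|W :&: A| <= k)%N -> (#|(A1 :|: B1 :|: C1 :|: W) :&: A| <= m + k)%N.
  move=> s1 d1 d2 <- h; rewrite !setIUl (disjoint_setI0 d1) (disjoint_setI0 d2) !setU0.
  apply: (leq_trans (leq_card_setU _ _)); apply: leq_add => //.
  by rewrite subset_leq_card // subsetIl.
exists (Y' :|: Z' :|: X' :|: W); split.
- apply/subsetP=> v; move: (subsetP sY' v) (subsetP sZ' v) (subsetP sX' v) (subsetP WS v).
  rewrite !in_setU => /implyP + /implyP + /implyP + /implyP.
  by case: (v \in Y'); case: (v \in Z'); case: (v \in X'); case: (v \in W);
    case: (v \in X); case: (v \in Y); case: (v \in Z).
- rewrite (mulSn q) mulnDr (_ : Y' :|: Z' :|: X' = X' :|: Y' :|: Z'); last first.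
    by rewrite [LHS]setUC setUA.
  exact: (cI _ _ _ _ _ _ _ sX' (dW _ _ _ _ dYX sY' (subxx _)) (dW _ _ _ _ dZX sZ' (subxx _))
      cX WX).
- have dZY : [disjoint Z & Y] by rewrite disjoint_sym.
  rewrite mulSn; exact: (cI _ _ _ _ _ _ _ sY' (dW _ _ _ _ dZY sZ' (subxx _)) (dW _ _ _ _ dXY
      sX' (subxx _)) cY WY).
- rewrite mulSn (setUC Y').
  exact: (cI _ _ _ _ _ _ _ sZ' (dW _ _ _ _ dYZ sY' (subxx _)) (dW _ _ _ _ dXZ sX' (subxx _))
      cZ WZ).
rewrite -add1n; apply: packsU => //.
rewrite !disjointUl; apply/andP; split; first (apply/andP; split).
- by apply: (disjointWl sY); rewrite disjoint_sym disjointD.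
- by apply: (disjointWl sZ); rewrite disjoint_sym disjointD.
- by apply: (disjointWl sX); rewrite disjoint_sym disjointD.
Qed.

(** * Augmentations of a reduced tiling *)

Local Open Scope nat_scope.

(* [if] instead of [&&] and [||], whose arguments [vm_compute] evaluates
   eagerly. *)
Fixpoint all_bitseq n k (f : bitseq -> bool) : bool :=
  if n is n'.+1 then
    if (if k is k'.+1 then all_bitseq n' k' (fun s => f (true :: s)) else true)
    then all_bitseq n' k (fun s => f (false :: s)) else false
  else if k is 0 then f [::] else true.

Lemma all_bitseqP n k f : all_bitseq n k f ->
  forall s, size s = n -> count id s = k -> f s.
Proof.
elim: n k f => [|n IH] k f /=.
  by move=> h s /size0nil -> /= k0; rewrite -k0 in h.
case: ifP => // h1 h2 [|[] s] //= [hs] hk; last exact: (IH _ _ h2).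
by case: k hk h1 h2 => // k [hk] h1 _; apply: (IH _ _ h1).
Qed.

Fixpoint lazy_has (T : Type) (f : T -> bool) s :=
  if s is x :: s' then if f x then true else lazy_has f s' else false.
Fixpoint lazy_all (T : Type) (f : T -> bool) s :=
  if s is x :: s' then if f x then lazy_all f s' else false else true.

Definition inj3 : seq (seq nat) :=
  Eval vm_compute in [seq s <- [seq a :: s | a <- iota 0 4, s <- [seq [:: b; c] | b <- iota 0
      4, c <- iota 0 4]] | uniq s].
Definition inc3 : seq (seq nat) :=
  Eval vm_compute in [seq s <- inj3 | sorted ltn s].
Definition inc2 : seq (seq nat) := [:: [:: 0; 1]; [:: 0; 2]; [:: 0; 3]; [:: 1; 2]; [:: 1; 3];
    [:: 2; 3]].

(** [s] lists the rows of a 4 x 4 matrix. The rows of a 3-matching may be taken in increasing order,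
    hence [inc3] against [inj3]. *)
Definition four_by_four_check (s : bitseq) : bool :=
  let M i j := nth false s (i * 4 + j) in
  lazy_has id
   [:: lazy_has (fun ps => lazy_has (fun qs => lazy_all (fun i => M (nth 0 ps i) (nth 0 qs
       i)) [:: 0; 1; 2]) inj3) inc3;
      lazy_has (fun ab => lazy_all (fun q => lazy_all (M^~ q) ab) [:: 0; 1; 2; 3]) inc2;
      lazy_has (fun ab => lazy_all (fun p => lazy_all (M p) ab) [:: 0; 1; 2; 3]) inc2].

(** The reason is König's theorem: without a 3-matching two vertices cover all edges, and two
    vertices cover 8 edges only if they lie on the same side and have full degree. Here all graphs
    with 8 edges are enumerated. *)
Lemma four_by_four_all : all_bitseq 16 8 four_by_four_check.
Proof. by vm_compute. Qed.

Lemma lazy_hasE (T : Type) (f : T -> bool) s : lazy_has f s = has f s.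
Proof. by elim: s => //= x s ->; case: (f x). Qed.

Lemma lazy_allE (T : Type) (f : T -> bool) s : lazy_all f s = all f s.
Proof. by elim: s => //= x s ->; case: (f x). Qed.

Lemma four_by_four_checkP s : four_by_four_check s ->
  [\/ has (fun ps => has (fun qs => all (fun i => nth false s (nth 0 ps i * 4 + nth 0 qs i))
      [:: 0; 1; 2]) inj3) inc3,
      has (fun ab => all (fun q => all (fun p => nth false s (p * 4 + q)) ab) [:: 0; 1; 2;
          3]) inc2 |
      has (fun ab => all (fun p => all (fun q => nth false s (p * 4 + q)) ab) [:: 0; 1; 2;
          3]) inc2].
Proof.
rewrite /four_by_four_check lazy_hasE => /hasP[b]; rewrite !inE.
case/or3P=> /eqP -> h; [apply: Or31|apply: Or32|apply: Or33]; move: h;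
  rewrite lazy_hasE; apply: sub_has => ps.
- by rewrite lazy_hasE; apply: sub_has => qs; rewrite lazy_allE.
- by rewrite lazy_allE; apply: sub_all => q; rewrite lazy_allE.
- by rewrite lazy_allE; apply: sub_all => q; rewrite lazy_allE.
Qed.

Lemma four_by_four8 (B : rel 'I_4) : #|[set p | B p.1 p.2]| = 8 ->
  [\/ exists ps qs : seq 'I_4, [/\ uniq ps, uniq qs, size ps = 3, size qs = 3 &
        all (fun t => B t.1 t.2) (zip ps qs)],
      exists a b, a != b /\ forall q, B a q && B b q |
      exists a b, a != b /\ forall p, B p a && B p b].
Proof.
move=> hB; pose G i j := B (inord i) (inord j).
pose s := [seq G (k %/ 4) (k %% 4) | k <- iota 0 16].
have cs : count id s = 8.
  rewrite -hB (card_pair (fun p q => B p q)).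
  rewrite (eq_bigr (fun a : 'I_4 => \sum_(b < 4) G a b)); last first.
    move=> a _; rewrite -sum1_card big_mkcond /=; apply: eq_bigr => b _.
    by rewrite inE /G !inord_val; case: (B _ _).
  rewrite !big_ord_recr !big_ord0 /= !addn0 !add0n -!addnA.
  by [].
have := all_bitseqP four_by_four_all (s := s) erefl cs.
have Ms i j : i < 4 -> j < 4 -> nth false s (i * 4 + j) = G i j.
  move=> hi hj; rewrite (nth_map 0) ?size_iota; last by clear -hi hj; lia.
  rewrite nth_iota; last by clear -hi hj; lia.
  by rewrite add0n divnMDl // divn_small // addn0 modnMDl modn_small.
have inj4 : {in gtn 4 &, injective (@inord 3)}.
  by move=> i j hi hj /(congr1 val); rewrite /= !inordK.
have h4 (A : seq nat) : all (gtn 4) A -> uniq A -> uniq (map (@inord 3) A).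
  move=> /allP hA; rewrite map_inj_in_uniq // => i j /hA hi /hA hj; exact: inj4.
have two a b : a < 4 -> b < 4 -> uniq [:: a; b] -> inord a != inord b :> 'I_4.
  move=> a4 b4 h; have := h4 [:: a; b]; rewrite /= a4 b4 => /(_ isT h).
  by rewrite inE andbT.
case/four_by_four_checkP.
- case/hasP=> ps hps /hasP[qs hqs hall]; apply: Or31.
  have /allP/(_ _ hps)/and3P[p1 p2 /eqP p3] : all (fun A => [&& uniq A, all (gtn 4) A & size
      A == 3]) inc3 by [].
  have /allP/(_ _ hqs)/and3P[q1 q2 /eqP q3] : all (fun A => [&& uniq A, all (gtn 4) A & size
      A == 3]) inj3 by [].
  exists (map (@inord 3) ps), (map (@inord 3) qs); rewrite !size_map; split; rewrite ?h4 //.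
  case: ps qs p3 q3 p2 q2 hall {hps hqs p1 q1} => [|a1 [|a2 [|a3 [|? ?]]]] //.
  case=> [|b1 [|b2 [|b3 [|? ?]]]] // _ _ /and4P[? ? ? _] /and4P[? ? ? _] /=.
  by rewrite !Ms // /G.
- case/hasP=> ab hab hall; apply: Or32.
  have /allP/(_ _ hab)/and3P[p1 p2 /eqP p3] : all (fun A => [&& uniq A, all (gtn 4) A & size
      A == 2]) inc2 by [].
  case: ab p1 p2 p3 hall {hab} => [|a [|b [|? ?]]] // p1 /and3P[a4 b4 _] _ /allP hall.
  exists (inord a), (inord b); split; first exact: two.
  move=> q; have hq : (q : nat) \in [:: 0; 1; 2; 3] by case: q => -[|[|[|[|]]]].
  by have := hall q hq; rewrite /= !Ms // /G inord_val andbT.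
- case/hasP=> ab hab hall; apply: Or33.
  have /allP/(_ _ hab)/and3P[p1 p2 /eqP p3] : all (fun A => [&& uniq A, all (gtn 4) A & size
      A == 2]) inc2 by [].
  case: ab p1 p2 p3 hall {hab} => [|a [|b [|? ?]]] // p1 /and3P[a4 b4 _] _ /allP hall.
  exists (inord a), (inord b); split; first exact: two.
  move=> q; have hq : (q : nat) \in [:: 0; 1; 2; 3] by case: q => -[|[|[|[|]]]].
  by have := hall q hq; rewrite /= !Ms // /G inord_val andbT.
Qed.

Lemma four_by_four (B : rel 'I_4) : 8 <= #|[set p | B p.1 p.2]| ->
  [\/ exists ps qs : seq 'I_4, [/\ uniq ps, uniq qs, size ps = 3, size qs = 3 &
        all (fun t => B t.1 t.2) (zip ps qs)],
      exists a b, a != b /\ forall q, B a q && B b q |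
      exists a b, a != b /\ forall p, B p a && B p b].
Proof.
move=> /ex_subset[A sA cA].
have AB p q : (p, q) \in A -> B p q by move=> /(subsetP sA); rewrite inE.
have [|[ps [qs [h1 h2 h3 h4 h5]]]|[a [b [ab h]]]|[a [b [ab h]]]] := @four_by_four8 (fun p q
    => (p, q) \in A).
- by rewrite -cA; apply: eq_card => -[p q]; rewrite inE.
- apply: Or31; exists ps, qs; split=> //; apply: sub_all h5 => -[p q]; exact: AB.
- by apply: Or32; exists a, b; split=> // q; have /andP[/AB-> /AB->] := h q.
- by apply: Or33; exists a, b; split=> // q; have /andP[/AB-> /AB->] := h q.
Qed.

Lemma distinct_representatives (T : finType) (Ls : seq {set T}) k :
  size Ls <= k -> all (fun L : {set T} => k <= #|L|) Ls ->
  exists ws, [/\ size ws = size Ls, uniq ws & all2 (fun w L => w \in pred_of_set L) ws Ls].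
Proof.
elim: Ls => [|L Ls IH] /= hk; first by exists [::].
case/andP=> hL hLs; have [ws [ws1 ws2 ws3]] := IH (ltnW hk) hLs.
have [w] : exists w, w \in L :\: [set:: ws].
  apply/card_gt0P; rewrite cardsD subn_gt0; apply: leq_trans hL.
  apply: leq_ltn_trans hk; rewrite -ws1.
  apply: leq_trans (subset_leq_card (subsetIr _ _)) _; rewrite cardsE; exact: card_size.
rewrite !inE => /andP[w1 w2]; exists (w :: ws); rewrite /= ws1 w1 ws2 w2.
by split.
Qed.

(** * Augmentations in the reduced hypergraph *)

Section Augmentation.
Variables (IT IU : finType).
Notation blob := ((IT * 'I_4) + IU)%type.
Variables (r : blob -> blob -> blob -> bool) (T0 : {set IT}) (U0 : {set IU}).
Hypothesis rsym : forall w x y, r (inr w) x y = r (inr w) y x.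
Hypothesis runiq : forall w x y, r (inr w) x y -> uniq [:: inr w; x; y].

Definition avail : {set blob} :=
  [set j : blob | match j with inl t => t.1 \in T0 | inr w => w \in U0 end].

Definition aug_blobs (es : seq (IU * (blob * blob))) : seq blob :=
  flatten [seq [:: inr t.1; t.2.1; t.2.2] | t <- es].

(** One edge more than tiles is the gain. The cap 4 bounds what one augmentation consumes, and lets
    four candidates per edge suffice for distinct uncovered blobs. *)
Definition augmentation (ts : seq IT) (es : seq (IU * (blob * blob))) : Prop :=
  [/\ size ts < size es <= 4, uniq ts, uniq (aug_blobs es),
    all (fun t => r (inr t.1) t.2.1 t.2.2) es &
    {subset ts <= T0} /\ {in aug_blobs es, forall j, j \in avail /\
      forall t p, j = inl (t, p) -> t \in ts}].

Hypothesis noaug : forall ts es, ~ augmentation ts es.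
Notation m := #|T0|.
Notation u := #|U0|.

Lemma sum_avail (F : blob -> nat) : \sum_(j in avail) F j =
  \sum_(t in T0) \sum_p F (inl (t, p)) + \sum_(w in U0) F (inr w).
Proof.
rewrite big_mkcond big_sumType /=; congr (_ + _); last first.
  by rewrite [RHS]big_mkcond; apply: eq_bigr => w _; rewrite inE.
rewrite [RHS]big_mkcond /=.
rewrite (eq_bigr (fun x : IT * 'I_4 => if inl (x.1, x.2) \in avail then F (inl (x.1, x.2))
    else 0)); last by case.
rewrite -(pair_bigA _ (fun t p => if inl (t, p) \in avail then F (inl (t, p)) else 0)) /=.
apply: eq_bigr => t _; case: ifP => ht.
  by apply: eq_bigr => p _; rewrite inE /= ht.
by rewrite big1 // => p _; rewrite inE /= ht.
Qed.

Lemma no_UUU w x y : w \in U0 -> x \in U0 -> y \in U0 -> r (inr w) (inr x) (inr y) = false.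
Proof.
move=> wU xU yU; apply/negP=> h.
apply: (@noaug [::] [:: (w, (inr x, inr y))]); split=> //=.
- exact: runiq h.
- by rewrite h.
split=> // j; rewrite !inE => /or3P[]/eqP->; rewrite ?inE; by split.
Qed.

Let D t p := \sum_(w in U0) \sum_(x in U0) r (inr w) (inl (t, p)) (inr x).

(** An edge through [q] must share an uncovered blob with a fixed edge through [p], for two disjoint
    edges on the single tile [t] would augment; each of the four possible coincidences leaves [u]
    pairs. *)
Lemma D_le t p q : t \in T0 -> p != q -> 0 < D t p -> D t q <= 4 * u.
Proof.
move=> tT pq Dp.
have [w [x [wU xU h]]] : exists w x, [/\ w \in U0, x \in U0 & r (inr w) (inl (t, p)) (inr x)].
  move: Dp; rewrite lt0n sum_nat_eq0 negb_forall_in => /exists_inP[w wU].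
  rewrite sum_nat_eq0 negb_forall_in => /exists_inP[x xU] h.
  by exists w, x; split=> //; move: h; case: r.
have wx : w != x by apply/eqP=> E; have := runiq h; rewrite E /= !inE eqxx ?orbT.
have key w' x' : w' \in U0 -> x' \in U0 -> r (inr w') (inl (t, q)) (inr x') ->
    [|| w' == w, w' == x, x' == w | x' == x].
  move=> wU' xU' h'; apply: contraT; rewrite !negb_or => /and4P[n1 n2 n3 n4].
  have wx' : w' != x' by apply/eqP=> E; have := runiq h'; rewrite E /= !inE eqxx ?orbT.
  exfalso; apply: (@noaug [:: t] [:: (w, (inl (t, p), inr x)); (w', (inl (t, q), inr x'))]).
  split=> //=.
  - rewrite !inE /= !(inj_eq inr_inj) !(inj_eq inl_inj) xpair_eqE eqxx (negbTE pq) /=.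
    by rewrite ![_ == w']eq_sym ![_ == x']eq_sym (negbTE wx) (negbTE n1) (negbTE n2) (negbTE
        n3) (negbTE n4) eq_sym (negbTE wx').
  - by rewrite h h'.
  split=> [z|j]; first by rewrite inE => /eqP->.
  rewrite !inE => /or4P[|||/or3P[]] /eqP->; rewrite ?inE; split=> //.
  + by move=> t' p' [<- _]; rewrite inE.
  + by move=> t' p' [<- _]; rewrite inE.
apply: (@leq_trans (\sum_(w' in U0) \sum_(x' in U0) ((w' == w) + (w' == x) + (x' == w) + (x'
    == x)))).
  apply: leq_sum => w' wU'; apply: leq_sum => x' xU'.
  case hr : (r _ _ _) => //; have := key w' x' wU' xU' hr.
  by do 4! case: (_ == _).
have one z : z \in U0 -> \sum_(i in U0) (i == z) = 1.
  move=> zU; rewrite (bigD1 z) //= eqxx big1 ?addn0 // => i /andP[_ /negbTE->] //.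
rewrite (eq_bigr (fun w' => u * (w' == w) + u * (w' == x) + 2)); last first.
  by move=> w' _; rewrite !big_split /= !sum_nat_const !one // -addnA.
rewrite !big_split /= -!big_distrr /= !one // sum_nat_const.
by clear; lia.
Qed.

(** If one blob has more than [4 * u] pairs, the other three have none. So a tile gets only about a
    quarter of its [4 * u ^ 2] pairs. *)
Lemma D_sum t : t \in T0 -> \sum_p D t p <= u ^ 2 + 16 * u.
Proof.
move=> tT; have Du p : D t p <= u ^ 2.
  rewrite -mulnn -sum_nat_const; apply: leq_sum => w _.
  by rewrite -sum1_card; apply: leq_sum => x _; case: r.
case: (boolP [exists q, 4 * u < D t q]) => [/existsP[q hq]|].
  rewrite (bigD1 q) //= big1 => [|p pq]; first by rewrite addn0 (leq_trans (Du q)) ?leq_addr.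
  apply/eqP; rewrite -leqn0 leqNgt; apply/negP=> hp.
  by have := D_le tT pq hp; rewrite leqNgt hq.
rewrite negb_exists => /forallP h; apply: leq_trans (leq_addl _ _).
apply: (@leq_trans (\sum_(p < 4) 4 * u)); last by rewrite sum_nat_const card_ord mulnA.
by apply: leq_sum => p _; rewrite leqNgt.
Qed.

Let P (a b : IT * 'I_4) := [set w in U0 | r (inr w) (inl a) (inl b)].

Definition with_links (ws : seq IU) (ps : seq ((IT * 'I_4) * (IT * 'I_4))) :=
  [seq (t.1, (inl t.2.1 : blob, inl t.2.2 : blob)) | t <- zip ws ps].

Lemma mem_with_links ws ps j : size ws = size ps ->
  (j \in aug_blobs (with_links ws ps)) =
  match j with inl x => x \in flatten [seq [:: t.1; t.2] | t <- ps]
             | inr w => w \in ws end.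
Proof.
elim: ws ps j => [|w ws IH] [|[x y] ps] j //= => [_|[/IH h]]; first by case: j.
by rewrite !inE -/(aug_blobs _) h; case: j => [z|z]; rewrite !inE.
Qed.

Lemma uniq_with_links ws ps : size ws = size ps -> uniq ws ->
  uniq (flatten [seq [:: t.1; t.2] | t <- ps]) -> uniq (aug_blobs (with_links ws ps)).
Proof.
elim: ws ps => [|w ws IH] [|[x y] ps] //= => -[h] /andP[w1 w2].
move=> /and3P[xy yps ups]; rewrite -!/(aug_blobs _) -!/(with_links _ _).
rewrite !inE !mem_with_links // w1 yps /= IH //.
by rewrite andbT; move: xy; rewrite inE.
Qed.

(** At most four pairs with at least four candidates each: distinct uncovered blobs can be chosen
    greedily. Hence the threshold 4 in [B]. *)
Lemma pairs_augment (ts : seq IT) (ps : seq ((IT * 'I_4) * (IT * 'I_4))) :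
  size ts < size ps <= 4 -> uniq ts -> {subset ts <= T0} ->
  uniq (flatten [seq [:: t.1; t.2] | t <- ps]) ->
  {in flatten [seq [:: t.1; t.2] | t <- ps], forall x, x.1 \in ts} ->
  all (fun t => 4 <= #|P t.1 t.2|) ps -> False.
Proof.
move=> /andP[s1 s2] uts tsT ups hin hP.
have [||ws [w1 w2 w3]] := @distinct_representatives _ [seq P t.1 t.2 | t <- ps] 4.
- by rewrite size_map.
- by rewrite all_map.
rewrite size_map in w1.
apply: (@noaug ts (with_links ws ps)); split=> //.
- by rewrite size_map size_zip w1 minnn s1.
- exact: uniq_with_links.
- elim: ws ps w1 w3 {s1 s2 ups hin hP w2} => [|w ws IH] [|[x y] ps] //= => -[h] /andP[].
  by rewrite inE /= => /andP[_ ->] /IH ->.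
split=> // j; rewrite mem_with_links //; case: j => [[t p] /hin/= ht|w hw].
  by split=> [|t' p' [<- _]//]; rewrite inE /= tsT.
split=> //; rewrite inE; elim: ws ps w1 w3 hw {s1 s2 ups hin hP w2} => [|w' ws IH] [|[x y]
    ps] //= => -[h] /andP[].
by rewrite 2!inE /= => /andP[w'U _] /IH{}IH /orP[/eqP->|/IH->].
Qed.

Let B t s : rel 'I_4 := fun p q => 4 <= #|P (t, p) (s, q)|.
(** A [K_{2,4}] of popular pairs with its side of size 2 in [t]. *)
Let arrow t s := [exists a, exists b, (a != b) && [forall q, B t s a q && B t s b q]].

Lemma P_sym a b : P a b = P b a.
Proof. by apply/setP=> w; rewrite !inE rsym. Qed.

(** A 3-matching would give three disjoint edges on two tiles, an augmentation. *)
Lemma B_dichotomy t s : t \in T0 -> s \in T0 -> t != s ->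
  8 <= #|[set p | B t s p.1 p.2]| -> arrow t s || arrow s t.
Proof.
move=> tT sT ts /four_by_four[[ps [qs [u1 u2 z1 z2 hall]]]|[a [b [ab h]]]|[a [b [ab h]]]].
- exfalso; apply: (@pairs_augment [:: t; s] [seq ((t, x.1), (s, x.2)) | x <- zip ps qs]).
  + by rewrite size_map size_zip z1 z2.
  + by rewrite /= inE ts.
  + by move=> z; rewrite !inE => /orP[]/eqP->.
  + case: ps qs z1 z2 u1 u2 {hall} => [|a1 [|a2 [|a3 [|? ?]]]] // [|b1 [|b2 [|b3 [|? ?]]]] //
      _ _ /=.
    rewrite !inE !xpair_eqE !eqxx /= (negbTE ts) ![s == t]eq_sym (negbTE ts) /=.
    by rewrite !negb_or !andbT -!andbA => /and3P[-> -> ->] /and3P[-> -> ->].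
  + move=> z /flatten_mapP[y /mapP[x _ ->]]; rewrite !inE => /orP[]/eqP-> /=.
      by rewrite eqxx.
    by rewrite eqxx orbT.
  + by rewrite all_map.
- by apply/orP; left; apply/existsP; exists a; apply/existsP; exists b; rewrite ab;
    apply/forallP.
- apply/orP; right; apply/existsP; exists a; apply/existsP; exists b; rewrite ab.
  by apply/forallP=> q; rewrite /B ![P (s, _) _]P_sym; apply: h.
Qed.

(** Two arrows into [s] could share out its four blobs, two to each source tile: four disjoint edges
    on three tiles. *)
Lemma arrow_inj t t' s : t \in T0 -> t' \in T0 -> s \in T0 -> t != s -> t' != s ->
  arrow t s -> arrow t' s -> t = t'.
Proof.
move=> tT tT' sT ts ts' /existsP[a /existsP[b /andP[ab /forallP h]]].
move=> /existsP[a' /existsP[b' /andP[ab' /forallP h']]].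
apply/eqP; apply: contraT => tt'; exfalso.
pose o k : 'I_4 := inord k.
have oE k l : k < 4 -> l < 4 -> (o k == o l) = (k == l).
  by move=> hk hl; rewrite -val_eqE /= !inordK.
apply: (@pairs_augment [:: t; t'; s] [:: ((t, a), (s, o 0)); ((t, b), (s, o 1)); ((t', a'),
    (s, o 2)); ((t', b'), (s, o 3))]).
- by [].
- by rewrite /= !inE negb_or tt' ts ts'.
- by move=> z; rewrite !inE => /or3P[]/eqP->.
- rewrite /= !inE !xpair_eqE !eqxx /= !oE //= (negbTE ab) (negbTE ab') (negbTE tt') (negbTE
    ts) (negbTE ts') /=.
  by rewrite ![s == _]eq_sym (negbTE ts) (negbTE ts').
- by move=> z; rewrite /= !inE => /or4P[|||/or4P[|||/orP[]]] /eqP-> /=; rewrite !eqxx ?orbT.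
- move: (h (o 0)) (h (o 1)) (h' (o 2)) (h' (o 3)); rewrite /B /=.
  by move=> /andP[-> _] /andP[_ ->] /andP[-> _] /andP[_ ->].
Qed.

Lemma P_sum t s : \sum_p \sum_q #|P (t, p) (s, q)| <= 16 * u.
Proof.
have -> : 16 * u = \sum_(p < 4) \sum_(q < 4) u by rewrite !sum_nat_const card_ord mulnA.
apply: leq_sum => p _; apply: leq_sum => q _; rewrite subset_leq_card //.
by apply/subsetP=> w; rewrite inE => /andP[].
Qed.

(** An unpopular pair has at most 3 uncovered blobs, and 48 is 16 times 3. *)
Lemma P_sum7 t s : #|[set p | B t s p.1 p.2]| <= 7 ->
  \sum_p \sum_q #|P (t, p) (s, q)| <= 7 * u + 48.
Proof.
move=> h7; rewrite (card_pair (fun p q => B t s p q)) in h7.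
apply: (@leq_trans (\sum_p \sum_q (u * B t s p q + 3))).
  apply: leq_sum => p _; apply: leq_sum => q _; rewrite /B; case: (leqP 4) => h.
    rewrite muln1; apply: leq_trans (leq_addr _ _); rewrite subset_leq_card //.
    by apply/subsetP=> w; rewrite inE => /andP[].
  by rewrite muln0.
rewrite (eq_bigr (fun p => u * #|[set q | B t s p q]| + 12)); last first.
  move=> p _; rewrite big_split -big_distrr /= sum_nat_const card_ord.
  congr (u * _ + _); rewrite -sum1_card [RHS]big_mkcond; apply: eq_bigr => q _.
  by rewrite inE; case: (B _ _ _ _).
rewrite big_split -big_distrr /= sum_nat_const card_ord leq_add2r mulnC.
by rewrite leq_mul2r h7 orbT.
Qed.

(** Mixed pairs, one blob in a tile and one uncovered, occur in both orders. The exceptional pairs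
    of tiles are the diagonal ones and those with an arrow in either direction, at most [m] of each
    kind, with [16 * u] triples each: this is the last term. *)
Lemma total_bound :
  \sum_(w in U0) \sum_(x in avail) \sum_(y in avail) r (inr w) x y <=
  2 * (m * (u ^ 2 + 16 * u)) + m ^ 2 * (7 * u + 48) + 48 * (m * u).
Proof.
pose TU := \sum_(t in T0) \sum_p D t p.
pose TT := \sum_(t in T0) \sum_(s in T0) \sum_p \sum_q #|P (t, p) (s, q)|.
have hTU : TU <= m * (u ^ 2 + 16 * u).
  by rewrite -sum_nat_const; apply: leq_sum => t tT; apply: D_sum.
have hTT : TT <= m ^ 2 * (7 * u + 48) + 48 * (m * u).
  apply: (@leq_trans (\sum_(t in T0) \sum_(s in T0) ((7 * u + 48) + (16 * u * (t == s) + 16 *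
      u * ((t != s) && arrow t s) + 16 * u * ((s != t) && arrow s t))))).
    apply: leq_sum => t tT; apply: leq_sum => s sT.
    case: (eqVneq t s) => [->|ts].
      rewrite ?eqxx /= ?muln0 ?addn0 muln1; apply: leq_trans (P_sum _ _) _; exact: leq_addl.
    case: (leqP #|[set p | B t s p.1 p.2]| 7) => h7.
      by apply: leq_trans (P_sum7 h7) _; apply: leq_addr.
    have := B_dichotomy tT sT ts h7 => /=.
    by move: (P_sum t s); case: (arrow t s); case: (arrow s t) => //= h _; clear -h; lia.
  rewrite (eq_bigr (fun t => m * (7 * u + 48) + (16 * u * \sum_(s in T0) (t == s) + 16 * u *
      \sum_(s in T0) ((t != s) && arrow t s) + 16 * u * \sum_(s in T0) ((s != t) && arrow s
      t)))); last first.
    move=> t _; rewrite big_split /= sum_nat_const; congr (_ + _).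
    by rewrite !big_split /= -!big_distrr.
  rewrite !big_split /= -!big_distrr /= sum_nat_const mulnA mulnn leq_add2l.
  have h1 : \sum_(t in T0) \sum_(s in T0) (t == s) <= m.
    rewrite -sum1_card; apply: leq_sum => t tT; rewrite (bigD1 t) //= eqxx big1 // => s.
    by move=> /andP[_]; rewrite eq_sym => /negbTE->.
  have h2 : \sum_(s in T0) \sum_(t in T0) ((t != s) && arrow t s) <= m.
    rewrite -sum1_card; apply: leq_sum => s sT; rewrite sum_card_in.
    apply/card_le1_eqP=> t t'; rewrite !inE => /and3P[h1' h2' h3'] /and3P[h4' h5' h6'].
    exact: arrow_inj sT _ _ _ _.
  have h3 : \sum_(t in T0) \sum_(s in T0) ((t != s) && arrow t s) <= m by rewrite exchange_big.
  move: h1 h2 h3.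
  move: (\sum_(t in T0) _) (\sum_(t in T0) _) (\sum_(t in T0) _) => a b c; clear.
  by move: u m => U M ha hb hc; nia.
have -> : \sum_(w in U0) \sum_(x in avail) \sum_(y in avail) r (inr w) x y = TT + TU + TU.
  rewrite (eq_bigr (fun w => \sum_(t in T0) \sum_p \sum_(s in T0) \sum_q r (inr w) (inl (t,
      p)) (inl (s, q)) + \sum_(t in T0) \sum_p \sum_(x in U0) r (inr w) (inl (t, p)) (inr x)
      + \sum_(t in T0) \sum_p \sum_(x in U0) r (inr w) (inl (t, p)) (inr x))); last first.
    move=> w wU; rewrite sum_avail; congr (_ + _).
      rewrite -big_split; apply: eq_bigr => t _; rewrite -big_split; apply: eq_bigr => p _.
      by rewrite sum_avail.
    rewrite (eq_bigr (fun x => \sum_(t in T0) \sum_p r (inr w) (inl (t, p)) (inr x))).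
      rewrite exchange_big; apply: eq_bigr => t _; rewrite exchange_big.
      by apply: eq_bigr.
    move=> x xU; rewrite sum_avail [X in _ + X]big1 => [|y yU]; last by rewrite no_UUU.
    by rewrite addn0; apply: eq_bigr => t _; apply: eq_bigr => p _; rewrite rsym.
  rewrite !big_split /=; congr (_ + _ + _).
  - rewrite exchange_big; apply: eq_bigr => t _.
    rewrite exchange_big /= [RHS]exchange_big /=; apply: eq_bigr => p _.
    rewrite exchange_big /=; apply: eq_bigr => s _.
    rewrite exchange_big /=; apply: eq_bigr => q _.
    by rewrite sum_card_in.
  - by rewrite exchange_big; apply: eq_bigr => t _; rewrite exchange_big.
  - by rewrite exchange_big; apply: eq_bigr => t _; rewrite exchange_big.
by move: hTU hTT; clear; lia.
Qed.
End Augmentation.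

(** The part [7 / 16 * N ^ 2 * u] of the degree sum is at least the main terms of [total_bound]. The
    others, [80 * m * u + 48 * m ^ 2], are at most [20 * N * u + 3 * N ^ 2] because [4 * m <= N];
    the bound [N <= u / alpha] then turns them into [(20 + 3 / alpha) * N * u]. *)
Lemma augmentation_exists (R : realType) (gamma alpha : R) (IT IU : finType)
    (r : (IT * 'I_4) + IU -> (IT * 'I_4) + IU -> (IT * 'I_4) + IU -> bool)
    (T0 : {set IT}) (U0 : {set IU}) (N := (4 * #|T0| + #|U0|)%N) :
  (forall w x y, r (inr w) x y = r (inr w) y x) ->
  (forall w x y, r (inr w) x y -> uniq [:: inr w; x; y]) ->
  (0 < alpha)%R -> (20 + 3 / alpha < gamma * N%:R)%R ->
  (alpha * N%:R <= #|U0|%:R)%R ->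
  (forall w, w \in U0 -> ((7 / 16 + gamma) * N%:R ^+ 2 <=
     (\sum_(x in avail T0 U0) \sum_(y in avail T0 U0) r (inr w) x y)%:R)%R) ->
  exists ts es, augmentation r T0 U0 ts es.
Proof.
move=> rsym runiq a0 hN hU hdeg.
have [//|noaug] := boolp.pselect (exists ts es, augmentation r T0 U0 ts es).
exfalso.
have /(total_bound rsym runiq) : forall ts es, ~ augmentation r T0 U0 ts es.
  by move=> ts es h; apply: noaug; exists ts, es.
rewrite -(ler_nat R) natr_sum => hle.
have : (#|U0|%:R * ((7 / 16 + gamma) * N%:R ^+ 2) <= \sum_(w in U0) (\sum_(x in avail T0 U0)
    \sum_(y in avail T0 U0) r (inr w) x y)%:R)%R.
  by rewrite mulr_natl -sumr_const; apply: ler_sum.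
move=> /le_trans/(_ hle).
move: hN hU a0; rewrite /N; clear.
move: #|T0| #|U0| => m u; rewrite ?natrX !(natrD, natrM) ?natrX.
have : (0 <= m%:R :> R)%R by []. have : (0 <= u%:R :> R)%R by [].
move: (m%:R)%R (u%:R)%R => {}m {}u u0 m0 hN hU a0 h.
move En : (4 * m + u)%R => n; rewrite En in hN hU h.
have n0 : (0 < n)%R.
  have n1 : (0 <= n)%R by rewrite -En; lra.
  rewrite lt_neqAle n1 andbT; apply/eqP=> n2; move: hN; rewrite -n2 mulr0.
  have : (0 <= 3 / alpha)%R by rewrite divr_ge0 // ltW.
  lra.
have u1 : (0 < u)%R by apply: lt_le_trans hU; rewrite mulr_gt0.
have h1 : (gamma * n ^+ 2 * u <= 80 * (m * u) + 48 * m ^+ 2)%R.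
  have e1 : (7 / 16 * n ^+ 2 * u = 7 * m ^+ 2 * u + 7 / 2 * (m * u ^+ 2) + 7 / 16 * u ^+ 3)%R.
    by rewrite -En; field.
  have : (0 <= m * u ^+ 2)%R by rewrite mulr_ge0 // exprn_ge0.
  have : (0 <= u ^+ 3)%R by rewrite exprn_ge0.
  move: h e1; clear; move=> h e1 p1 p2; lra.
have h2 : (80 * (m * u) + 48 * m ^+ 2 <= 20 * (n * u) + 3 * (n * n))%R.
  have : (0 <= m * u)%R by rewrite mulr_ge0.
  rewrite -En; move: u0 m0; clear; nra.
have h3 : (gamma * n * u <= 20 * u + 3 * n)%R.
  rewrite -(ler_pM2l n0); apply: le_trans (le_trans _ (le_trans h1 h2)) _.
    by rewrite le_eqVlt; apply/orP; left; apply/eqP; ring.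
  by rewrite le_eqVlt; apply/orP; left; apply/eqP; ring.
have h4 : (n <= u / alpha)%R by rewrite ler_pdivlMr // mulrC.
have h5 : (gamma * n * u <= (20 + 3 / alpha) * u)%R.
  apply: (le_trans h3).
  have -> : ((20 + 3 / alpha) * u = 20 * u + 3 * (u / alpha))%R by ring.
  by rewrite lerD2l ler_pM2l.
by move: h5; rewrite leNgt ltr_pM2r // hN.
Qed.

(** * Almost perfect tilings *)

Lemma chunks (V : finType) (X : {set V}) T u : u * T <= #|X| ->
  exists g : 'I_u -> {set V}, [/\ forall w, #|g w| = T, forall w, g w \subset X &
    forall w w', w != w' -> [disjoint g w & g w']].
Proof.
elim: u X => [|u IH] X hX; first by exists (fun=> set0); split=> -[].
rewrite mulSn in hX.
have [A AX cA] : exists2 A : {set V}, A \subset X & #|A| = T.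
  by apply: ex_subset; apply: leq_trans hX; apply: leq_addr.
have [|g [g1 g2 g3]] := IH (X :\: A).
  by rewrite cardsD (setIidPr AX) cA -(addKn T (u * T)) leq_sub2r.
have dA w : [disjoint A & g w] by apply: disjointWr (g2 w) (disjointD _ _).
exists (fun w => if unlift ord0 w is Some w' then g w' else A); split.
- by move=> w; case: (unliftP ord0 w).
- move=> w; case: (unliftP ord0 w) => [w' _|//].
  exact: subset_trans (g2 w') (subsetDl _ _).
- move=> w w'; case: (unliftP ord0 w) => [v ->|->]; case: (unliftP ord0 w') => [v' ->|->].
  + by rewrite (inj_eq lift_inj); apply: g3.
  + by move=> _; rewrite disjoint_sym.
  + by move=> _.
  + by rewrite eqxx.
Qed.

(** * From augmentations to tiles at the smaller scale *)

Section Improve.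
Variables (R : realType) (V : finType) (e : V -> V -> V -> bool) (IT IU : finType).
Notation blob := ((IT * 'I_4) + IU)%type.
Variables (bl : blob -> {set V}) (T t M q : nat) (eta : R).
Hypothesis cbl : forall j, #|bl j| = T.
Hypothesis dbl : forall j j', j != j' -> [disjoint bl j & bl j'].
Hypothesis tbl : forall i, tile e T (fun p => bl (inl (i, p))).
Hypothesis TM : T = M * t.
Hypothesis qM : q <= M.

Definition reduced (j x y : blob) : bool :=
  uniq [:: j; x; y] && (eta * T%:R ^+ 3 <= (e3 e (bl j) (bl x) (bl y))%:R)%R.

Hypothesis hpack : forall j x y, reduced j x y ->
  exists W : {set V}, [/\ W \subset bl j :|: bl x :|: bl y, #|W :&: bl x| <= q * t,
    #|W :&: bl y| <= q * t & packs e t q W].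

Definition region (J : {set blob}) := \bigcup_(j in J) bl j.

Lemma region_disjoint (J K : {set blob}) : [disjoint J & K] ->
  [disjoint region J & region K].
Proof.
move=> dJK; apply: bigcup_disjoint => k kK; rewrite disjoint_sym.
apply: bigcup_disjoint => j jJ; apply: dbl; apply: contraTneq kK => ->.
by rewrite (disjointFr dJK).
Qed.

Lemma regionU (J K : {set blob}) : region (J :|: K) = region J :|: region K.
Proof. by rewrite /region bigcup_setU. Qed.

Lemma region1 j : region [set j] = bl j.
Proof. by rewrite /region big_set1. Qed.

(** A tile blob takes part in at most one of the edges, never as its first blob, and so loses at
    most [q * t] vertices in all. *)
Lemma edges_pack es' : uniq (aug_blobs es') ->
  all (fun t => reduced (inr t.1) t.2.1 t.2.2) es' ->
  exists W : {set V}, [/\ W \subset region [set:: aug_blobs es'],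
    forall i p, #|W :&: bl (inl (i, p))| <= q * t & packs e t (size es' * q) W].
Proof.
elim: es' => [|[w [x y]] es' IH] /=.
  move=> _ _; exists set0; rewrite sub0set; split=> //.
    by move=> i p; rewrite set0I cards0.
  exact: packs0.
rewrite -/(aug_blobs _) !inE => /and4P[h1 h2 h3 us] /andP[hr /(IH us)[W [W1 W2 W3]]].
have [Z [Z1 Z2 Z3 Z4]] := hpack hr.
have out j : j \notin aug_blobs es' -> [disjoint bl j & W].
  move=> hj; apply: (disjointWr W1); rewrite -region1; apply: region_disjoint.
  by rewrite disjoints1 inE.
move: h1 h2; rewrite !negb_or => /and3P[wx wy hw] /andP[xy hx].
exists (Z :|: W); split.
- apply/subsetP=> v; rewrite in_setU => /orP[/(subsetP Z1)|/(subsetP W1)].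
    by rewrite !in_setU -!orbA => /or3P[] hv; apply/bigcupP;
      [exists (inr w)|exists x|exists y] => //; rewrite !inE ?eqxx ?orbT.
  move=> /bigcupP[j hj hv]; apply/bigcupP; exists j => //.
  by move: hj; rewrite !inE => ->; rewrite !orbT.
- move=> i p; rewrite setIUl.
  have inW j : j \in [:: inr w; x; y] -> W :&: bl j = set0.
    by move=> hj; apply: disjoint_setI0; rewrite disjoint_sym out //;
      move: hj; rewrite !inE => /or3P[]/eqP->.
  case: (eqVneq (inl (i, p)) x) => [->|nx].
    by rewrite inW ?inE ?eqxx ?orbT // setU0.
  case: (eqVneq (inl (i, p)) y) => [->|ny].
    by rewrite inW ?inE ?eqxx ?orbT // setU0.
  rewrite (_ : Z :&: _ = set0) ?set0U //; apply: disjoint_setI0.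
  apply: (disjointWl Z1); rewrite !disjointUl !dbl //; by rewrite eq_sym.
- rewrite mulSn; apply: packsU => //; apply: (disjointWl Z1).
  by rewrite !disjointUl !out.
Qed.

(** Completeness survives deletions, so only the number of vertices left in each blob counts. *)
Lemma tile_pack i (W : {set V}) s : (forall p, #|W :&: bl (inl (i, p))| <= s * t) ->
  packs e t (M - s) (region [set inl (i, p) | p : 'I_4] :\: W).
Proof.
move=> hW; pose b k : {set V} := bl (inl (i, inord k)) :\: W.
have db k l : k < 4 -> l < 4 -> k != l -> [disjoint b k & b l].
  move=> hk hl kl; apply: disjointWl (subsetDl _ _) (disjointWr (subsetDl _ _) _).
  apply: dbl; rewrite (inj_eq inl_inj) xpair_eqE eqxx /=.
  by rewrite -val_eqE /= !inordK.
have cb k : (M - s) * t <= #|b k|.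
  rewrite cardsD cbl mulnBl TM leq_sub2l // setIC; exact: hW.
apply: (@packsS _ _ _ _ (b 0 :|: b 1 :|: (b 2 :|: b 3))).
  rewrite -!setDUl setSD //; apply/subsetP=> v; rewrite !in_setU -!orbA.
  by case/or4P=> hv; apply/bigcupP;
    [exists (inl (i, inord 0))|exists (inl (i, inord 1))|exists (inl (i, inord 2))|exists
        (inl (i, inord 3))] => //;
    apply: imset_f.
apply: packs_complete.
- exact: cb.
- exact: cb.
- by rewrite cardsU (disjoint_setI0 (db 2 3 _ _ _)) // cards0 subn0 mul2n -addnn leq_add // cb.
- exact: db.
- by rewrite disjointUr !db.
- by rewrite disjointUr !db.
move=> x y z /setDP[hx _] /setDP[hy _]; have [_ _ hE] := tbl i.
have i0 : inord 0 = 0%R :> 'I_4 by apply: val_inj; rewrite /= inordK.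
have i1 : inord 1 = 1%R :> 'I_4 by apply: val_inj; rewrite /= inordK.
rewrite i0 in hx; rewrite i1 in hy.
by rewrite in_setU => /orP[]/setDP[hz _]; apply: (hE x y z _ hx hy _ hz); rewrite inordK.
Qed.

(** Each tile of [ts] drops from [M] to [M - q] small tiles and each edge brings [q]; one edge more
    than tiles leaves a net gain of [q]. *)
Lemma augmentation_pack T0 U0 ts es' : augmentation reduced T0 U0 ts es' ->
  packs e t (size ts * M + q)
    (region (avail [set:: ts] [set w | inr w \in aug_blobs es'])).
Proof.
case=> /andP[s1 s2] uts ues hr [_ hin].
have [W [W1 W2 W3]] := edges_pack ues hr.
have ht : packs e t (#|[set:: ts]| * (M - q))
    (\bigcup_(i in [set:: ts]) (region [set inl (i, p) | p : 'I_4] :\: W)).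
  apply: packs_big => [i _|i j _ _ ij]; first by apply: tile_pack.
  apply: disjointWl (subsetDl _ _) (disjointWr (subsetDl _ _) _).
  apply: region_disjoint; rewrite -setI_eq0; apply/eqP/setP=> z; rewrite !inE.
  apply/negP=> /andP[/imsetP[p _ ->] /imsetP[p' _ [E _]]].
  by move: ij; rewrite E eqxx.
have cts : #|[set:: ts]| = size ts by rewrite cardsE; apply/card_uniqP.
rewrite cts in ht.
apply: (@packs_leq _ _ _ _ (size es' * q + size ts * (M - q))).
  move: s1 qM; clear; nia.
apply: packsS (packsU _ W3 ht).
  rewrite subUset; apply/andP; split.
    apply: (subset_trans W1); apply/subsetP=> v /bigcupP[j hj hv].
    apply/bigcupP; exists j => //; move: hj; rewrite inE => hj.
    have [_ h] := hin j hj; case: j {hv} hj h => [[i p] _ h|w hw _]; rewrite !inE //=.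
    exact: (h i p erefl).
  apply/bigcupsP=> i; rewrite inE => its; apply: (subset_trans (subsetDl _ _)).
  apply/subsetP=> v /bigcupP[j /imsetP[p _ ->] hv]; apply/bigcupP; exists (inl (i, p)) => //.
  by rewrite !inE.
by apply: bigcup_disjoint => i _; apply: disjointD.
Qed.

(** An augmentation has at most 4 edges, hence at most 3 tiles and at most 12 uncovered blobs; the
    next one is sought among the rest. *)
Lemma many_augmentations K :
  (forall (TU : {set IT}) (UU : {set IU}), #|TU| <= 3 * K -> #|UU| <= 12 * K ->
     exists ts es, augmentation reduced (~: TU) (~: UU) ts es) ->
  forall k, k <= K -> exists (TU : {set IT}) (UU : {set IU}), [/\ #|TU| <= 3 * k, #|UU| <= 12
      * k &
    packs e t (#|TU| * M + k * q) (region (avail TU UU))].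
Proof.
move=> haug; elim=> [_|k IH hk].
  exists set0, set0; rewrite !cards0; split=> //; exact: packs0.
have [TU [UU [c1 c2 hp]]] := IH (ltnW hk).
have [||ts [es' ha]] := haug TU UU.
- by apply: (leq_trans c1); rewrite leq_mul2l ltnW ?orbT.
- by apply: (leq_trans c2); rewrite leq_mul2l ltnW ?orbT.
have hp' := augmentation_pack ha.
have [/andP[s1 s2] uts ues _ [tsT hin]] := ha.
set WU := [set w | inr w \in aug_blobs es'] in hp'.
have cts : #|[set:: ts]| = size ts by rewrite cardsE; apply/card_uniqP.
have dts : [disjoint TU & [set:: ts]].
  rewrite disjoint_sym disjoint_subset; apply/subsetP=> i; rewrite inE => /tsT.
  by rewrite !inE.
have cWU : #|WU| <= 12.
  rewrite -(card_imset _ (@inr_inj (IT * 'I_4)%type IU)).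
  apply: (@leq_trans (size (aug_blobs es'))).
    rewrite -(card_uniqP ues); apply: subset_leq_card; apply/subsetP=> _ /imsetP[w hw ->].
    by move: hw; rewrite inE.
  have : size (aug_blobs es') = 3 * size es'.
    by elim: (es') => //= a s; rewrite -/(aug_blobs _) => ->; rewrite mulnS.
  by move=> ->; move: s2; clear; lia.
exists (TU :|: [set:: ts]), (UU :|: WU); split.
- apply: (leq_trans (leq_card_setU _ _)); rewrite cts mulnS addnC leq_add //.
  by move: s1 s2; clear; lia.
- by apply: (leq_trans (leq_card_setU _ _)); rewrite mulnS addnC leq_add.
have -> : avail (TU :|: [set:: ts]) (UU :|: WU) = avail TU UU :|: avail [set:: ts] WU.
  by apply/setP=> -[[i p]|w]; rewrite !inE.
rewrite cardsU (disjoint_setI0 dts) cards0 subn0 cts regionU.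
have -> : (#|TU| + size ts) * M + k.+1 * q = (#|TU| * M + k * q) + (size ts * M + q).
  by clear; nia.
apply: packsU => //; apply: region_disjoint.
rewrite -setI_eq0; apply/eqP/setP=> -[[i p]|w]; rewrite !inE /=.
  apply/negP=> /andP[hi its]; have := disjointFr dts hi.
  by rewrite inE its.
apply/negP=> /andP[hw hw']; have [+ _] := hin _ hw'.
by rewrite !inE hw.
Qed.

Lemma improved_packing K :
  (forall (TU : {set IT}) (UU : {set IU}), #|TU| <= 3 * K -> #|UU| <= 12 * K ->
     exists ts es, augmentation reduced (~: TU) (~: UU) ts es) ->
  packs e t (#|IT| * M + K * q) (region setT).
Proof.
move=> /many_augmentations/(_ K (leqnn K))[TU [UU [_ _ hp]]].
have ht : packs e t (#|~: TU| * M) (\bigcup_(i in ~: TU) region [set inl (i, p) | p : 'I_4]).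
  apply: packs_big => [i _|i j _ _ ij].
    have := @tile_pack i set0 0; rewrite subn0 setD0; apply=> p.
    by rewrite set0I cards0.
  apply: region_disjoint; rewrite -setI_eq0; apply/eqP/setP=> z; rewrite !inE.
  apply/negP=> /andP[/imsetP[p _ ->] /imsetP[p' _ [E _]]].
  by move: ij; rewrite E eqxx.
have -> : #|IT| * M + K * q = #|TU| * M + K * q + #|~: TU| * M.
  by rewrite -(cardsC TU); clear; lia.
apply: packsS (packsU _ hp ht); first by rewrite /region; apply/subsetP=> v;
  rewrite in_setU => /orP[/bigcupP[j _ hj]|/bigcupP[i _ /bigcupP[j _ hj]]]; apply/bigcupP;
      exists j.
apply: bigcup_disjoint => i; rewrite inE => hi; apply: region_disjoint.
rewrite -setI_eq0; apply/eqP/setP=> z; rewrite !inE.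
apply/negP=> /andP[hz /imsetP[p _ zE]]; move: hz.
by rewrite zE /= (negbTE hi).
Qed.
End Improve.

Lemma card_avail (IT IU : finType) (T0 : {set IT}) (U0 : {set IU}) :
  #|avail T0 U0| = 4 * #|T0| + #|U0|.
Proof.
rewrite -sum1_card sum_avail sum1_card; congr (_ + _).
rewrite (eq_bigr (fun=> 4)); last by move=> t _; rewrite sum1_card card_ord.
by rewrite sum_nat_const mulnC.
Qed.

Lemma sum_restrict (J : finType) (A : {set J}) (f : J -> J -> bool) :
  \sum_x \sum_y f x y <= \sum_(x in A) \sum_(y in A) f x y + 2 * (#|~: A| * #|J|).
Proof.
have le1 (B : {set J}) x : \sum_(y in B) f x y <= #|B|.
  by rewrite -sum1_card; apply: leq_sum => y _; case: (f x y).
rewrite (bigID (mem A)) /= mul2n -addnn addnA leq_add //; last first.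
  rewrite -sum_nat_const (eq_bigl (mem (~: A))); last by move=> x; rewrite /= inE.
  by apply: leq_sum => x _; rewrite -sum1_card; apply: leq_sum => y _; case: (f x y).
apply: (@leq_trans (\sum_(x in A) (\sum_(y in A) f x y + #|~: A|))).
  apply: leq_sum => x _; rewrite (bigID (mem A)) /= leq_add2l.
  rewrite (eq_bigl (mem (~: A))); last by move=> y; rewrite /= inE.
  exact: le1.
by rewrite big_split /= leq_add2l sum_nat_const mulnC leq_mul2l max_card orbT.
Qed.

(** * Degrees in the reduced hypergraph *)

Section ReducedDegree.
Variables (R : realType) (V : finType) (e : V -> V -> V -> bool) (IT IU : finType).
Notation blob := ((IT * 'I_4) + IU)%type.
Variables (bl : blob -> {set V}) (T : nat) (eta D : R) (S : {set V}).
Hypothesis cbl : forall j, #|bl j| = T.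
Hypothesis dbl : forall j j', j != j' -> [disjoint bl j & bl j'].
Hypothesis sbl : forall j, bl j \subset S.
Hypothesis hd : mindeg e S D.
Hypothesis T0 : 0 < T.
Hypothesis eta0 : (0 <= eta)%R.
Hypothesis D0 : (0 <= D)%R.
Notation N := #|{: blob}|.
Hypothesis hS : #|S| <= N.+1 * T.
Notation Y := (\bigcup_j bl j).

Lemma card_blobs : #|Y| = N * T.
Proof.
rewrite -sum1_card partition_disjoint_bigcup // (eq_bigr (fun=> T)); last first.
  by move=> j _; rewrite sum1_card cbl.
by rewrite sum_nat_const.
Qed.

Lemma link_blobs v : #|link e S v| <= \sum_(b in Y) \sum_(c in Y) e v b c + 2 * (T * #|S|).
Proof.
have YS : Y \subset S by apply/bigcupsP=> j _.
have cD : #|S :\: Y| <= T.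
  rewrite cardsD (setIidPr YS) card_blobs leq_subLR; apply: leq_trans hS _.
  by rewrite mulSn addnC.
apply: (@leq_trans #|[set p in link e S v | (p.1 \in Y) && (p.2 \in Y)] :|: (setX (S :\: Y) S
    :|: setX S (S :\: Y))|).
  apply: subset_leq_card; apply/subsetP=> -[p q] hl; move: (hl).
  rewrite inE /= => /and3P[pS qS _]; rewrite in_setU inE hl /= in_setU !in_setX !in_setD pS qS.
  by case: (p \in Y); case: (q \in Y).
apply: leq_trans (leq_card_setU _ _) _; apply: leq_add.
  rewrite (_ : [set p in _ | _] = [set p | [&& p.1 \in Y, p.2 \in Y & e v p.1 p.2]]); last
      first.
    apply/setP=> -[p q]; rewrite [LHS]inE [RHS]inE inE /=.
    case pY : (p \in Y); rewrite ?andbF //; case qY : (q \in Y); rewrite ?andbF //.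
    by rewrite (subsetP YS p pY) (subsetP YS q qY) /= ?andbT.
  rewrite (card_pair (fun b c => [&& b \in Y, c \in Y & e v b c])).
  rewrite [leqRHS]big_mkcond; apply: leq_sum => b _.
  case bY : (b \in Y); rewrite ?sum_card_in.
    apply: subset_leq_card; apply/subsetP=> c; by rewrite !inE.
  by rewrite (_ : [set _ | _] = set0) ?cards0 //; apply/setP=> c; rewrite !inE.
apply: leq_trans (leq_card_setU _ _) _; rewrite !cardsX mul2n -addnn; apply: leq_add.
  by rewrite leq_mul2r cD orbT.
by rewrite mulnC leq_mul2r cD orbT.
Qed.

(** Double counting of the edges at the vertices of [bl w]: a dense pair of blobs accounts for at
    most [T ^ 3] of them, a sparse one for [eta * T ^ 3]. In the error, [3 * N] comes from pairs
    with a repeated blob and [2 * (N + 1)] from the at most [T] vertices outside all blobs. *)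
Lemma reduced_degree w :
  ((D - eta) * N%:R ^+ 2 - 5 * N%:R - 2 <=
    (\sum_x \sum_y reduced e bl T eta w x y)%:R)%R.
Proof.
have T0R : (0 < T%:R :> R)%R by rewrite ltr0n.
have sumE : \sum_x \sum_y e3 e (bl w) (bl x) (bl y) =
    \sum_(v in bl w) \sum_(b in Y) \sum_(c in Y) e v b c.
  rewrite /e3; under eq_bigr do rewrite exchange_big.
  rewrite exchange_big /=; apply: eq_bigr => v _.
  rewrite partition_disjoint_bigcup //; apply: eq_bigr => x _.
  by rewrite exchange_big; apply: eq_bigr => b _; rewrite partition_disjoint_bigcup.
have low : (T%:R * (D * #|S|%:R ^+ 2 - 2 * (T%:R * #|S|%:R)) <=
    (\sum_x \sum_y e3 e (bl w) (bl x) (bl y))%:R)%R.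
  rewrite sumE natr_sum -{1}(cbl w) mulr_natl -sumr_const; apply: ler_sum => v vw.
  have := link_blobs v; rewrite -(ler_nat R) natrD natrM natrM.
  have := hd (subsetP (sbl w) v vw).
  move: (#|_|%:R)%R => l; move: (D * _)%R => z; lra.
have up : ((\sum_x \sum_y e3 e (bl w) (bl x) (bl y))%:R <=
    T%:R ^+ 3 * (\sum_x \sum_y reduced e bl T eta w x y)%:R +
    (eta * T%:R ^+ 3 * N%:R ^+ 2 + 3 * N%:R * T%:R ^+ 3))%R.
  (* The number of coincidences is at least 1 on every degenerate pair, and easier to sum than an
     indicator. *)
  pose bad x y := (x == w) + (y == w) + (x == y).
  have hbad : (\sum_x \sum_y bad x y = 3 * N)%N.
    rewrite /bad; under eq_bigr do rewrite !big_split /= sum_nat_const.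
    have one (z : blob) : \sum_i (i == z) = 1.
      by rewrite (bigD1 z) //= eqxx big1 // => i /negbTE->.
    have one' (z : blob) : \sum_i (z == i) = 1.
      by rewrite -[RHS](one z); apply: eq_bigr => i _; rewrite eq_sym.
    under eq_bigr do rewrite one one'.
    by rewrite !big_split /= -big_distrr /= one !sum_nat_const !muln1 !mulSn mul0n addn0 addnA.
  apply: (@le_trans _ _ (\sum_x \sum_y (T%:R ^+ 3 * (reduced e bl T eta w x y)%:R + (eta *
      T%:R ^+ 3 + T%:R ^+ 3 * (bad x y)%:R)))%R).
    rewrite natr_sum; apply: ler_sum => x _; rewrite natr_sum; apply: ler_sum => y _.
    have hT : ((e3 e (bl w) (bl x) (bl y))%:R <= T%:R ^+ 3 :> R)%R.
      rewrite -natrX ler_nat; apply: leq_trans (e3_le _ _ _ _) _.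
      by rewrite !cbl !expnS expn0 muln1.
    have p3 : (0 <= T%:R ^+ 3 :> R)%R by rewrite exprn_ge0.
    have e3p : (0 <= (e3 e (bl w) (bl x) (bl y))%:R :> R)%R by [].
    have p4 : (0 <= eta * T%:R ^+ 3)%R by rewrite mulr_ge0.
    have p5 : (0 <= T%:R ^+ 3 * (bad x y)%:R :> R)%R by rewrite mulr_ge0.
    rewrite /reduced; case hu : (uniq _) => /=.
      case: (lerP (eta * T%:R ^+ 3)) => /= h; rewrite ?mulr1 ?mulr0 ?add0r.
        by apply: (le_trans hT); rewrite lerDl addr_ge0.
      by apply: (le_trans (ltW h)); rewrite lerDl.
    have : (T%:R ^+ 3 <= T%:R ^+ 3 * (bad x y)%:R :> R)%R.
      rewrite ler_peMr // ler1n lt0n; apply: contraFneq hu => /eqP.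
      rewrite /bad !addn_eq0 !eqb0 -andbA => /and3P[h1 h2 h3].
      by rewrite /= !inE negb_or h3 ![w == _]eq_sym h1 h2.
    by rewrite mulr0 add0r => hb; apply: (le_trans hT); apply: (le_trans hb); rewrite lerDr.
  clearbody bad; have sc (c : R) : (\sum_(x : blob) c = c * N%:R)%R by rewrite sumr_const
      mulr_natr.
  apply: (@le_trans _ _ (T%:R ^+ 3 * (\sum_x \sum_y reduced e bl T eta w x y)%:R + (eta *
      T%:R ^+ 3 * N%:R ^+ 2 + T%:R ^+ 3 * (\sum_x \sum_y bad x y)%:R))%R).
    rewrite (eq_bigr (fun x => (T%:R ^+ 3 * (\sum_y reduced e bl T eta w x y)%:R + (eta *
        T%:R ^+ 3 * N%:R + T%:R ^+ 3 * (\sum_y bad x y)%:R))%R)).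
      by rewrite !big_split /= sc -!mulr_sumr -!natr_sum expr2 mulrA.
    by move=> x _; rewrite !big_split /= sc -!mulr_sumr -!natr_sum.
  by rewrite hbad natrM [(_ * (3%:R * _))%R]mulrC.
have NT : (N%:R * T%:R <= #|S|%:R :> R)%R.
  by rewrite -natrM ler_nat -card_blobs subset_leq_card //; apply/bigcupsP.
have SN : (#|S|%:R <= (N%:R + 1) * T%:R :> R)%R.
  by rewrite natr1 -natrM ler_nat.
have := le_trans low up.
have N0 : (0 <= N%:R :> R)%R by [].
have n0 : (0 <= #|S|%:R :> R)%R by [].
move: NT SN T0R N0 n0 D0; move: (eta) (D) => eta' D'; clear.
move: eta' D' => eta D.
move: ((\sum_x _)%:R)%R (N%:R)%R (#|S|%:R)%R (T%:R)%R => s n m t h1 h2 t0 n0 m0 d0 h.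
have t3 : (0 < t ^+ 3)%R by rewrite exprn_gt0.
rewrite -(ler_pM2l t3).
have h3 : (D * (t * (n * t) ^+ 2) <= D * (t * m ^+ 2))%R.
  by rewrite ler_wpM2l // ler_pM2l // lerXn2r // nnegrE // mulr_ge0 // ltW.
have h4 : (t * (t * m) <= t * (t * ((n + 1) * t)))%R.
  by rewrite !ler_pM2l.
nra.
Qed.
End ReducedDegree.

Local Open Scope ring_scope.

(** * Linear inequalities for one round of augmentations *)

Section Arithmetic.
Variable R : realType.
Implicit Types x k n a g s : R.

Lemma blobs_left_half x k n' n g : n <= n' + 24 * k -> k <= x -> x <= g / 400 * n ->
  g * n <= 1 * n -> 0 <= n -> n <= 2 * n'.
Proof. lra. Qed.

Lemma uncovered_left x k u u' n a : 0 <= a * n -> u <= u' + 12 * k -> a / 2 * n <= u ->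
  k <= x -> x <= a / 400 * n -> a / 4 * n <= u'.
Proof. lra. Qed.

Lemma blobs_left_large x n n' g : 137 + 4 * x <= g * n -> g * n <= g * (2 * n') ->
  20 + x < g / 2 * n'.
Proof. lra. Qed.

Lemma reduced_degree_left g n k s s' : (7 / 16 + g - g / 8) * n ^+ 2 - 5 * n - 2 <= s ->
  s <= s' + 48 * (k * n) -> k * n <= g / 400 * n * n ->
  137 * n <= g * n * n -> 1 <= n -> (7 / 16 + g / 2) * n ^+ 2 <= s'.
Proof. rewrite expr2; lra. Qed.
Lemma blobs_ge1 x n g : 0 <= x -> 137 + x <= g * n -> g * n <= 1 * n -> 1 <= n.
Proof. lra. Qed.
Lemma blobs_cover_half a s n k : 2 * k <= a * s -> s <= (n + 1) * k -> a * s <= 1 * s ->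
  s <= 2 * (n * k).
Proof. lra. Qed.

Lemma half_le_floor x k : x < k + 1 -> 2 <= x -> x / 2 <= k.
Proof. lra. Qed.

Lemma sixteenth_le_floor x k : x / 8 < k + 1 -> 16 <= x -> x / 16 <= k.
Proof. lra. Qed.
End Arithmetic.

(* One round of augmentations: [M * t] is the old scale, [t] the new one. *)
Lemma improve_packing (R : realType) (gamma alpha : R) (t : nat) :
  0 < gamma -> gamma <= 1 -> 0 < alpha -> alpha <= 1 -> (0 < t)%N ->
  exists M n0 : nat, (0 < M)%N /\ forall (V : finType) (e : V -> V -> V -> bool) (S : {set V}),
  sym3 e -> (n0 <= #|S|)%N -> mindeg e S (7 / 16 + gamma) ->
  forall k, packs e (M * t) k S ->
  (4 * (k * (M * t)))%:R < (1 - alpha) * #|S|%:R ->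
  exists2 k', packs e t k' S &
    (4 * (k * (M * t)))%:R + gamma ^+ 2 * alpha / 512 / 100 * #|S|%:R <= (4 * (k' * t))%:R.
Proof.
move=> g0 g1 a0 a1 t0.
(* [eta] costs the reduced degree only [gamma / 8]. About [theta * N] augmentations will be made,
   few enough against [gamma] and [alpha] that degrees and uncovered blobs survive them all. *)
pose eta := gamma / 8; pose theta := gamma * alpha / 400.
have eta0 : 0 < eta by rewrite divr_gt0.
have theta0 : 0 < theta by rewrite divr_gt0 // mulr_gt0.
have [B hB] := box_pack t eta0.
have [n1 hn1] := @eventually_ge R 16 eta eta0.
pose M := (B + n1).+1; pose T := (M * t)%N.
have M0 : (0 < M)%N by [].
have T0 : (0 < T)%N by rewrite muln_gt0 M0.
have BT : (B <= T)%N.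
  by apply: (@leq_trans M); rewrite ?leq_pmulr // leqW // leq_addr.
have etaM : 16 <= eta * M%:R by apply: hn1; rewrite leqW // leq_addl.
(* [augmentation_exists] is used with [gamma / 2] and [alpha / 4], on at least half of the blobs, so
   4 times [20 + 12 / alpha] is needed; the surplus in 137 also absorbs the error [5 * N + 2] of
   [reduced_degree]. *)
pose c1 := 137 + 48 / alpha.
have [N1 hN1] := @eventually_ge R c1 gamma g0.
have [N2 hN2] := @eventually_ge R 2 theta theta0.
have [n3 hn3] := @eventually_ge R (2 * T%:R) alpha a0.
exists M, ((N1 + N2).+1 * T + n3)%N; split=> // V e S es hn hd k [f [f1 f2 f3]] hk.
rewrite -/T in f1 hk *.
have nN3 : (n3 <= #|S|)%N by apply: leq_trans hn; apply: leq_addl.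
have aT : 2 * T%:R <= alpha * #|S|%:R by apply: hn3.
pose C := \bigcup_(j : 'I_k * 'I_4) f j.1 j.2.
have CS : C \subset S by apply/bigcupsP=> j _.
have df j j' : j != j' -> [disjoint f j.1 j.2 & f j'.1 j'.2].
  case: j j' => [i p] [i' p']; rewrite xpair_eqE negb_and /=.
  case: (eqVneq i i') => [<- /= pp'|ii' _]; last exact: f2.
  by have [_ h _] := f1 i; apply: h.
have cf i p : #|f i p| = T by have [h _ _] := f1 i.
have cC : #|C| = (4 * (k * T))%N.
  rewrite -sum1_card partition_disjoint_bigcup // (eq_bigr (fun=> T)); last first.
    by move=> j _; rewrite sum1_card cf.
  by rewrite sum_nat_const card_prod !card_ord mulnA (mulnC 4).
have cSC : #|S :\: C| = (#|S| - 4 * (k * T))%N by rewrite cardsD (setIidPr CS) cC.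
pose u := (#|S :\: C| %/ T)%N.
have [g [g1' g2 g3]] : exists g : 'I_u -> {set V}, [/\ forall w, #|g w| = T, forall w, g w
    \subset S :\: C &
    forall w w', w != w' -> [disjoint g w & g w']].
  by apply: chunks; apply: leq_trunc_div.
pose bl (j : 'I_k * 'I_4 + 'I_u) := match j with inl x => f x.1 x.2 | inr w => g w end.
have cbl j : #|bl j| = T by case: j => [x|w] /=.
have dfg x w : [disjoint f x.1 x.2 & g w].
  have fC : f x.1 x.2 \subset C by apply: (bigcup_sup x).
  exact: disjointWl fC (disjointWr (g2 w) (disjointD _ _)).
have dbl j j' : j != j' -> [disjoint bl j & bl j'].
  case: j j' => [x|w] [x'|w'] /=; rewrite ?(inj_eq inl_inj) ?(inj_eq inr_inj).
  - exact: df.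
  - by move=> _; apply: dfg.
  - by move=> _; rewrite disjoint_sym; apply: dfg.
  - exact: g3.
have sbl j : bl j \subset S.
  case: j => [x|w] /=; first exact: f3.
  exact: subset_trans (g2 w) (subsetDl _ _).
pose N := #|{: 'I_k * 'I_4 + 'I_u}|.
have EN : N = (4 * k + u)%N.
  by rewrite /N card_sum card_prod !card_ord mulnC.
have hSN : (#|S| <= N.+1 * T)%N.
  have h1 : (#|S| - 4 * (k * T) < u.+1 * T)%N by rewrite -cSC ltn_ceil.
  have h2 : (4 * (k * T) <= #|S|)%N by rewrite -cC subset_leq_card.
  rewrite EN; move: h1 h2; clear; nia.
have NT : (N%:R * T%:R <= #|S|%:R :> R).
  by rewrite -natrM ler_nat -(card_blobs cbl dbl) subset_leq_card //; apply/bigcupsP.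
have uT : alpha / 2 * #|S|%:R <= u%:R * T%:R.
  have : #|S :\: C|%:R <= u.+1%:R * T%:R :> R by rewrite -natrM ler_nat ltnW // ltn_ceil.
  rewrite cSC natrB -?cC ?subset_leq_card // -(natr1 u) cC.
  move: hk aT; clear; move: (_ * (k * T))%:R (T%:R) (#|S|%:R) (u%:R) => x y s v; nra.
have NN : (N1 + N2 <= N)%N.
  have : ((N1 + N2).+1 * T <= N.+1 * T)%N.
    by apply: leq_trans hSN; apply: leq_trans hn; apply: leq_addr.
  by rewrite leq_pmul2r // ltnS.
have gN : c1 <= gamma * N%:R by apply: hN1; apply: leq_trans NN; apply: leq_addr.
have tN : 2 <= theta * N%:R by apply: hN2; apply: leq_trans NN; apply: leq_addl.
have T0R : 0 < T%:R :> R by rewrite ltr0n.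
have uN : alpha / 2 * N%:R <= u%:R.
  rewrite -(ler_pM2r T0R); apply: le_trans uT; rewrite -[leLHS]mulrA ler_wpM2l //.
  by rewrite divr_ge0 // ltW.
(* [K] augmentations gain [q] tiles each; [q] is the largest number of boxes that [box_pack] allows
   in an edge. *)
pose K := Num.truncn (theta * N%:R); pose q := Num.truncn (eta * M%:R / 8).
have K1 : K%:R <= theta * N%:R by rewrite truncn_le // ltW // (lt_le_trans _ tN).
have K2 : theta * N%:R < K%:R + 1 by rewrite natr1 truncnS_gt.
have q1 : q%:R <= eta * M%:R / 8.
  by rewrite truncn_le // divr_ge0 // (le_trans _ etaM).
have q2 : eta * M%:R / 8 < q%:R + 1 by rewrite natr1 truncnS_gt.
have M0R : 0 <= M%:R :> R by [].
have qM : (q <= M)%N.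
  rewrite -(ler_nat R); apply: (le_trans q1); rewrite /eta.
  have : gamma * M%:R <= 1 * M%:R by rewrite ler_wpM2r.
  by move: M0R; clear; lra.
have hq : (8 * (q * t))%:R <= eta * T%:R.
  rewrite /T !natrM mulrA (mulrA eta) ler_wpM2r //.
  by move: q1; clear; move: (eta * _) (q%:R) => x y; lra.
have tbl i : tile e T (fun p => bl (inl (i, p))) by apply: f1.
have hpk j x y : reduced e bl T eta j x y -> exists W : {set V},
   [/\ W \subset bl j :|: bl x :|: bl y, (#|W :&: bl x| <= q * t)%N,
    (#|W :&: bl y| <= q * t)%N & packs e t q W].
  case/andP; rewrite /= !inE negb_or => /and3P[/andP[jx jy] xy _] hE.
  by apply: (hB V e _ _ _ T es BT _ _ _ (dbl _ _ jx) (dbl _ _ jy) (dbl _ _ xy) hE); rewrite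
      ?cbl.
have imp : packs e t (#|'I_k| * M + K * q) (region bl setT).
  have TM : T = (M * t)%N by [].
  have hh := @improved_packing R V e 'I_k 'I_u bl T t M q eta cbl dbl tbl TM qM hpk K.
  apply: hh => TU UU hTU hUU.
  have a40 : 0 < alpha / 4 by rewrite divr_gt0.
  pose N' := (4 * #|~: TU| + #|~: UU|)%N.
  have cT : (#|TU| + #|~: TU| = k)%N by rewrite cardsC card_ord.
  have cU : (#|UU| + #|~: UU| = u)%N by rewrite cardsC card_ord.
  (* Per augmentation, 3 tiles of 4 blobs each and 12 uncovered blobs. *)
  have N'1 : (N <= N' + 24 * K)%N by rewrite EN /N'; move: hTU hUU cT cU; clear; lia.
  have N'2 : (N' <= N)%N by rewrite EN /N'; move: cT cU; clear; lia.
  have N'1R : N%:R <= N'%:R + 24 * K%:R :> R by rewrite -natrM -natrD ler_nat.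
  have N'2R : N'%:R <= N%:R :> R by rewrite ler_nat.
  have N0 : 0 <= N%:R :> R by [].
  have thN : theta * N%:R <= gamma / 400 * N%:R.
    rewrite ler_wpM2r // /theta ler_wpM2r ?invr_ge0 //.
    by rewrite ler_piMr // ltW.
  have thN2 : theta * N%:R <= alpha / 400 * N%:R.
    rewrite ler_wpM2r // /theta ler_wpM2r ?invr_ge0 //.
    by rewrite ler_piMl // ltW.
  have gN1 : gamma * N%:R <= 1 * N%:R by rewrite ler_wpM2r.
  have N'h : N%:R <= 2 * N'%:R :> R.
    exact: blobs_left_half N'1R K1 thN gN1 N0.
  apply: (@augmentation_exists R (gamma / 2) (alpha / 4) _ _ (reduced e bl T eta)) => //.
  - move=> w x y; rewrite /reduced (e3_swap (bl _)) //; congr (_ && _).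
    by rewrite /= !inE !negb_or !andbT [y == x]eq_sym (andbC (_ != x)).
  - by move=> w x y /andP[].
  - rewrite -/N'; have -> : 3 / (alpha / 4) = 12 / alpha by field; rewrite gt_eqF.
    have : gamma * N%:R <= gamma * (2 * N'%:R) by rewrite ler_pM2l.
    move: gN; rewrite /c1 (_ : 48 / alpha = 4 * (12 / alpha)); last by field; rewrite gt_eqF.
    exact: blobs_left_large.
  - have hU : u%:R <= #|~: UU|%:R + 12 * K%:R :> R.
      by rewrite -natrM -natrD ler_nat; move: hUU cU; clear; lia.
    apply: (@le_trans _ _ (alpha / 4 * N%:R)).
      by rewrite ler_wpM2l // ltW.
    have : 0 <= alpha * N%:R by rewrite mulr_ge0 // ltW.
    by move=> h; apply: uncovered_left h hU uN K1 thN2.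
  move=> w _.
  have D0 : 0 <= 7 / 16 + gamma by rewrite addr_ge0 // ?divr_ge0 // ltW.
  have := reduced_degree cbl dbl sbl hd T0 (ltW eta0) D0 hSN (inr w); rewrite -/N => h1.
  have := sum_restrict (avail (~: TU) (~: UU)) (reduced e bl T eta (inr w)).
  have -> : #|~: avail (~: TU) (~: UU)| = (N - N')%N by rewrite cardsCs setCK card_avail.
  rewrite -/N => h2.
  have h2R : (\sum_x \sum_y reduced e bl T eta (inr w) x y)%:R <=
      (\sum_(x in avail (~: TU) (~: UU)) \sum_(y in avail (~: TU) (~: UU)) reduced e bl T eta
          (inr w) x y)%:R
      + 48 * (K%:R * N%:R) :> R.
    rewrite -!natrM -natrD ler_nat; apply: (leq_trans h2); rewrite leq_add2l.
    rewrite (_ : (48 * (K * N) = 2 * (24 * K * N))%N); last by clear; lia.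
    by rewrite leq_mul2l leq_mul2r leq_subLR addnC (leq_trans N'1) ?orbT // addnC.
  have h3 : (7 / 16 + gamma / 2) * N'%:R ^+ 2 <= (7 / 16 + gamma / 2) * N%:R ^+ 2.
    rewrite ler_wpM2l ?lerXn2r ?nnegrE // addr_ge0 // ?divr_ge0 // ltW //.
  apply: (le_trans h3).
  have h4 : K%:R * N%:R <= gamma / 400 * N%:R * N%:R.
    by rewrite ler_wpM2r // (le_trans K1).
  have h5 : 137 * N%:R <= gamma * N%:R * N%:R.
    by rewrite ler_wpM2r //; apply: le_trans gN; rewrite /c1 lerDl divr_ge0 // ltW.
  have h6 : 1 <= N%:R :> R.
    have hx : 0 <= 48 / alpha by rewrite divr_ge0 // ltW.
    exact: blobs_ge1 hx gN gN1.
  exact: reduced_degree_left h1 h2R h4 h5 h6.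
exists (k * M + K * q)%N.
  move: imp; rewrite card_ord; apply: packsS; apply/bigcupsP=> j _; exact: sbl.
have S2 : #|S|%:R <= 2 * (N%:R * T%:R) :> R.
  have hS : #|S|%:R <= (N%:R + 1) * T%:R :> R by rewrite natr1 -natrM ler_nat.
  apply: blobs_cover_half aT hS _; by rewrite ler_wpM2r.
have K3 : theta / 2 * N%:R <= K%:R.
  rewrite mulrAC; exact: half_le_floor.
have q3 : eta / 16 * M%:R <= q%:R.
  rewrite mulrAC; exact: sixteenth_le_floor.
have N0 : 0 <= N%:R :> R by [].
(* The gain [4 * (K * q * t)] is thus at least [theta * eta / 8 * (N * T)], and [N * T] is at least
   half of [#|S|]: this gives the divisor 512 times 100. *)
have Kq : theta / 2 * N%:R * (eta / 16 * M%:R) <= K%:R * q%:R.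
  apply: ler_pM => //; rewrite mulr_ge0 // divr_ge0 // ltW //.
rewrite [in leRHS]mulnDl [in leRHS]mulnDr natrD -(mulnA k) lerD2l !natrM.
have : theta / 2 * N%:R * (eta / 16 * M%:R) * t%:R <= K%:R * q%:R * t%:R by rewrite ler_wpM2r.
have : gamma ^+ 2 * alpha / 512 / 100 * #|S|%:R <= gamma ^+ 2 * alpha / 512 / 100 * (2 *
    (N%:R * T%:R)).
  by rewrite ler_wpM2l // divr_ge0 // divr_ge0 // mulr_ge0 ?exprn_ge0 // ltW.
rewrite /T natrM /theta /eta => /le_trans + h; apply.
apply: le_trans (_ : 4 * (gamma * alpha / 400 / 2 * N%:R * (gamma / 8 / 16 * M%:R) * t%:R) <=
    _).
  by rewrite le_eqVlt; apply/orP; left; apply/eqP; field.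
by rewrite ler_pM2l.
Qed.

Lemma packs_refine (V : finType) (e : V -> V -> V -> bool) M t k (X : {set V}) :
  packs e (M * t) k X -> packs e t (k * M) X.
Proof.
case=> f [f1 f2 f3].
pose F i := f i 0 :|: f i 1 :|: (f i (inord 2) :|: f i (inord 3)).
have FX i : F i \subset X by rewrite !subUset !f3.
apply: (@packsS _ _ _ _ (\bigcup_(i in [set: 'I_k]) F i)).
  by apply/bigcupsP=> i _.
rewrite -[k in (k * M)%N]card_ord -cardsT; apply: packs_big => [i _|i j _ _ ij]; last first.
  by rewrite /F !disjointUl !disjointUr !(f2 i j).
have [c d h] := f1 i; rewrite mulnC in c.
have d01 : [disjoint f i 0 & f i 1] by apply: d.
have d23 : [disjoint f i (inord 2) & f i (inord 3)] by apply: d; rewrite -val_eqE /= !inordK.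
apply: packs_complete => //; rewrite ?c ?(mulnC M) //.
- by rewrite cardsU (disjoint_setI0 d23) cards0 subn0 !c mul2n -addnn.
- by rewrite disjointUr !d // -val_eqE /= inordK.
- by rewrite disjointUr !d // -val_eqE /= inordK.
move=> a b x ha hb; rewrite in_setU => /orP[] hx; apply: (h a b x _ ha hb _ hx);
  by rewrite inordK.
Qed.

(** Every round gains the fraction [delta]. Scales decrease from round to round, a tiling at scale
    [t] being made from one at scale [M * t]; therefore the induction on the number of rounds keeps
    [t] universally quantified. *)
Lemma almost_tiling_small (R : realType) (gamma alpha : R) :
  0 < gamma -> gamma <= 1 -> 0 < alpha -> alpha <= 1 -> forall t, (0 < t)%N ->
  exists n0 : nat, forall (V : finType) (e : V -> V -> V -> bool) (S : {set V}),
  sym3 e -> (n0 <= #|S|)%N -> mindeg e S (7 / 16 + gamma) ->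
  exists2 k, packs e t k S & (1 - alpha) * #|S|%:R <= (4 * (k * t))%:R.
Proof.
move=> g0 g1 a0 a1; pose delta := gamma ^+ 2 * alpha / 512 / 100.
have d0 : 0 < delta by rewrite divr_gt0 // divr_gt0 // mulr_gt0 ?exprn_gt0.
have step j : forall t, (0 < t)%N ->
  exists n0 : nat, forall (V : finType) (e : V -> V -> V -> bool) (S : {set V}),
  sym3 e -> (n0 <= #|S|)%N -> mindeg e S (7 / 16 + gamma) ->
  exists2 k, packs e t k S & (1 - alpha) * #|S|%:R <= (4 * (k * t))%:R \/
    delta * j%:R * #|S|%:R <= (4 * (k * t))%:R.
  elim: j => [|j IH] t t0.
    exists 0%N => V e S _ _ _; exists 0%N; first exact: packs0.
    by right; rewrite mulr0 mul0r.
  have [M [n1 [M0 hM]]] := improve_packing g0 g1 a0 a1 t0.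
  have [|n2 h2] := IH (M * t)%N; first by rewrite muln_gt0 M0.
  exists (n1 + n2)%N => V e S es hn hd.
  have [k pk hk] := h2 V e S es (leq_trans (leq_addl _ _) hn) hd.
  case: (lerP ((1 - alpha) * #|S|%:R) (4 * (k * (M * t)))%:R) => h.
    exists (k * M)%N; first exact: packs_refine.
    by left; rewrite -(mulnA k).
  have [k' pk' hk'] := hM V e S es (leq_trans (leq_addr _ _) hn) hd k pk h.
  exists k' => //; right; apply: le_trans hk'.
  case: hk => hk; first by rewrite ltNge hk in h.
  rewrite -/delta -(natr1 j) mulrDr mulrDl mulr1; exact: lerD.
have [j hj] := @eventually_ge R (1 - alpha) delta d0.
move=> t t0; have [n0 h] := step j t t0; exists n0 => V e S es hn hd.
have [k pk hk] := h V e S es hn hd; exists k => //.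
case: hk => // hk; apply: le_trans hk.
by rewrite ler_wpM2r // hj.
Qed.

Lemma almost_tiling (R : realType) (gamma alpha : R) t :
  0 < gamma -> 0 < alpha -> (0 < t)%N ->
  exists n0 : nat, forall (V : finType) (e : V -> V -> V -> bool) (S : {set V}),
  sym3 e -> (n0 <= #|S|)%N -> mindeg e S (7 / 16 + gamma) ->
  exists2 k, packs e t k S & (1 - alpha) * #|S|%:R <= (4 * (k * t))%:R.
Proof.
move=> g0 a0 t0.
have g1 : 0 < Num.min gamma 1 by rewrite lt_min g0 ltr01.
have a1 : 0 < Num.min alpha 1 by rewrite lt_min a0 ltr01.
have [||n0 h] := almost_tiling_small g1 _ a1 _ t0; rewrite ?ge_min ?lexx ?orbT //.
exists n0 => V e S es hn hd.
have [|k pk hk] := h V e S es hn.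
  move=> x xS; apply: le_trans (hd x xS); rewrite ler_wpM2r ?exprn_ge0 //.
  by rewrite lerD2l ge_min lexx.
exists k => //; apply: le_trans hk; rewrite ler_wpM2r // lerD2l lerN2.
by rewrite ge_min lexx.
Qed.

(** * Reservoir and absorbing family *)

(** Forbidding the vertices of [W] spoils at most [#|W|] members of a disjoint family. *)
Lemma disjoint_hitting (V T : finType) (supp : T -> {set V}) (W : {set V}) s :
  pairwise (fun t t' => [disjoint supp t & supp t']) s ->
  (forall t, t \in s -> ~~ [disjoint supp t & W]) -> (size s <= #|W|)%N.
Proof.
elim: s W => //= t s IH W /andP[/allP hts hs] hW.
have : ~~ [disjoint supp t & W] by apply: hW; rewrite mem_head.
rewrite -setI_eq0 => /set0Pn[v]; rewrite inE => /andP[vt vW].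
have h : (size s <= #|W :\: supp t|)%N.
  apply: IH => // t' ht'; have : ~~ [disjoint supp t' & W] by apply: hW; rewrite inE ht' orbT.
  rewrite -!setI_eq0 => /set0Pn[v']; rewrite inE => /andP[vt' vW'].
  apply/set0Pn; exists v'; rewrite !inE vt' vW' andbT /=.
  apply/negP=> h; have := hts _ ht'; rewrite -setI_eq0 => /eqP/setP/(_ v').
  by rewrite !inE h vt'.
apply: leq_ltn_trans h _; apply: proper_card; apply/properP; split; first exact: subsetDl.
by exists v; rewrite // inE vt.
Qed.

Lemma card_bigcup_seq (V T : finType) (supp : T -> {set V}) k s :
  (forall t, t \in s -> (#|supp t| <= k)%N) -> (#|\bigcup_(t in s) supp t| <= k * size s)%N.
Proof.
rewrite -bigcup_seq; elim: s => [|t s IH] h; first by rewrite big_nil cards0.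
rewrite big_cons; apply: leq_trans (leq_card_setU _ _) _; rewrite mulnS leq_add //.
  by apply: h; rewrite mem_head.
by apply: IH => t' ht'; apply: h; rewrite inE ht' orbT.
Qed.

Section Families.
Variable R : realType.
Notation kap := (1 / 2000 : R).

Definition connects (V : finType) (e : V -> V -> V -> bool) (a b : V) (k : V * (V * V)) :=
  e a k.1 k.2.1 && e k.2.1 k.2.2 b.
Definition triple_seq (V : finType) (k : V * (V * V)) := [:: k.1; k.2.1; k.2.2].

(* Up to [w] vertices of [P] can be used up before [P] stops connecting some pair. *)
Definition connecting (V : finType) (e : V -> V -> V -> bool) (S P : {set V}) (w : R) :=
  forall a b (W : {set V}), a \in S -> b \in S -> #|W|%:R <= w ->
  exists k, [/\ connects e a b k, uniq (triple_seq k) &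
    {in triple_seq k, forall v, (v \in P) && (v \notin W)}].

Lemma fresh_disjoint (V : finType) (S W : {set V}) s :
  fresh S W s = fresh S set0 s && [disjoint [set:: s] & W].
Proof.
rewrite /fresh -andbA; congr (_ && _); elim: s => [|v s IH] /=.
  by rewrite -setI_eq0 (_ : [set:: [::]] = set0) ?set0I ?eqxx //; apply/setP=> v; rewrite !inE.
rewrite IH inE /= andbT (_ : [set:: v :: s] = v |: [set:: s]); last by apply/setP=> u;
    rewrite !inE.
rewrite disjointUl disjoints1; case: (v \in S); case: (v \in W); case: (all _ s) => //=;
    rewrite ?andbF //.
Qed.

(** [S] itself is a reservoir, with a budget that does not depend on earlier choices. It will link
    the absorbers, which may be too many for the small reservoir. *)
Lemma connecting_all : exists2 n0 : nat, (0 < n0)%N &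
  forall (V : finType) (e : V -> V -> V -> bool) (S : {set V}),
  sym3 e -> (n0 <= #|S|)%N -> mindeg e S (7 / 16 : R) ->
  connecting e S S (kap / 2 * #|S|%:R).
Proof.
have k0 : 0 < kap / 2 by rewrite divr_gt0 // divr_gt0.
have [n1 h1] := @eventually_ge R 7 (kap / 2) k0.
exists n1.+1 => // V e S es hn hd a b W aS bS hW.
have h7 := h1 _ (ltnW hn).
have n0 : 0 < #|S|%:R :> R by rewrite ltr0n; apply: leq_trans hn.
have hW' : #|W|%:R + 7 <= kap * #|S|%:R by move: hW h7; clear; lra.
have := card_connector es hd aS bS hW'.
have p0 : 0 < (kap * #|S|%:R) ^+ 3 by rewrite exprn_gt0 // mulr_gt0 // divr_gt0.
move=> /(lt_le_trans p0); rewrite ltr0n => /card_gt0P[[y [x z]]].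
rewrite inE /fresh => /and3P[/andP[uz /allP az] h2 h3]; exists (x, (y, z)).
rewrite /connects /= h2 h3; split=> //.
  by move: uz; rewrite /= !inE !negb_or !andbT => /andP[/andP[zx zy] xy]; rewrite xy eq_sym
      zx eq_sym zy.
by move=> v hv; apply: az; move: hv; rewrite !inE; case: (v == x); case: (v == y); case: (v
    == z).
Qed.

Lemma divn_ge (Q n : nat) : (0 < Q)%N -> (2 * Q <= n)%N ->
  (1 / (2 * Q%:R)) * n%:R <= (n %/ Q)%:R :> R.
Proof.
move=> Q0 hn; have Q0R : 0 < Q%:R :> R by rewrite ltr0n.
rewrite mulrAC ler_pdivrMr ?mulr_gt0 // mul1r -!natrM ler_nat.
have := ltn_ceil n Q0; have : (2 <= n %/ Q)%N by rewrite leq_divRL.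
clear; nia.
Qed.

(** [selection] for the pairs of vertices and their connectors: every pair gets at least [#|S| %/ Q]
    disjoint connectors inside [P], of which [W] meets at most [#|W|]. *)
Lemma reservoir (eps : R) : 0 < eps ->
  exists (beta : R) (n0 : nat), 0 < beta /\
  forall (V : finType) (e : V -> V -> V -> bool) (S W0 : {set V}),
  sym3 e -> (n0 <= #|S|)%N -> mindeg e S (7 / 16 : R) -> #|W0|%:R <= kap / 4 * #|S|%:R ->
  exists P : {set V}, [/\ P \subset S, [disjoint P & W0], #|P|%:R <= eps * #|S|%:R &
    connecting e S P (beta * #|S|%:R)].
Proof.
move=> e0; pose eps' := Num.min eps (kap / 4).
have k0 : 0 < kap by rewrite divr_gt0.
have e'0 : 0 < eps' by rewrite lt_min e0 divr_gt0.
have c0 : 0 < kap ^+ 3 by rewrite exprn_gt0.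
have c1 : kap ^+ 3 <= 1 by rewrite exprn_ile1 ?ltW //; lra.
have [Q [n1 [Q0 hQ]]] := @selection R (kap ^+ 3) eps' 3 c0 c1 e'0.
have k40 : 0 < kap / 4 by rewrite divr_gt0.
have [n2 h2] := @eventually_ge R 7 (kap / 4) k40.
have Q0R : 0 < Q%:R :> R by rewrite ltr0n.
(* The extra factor 1/2 makes the number of connectors strictly larger than [#|W|]. *)
exists (1 / (2 * Q%:R) / 2), (n1 + n2 + 2 * Q).+1; split.
  by rewrite divr_gt0 // divr_gt0 // mulr_gt0.
move=> V e S W0 es hn hd hW0.
have hn1 : (n1 <= #|S|)%N by move: hn; clear; lia.
have hn2 : (n2 <= #|S|)%N by move: hn; clear; lia.
have hn3 : (2 * Q <= #|S|)%N by move: hn; clear; lia.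
have S0 : (0 < #|S|)%N by apply: leq_ltn_trans hn.
have S0R : 0 < #|S|%:R :> R by rewrite ltr0n.
pose supp (t : V * (V * V)) := [set:: [:: t.2.2; t.2.1; t.1]].
pose B (i : V * V) := connector e S i.1 i.2 set0.
have supp_le (t : V * (V * V)) : (#|supp t| <= 3)%N by rewrite cardsE; apply: card_size.
have Bfresh i t : t \in B i -> fresh S set0 [:: t.2.2; t.2.1; t.1].
  by case: t => [y [x z]]; rewrite inE => /and3P[].
have Bsub i t : t \in B i -> supp t \subset S.
  move=> /Bfresh /andP[_ /allP h]; apply/subsetP=> v; rewrite inE => /h.
  by case/andP.
have [|||||s [s1 s2 s3 s4 s5]] := hQ _ hn1 V _ _ supp (setX S S) B W0 (#|S|%:R ^+ 3).
- by rewrite cardsX -mulnn leqnn muln_gt0 S0.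
- by rewrite exprn_gt0.
- by [].
- rewrite -natrX ler_nat (_ : #|S| ^ 3 = #|setX S (setX S S)|)%N; last first.
    by rewrite !cardsX !expnS expn0 muln1.
  apply: subset_leq_card; apply/bigcupsP=> i _; apply/subsetP=> t /Bsub/subsetP h.
  by case: t h => [y [x z]] h; rewrite !in_setX !h // inE /= !inE eqxx ?orbT.
- move=> W [a b]; rewrite in_setX /= => /andP[aS bS] hW.
  have hW7 : #|W|%:R + 7 <= kap * #|S|%:R.
    have : eps' * #|S|%:R <= kap / 4 * #|S|%:R by rewrite ler_pM2r // ge_min lexx orbT.
    have := h2 _ hn2; move: hW hW0; clear; lra.
  apply: (@le_trans _ _ ((kap * #|S|%:R) ^+ 3)); first by rewrite [leRHS]exprMn.
  apply: (le_trans (card_connector es hd aS bS hW7)); rewrite ler_nat.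
  apply: subset_leq_card; apply/subsetP=> -[y [x z]].
  by rewrite !inE fresh_disjoint => /and3P[/andP[-> ->] -> ->].
exists (\bigcup_(t in s) supp t); split.
- apply/bigcupsP=> t /s4[i _ /Bsub]; exact.
- by rewrite disjoint_sym; apply: bigcup_disjoint => t ht; rewrite disjoint_sym; apply: s3.
- apply: (@le_trans _ _ (3 * size s)%:R).
    by rewrite ler_nat; apply: card_bigcup_seq.
  by apply: (le_trans s1); rewrite ler_pM2r // ge_min lexx.
move=> a b W aS bS hW.
have hc := s5 (a, b); rewrite in_setX aS bS /= in hc; have {}hc := hc isT.
have lt : (#|W| < count (mem (B (a, b))) s)%N.
  apply: leq_trans hc; rewrite -(ltr_nat R); apply: le_lt_trans hW _.
  apply: lt_le_trans (divn_ge Q0 hn3); rewrite ltr_pM2r //.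
  have : 0 < 1 / (2 * Q%:R) :> R by rewrite divr_gt0 // mulr_gt0.
  clear; lra.
have [t ts [tB tW]] : exists2 t, t \in s & t \in B (a, b) /\ [disjoint supp t & W].
  have [/hasP[t ts /andP[h1 h2']]|] := boolP (has (fun t => (t \in B (a, b)) && [disjoint
      supp t & W]) s).
    by exists t.
  rewrite -all_predC => /allP h; move: lt; rewrite ltnNge -size_filter => /negP[].
  apply: (disjoint_hitting (supp := supp)); first exact: pairwise_filter.
  move=> t; rewrite mem_filter => /andP[h1 /h] /=.
  by rewrite (_ : t \in B (a, b)).
have tP v : v \in supp t -> (v \in \bigcup_(t in s) supp t) && (v \notin W).
  move=> vt; rewrite (disjointFr tW vt) andbT; apply/bigcupP; by exists t.
case: t tB {ts tW} tP => y [x z]; rewrite inE /fresh => /and3P[/andP[uz _] h3 h4] tP.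
exists (x, (y, z)); rewrite /connects /= h3 h4; split=> //.
  by move: uz; rewrite /= !inE !negb_or !andbT => /andP[/andP[zx zy] xy]; rewrite xy eq_sym
      zx eq_sym zy.
by move=> v hv; apply: tP; move: hv; rewrite !inE; case: (v == x); case: (v == y); case: (v
    == z).
Qed.

Definition septuple_seq (V : finType) (t : septuple V) : seq V :=
  let: (v4, (v6, ((v3, v5), (v2, (v1, v7))))) := t in [:: v1; v2; v3; v4; v5; v6; v7].

(** [selection] again, with proportion [kap ^+ 7] from [card_absorber]. One family serves all pairs,
    so the pairs left over need not be known in advance. *)
Lemma absorber_family (eps : R) : 0 < eps -> eps <= kap / 4 ->
  exists (beta : R) (n0 : nat), 0 < beta /\
  forall (V : finType) (e : V -> V -> V -> bool) (S : {set V}),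
  sym3 e -> (n0 <= #|S|)%N -> mindeg e S (7 / 16 : R) ->
  exists A : seq (septuple V), [/\ (7 * size A)%:R <= eps * #|S|%:R,
    pairwise (fun t t' => [disjoint [set:: septuple_seq t] & [set:: septuple_seq t']]) A,
    {in A, forall t, exists x y, t \in absorber e S x y set0} &
    forall x y, x \in S -> y \in S -> beta * #|S|%:R <= (count (mem (absorber e S x y set0))
        A)%:R].
Proof.
move=> e0 ek.
have k0 : 0 < kap by rewrite divr_gt0.
have c0 : 0 < kap ^+ 7 by rewrite exprn_gt0.
have c1 : kap ^+ 7 <= 1 by rewrite exprn_ile1 ?ltW //; lra.
have [Q [n1 [Q0 hQ]]] := @selection R (kap ^+ 7) eps 7 c0 c1 e0.
have k40 : 0 < kap / 4 by rewrite divr_gt0.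
have [n2 h2] := @eventually_ge R 7 (kap / 4) k40.
exists (1 / (2 * Q%:R)), (n1 + n2 + 2 * Q).+1; split.
  by rewrite divr_gt0 // mulr_gt0 // ltr0n.
move=> V e S es hn hd.
have hn1 : (n1 <= #|S|)%N by move: hn; clear; lia.
have hn2 : (n2 <= #|S|)%N by move: hn; clear; lia.
have hn3 : (2 * Q <= #|S|)%N by move: hn; clear; lia.
have S0 : (0 < #|S|)%N by apply: leq_ltn_trans hn.
have S0R : 0 < #|S|%:R :> R by rewrite ltr0n.
pose supp (t : septuple V) := [set:: septuple_seq t].
pose B (i : V * V) := absorber e S i.1 i.2 set0.
pose sv (t : septuple V) : seq V := let: (v4, (v6, ((v3, v5), (v2, (v1, v7))))) := t in
  [:: v7; v1; v2; v5; v3; v6; v4].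
have svE t : [set:: sv t] = supp t.
  case: t => [v4 [v6 [[v3 v5] [v2 [v1 v7]]]]]; apply/setP=> v; rewrite !inE.
  by do 7! case: (v == _).
have supp_le t : (#|supp t| <= 7)%N.
  rewrite cardsE; apply: (leq_trans (card_size _)).
  by case: t => [v4 [v6 [[v3 v5] [v2 [v1 v7]]]]].
have BE (W : {set V}) i t : (t \in absorber e S i.1 i.2 W) = (t \in B i) && [disjoint supp t
    & W].
  rewrite -svE; case: t => [v4 [v6 [[v3 v5] [v2 [v1 v7]]]]]; rewrite !inE (fresh_disjoint S W).
  case: (fresh S set0 [:: v7; v1; v2; v5; v3; v6; v4]) => //.
  by rewrite !andTb [LHS]andbC.
have Bsub i t : t \in B i -> supp t \subset S.
  rewrite -svE; case: t => [v4 [v6 [[v3 v5] [v2 [v1 v7]]]]]; rewrite inE => /andP[/andP[_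
      /allP h] _].
  by apply/subsetP=> v; rewrite inE => /h/andP[].
have [|||||s [s1 s2 s3 s4 s5]] := hQ _ hn1 V _ _ supp (setX S S) B set0 (#|S|%:R ^+ 7).
- by rewrite cardsX -mulnn leqnn muln_gt0 S0.
- by rewrite exprn_gt0.
- by [].
- rewrite -natrX ler_nat (_ : #|S| ^ 7 = #|setX S (setX S (setX (setX S S) (setX S (setX S
    S))))|)%N; last first.
    rewrite !cardsX !expnS expn0 muln1; move: #|S| => m; clear; ring.
  apply: subset_leq_card; apply/bigcupsP=> i _; apply/subsetP=> t /Bsub/subsetP h.
  case: t h => [v4 [v6 [[v3 v5] [v2 [v1 v7]]]]] h; rewrite !in_setX /=.
  by rewrite !h // inE /= !inE eqxx ?orbT.
- move=> W [x y]; rewrite in_setX /= => /andP[xS yS] hW.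
  have hW7 : #|W|%:R + 7 <= kap * #|S|%:R.
    have : eps * #|S|%:R <= kap / 4 * #|S|%:R by rewrite ler_pM2r.
    have := h2 _ hn2; move: hW; rewrite cards0; move: S0R; clear; lra.
  apply: (@le_trans _ _ ((kap * #|S|%:R) ^+ 7)); first by rewrite [leRHS]exprMn.
  apply: (le_trans (card_absorber es hd xS yS hW7)); rewrite ler_nat.
  apply: subset_leq_card; apply/subsetP=> t; rewrite inE => ht.
  by rewrite -BE.
exists s; split=> //.
  by move=> t /s4[[x y] _ ht]; exists x, y.
move=> x y xS yS; apply: (le_trans (divn_ge Q0 hn3)); rewrite ler_nat.
by apply: (s5 (x, y)); rewrite in_setX xS.
Qed.
End Families.

(** * Loose paths *)

Local Open Scope nat_scope.

Section Paths.
Variables (V : finType) (e : V -> V -> V -> bool).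

(* [loose c z]: [c] followed by [z] is a loose path whose edges start at the
   even positions of [c]. *)
Fixpoint loose (c : seq V) (z : V) : bool :=
  match c with
  | [::] => true
  | x :: y :: c' => e x y (head z c') && loose c' z
  | [:: _] => false
  end.

Lemma head_cat (z : V) c1 c2 : head z (c1 ++ c2) = head (head z c2) c1.
Proof. by case: c1. Qed.

Lemma loose_cat c1 c2 z : ~~ odd (size c1) ->
  loose (c1 ++ c2) z = loose c1 (head z c2) && loose c2 z.
Proof.
have [n] := ubnP (size c1); elim: n c1 => // n IH [|x [|y c1]] //= hn.
by rewrite negbK => h; rewrite head_cat -andbA IH // ltnW.
Qed.

Lemma loose_even c z : loose c z -> ~~ odd (size c).
Proof.
have [n] := ubnP (size c); elim: n c => // n IH [|x [|y c]] //= hn.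
by move=> /andP[_ h]; rewrite negbK IH // ltnW.
Qed.

(** The connector's second edge is closed by the head of whatever follows. Blocks of loose segments
    therefore have even length and can be concatenated. *)
Definition link_block (s : seq V * V) (k : V * (V * V)) := s.1 ++ s.2 :: triple_seq k.

(** Built from the end, so that the target of each connector, the head of the remaining path, is
    known. A connector avoids [W0] and the connectors already placed, 3 vertices each; disjointness
    from the segments has to come from [P] or [W0]. *)
Lemma join_segments (R : realType) (S P : {set V}) (w : R) segs (z : V) (W0 : {set V}) :
  connecting e S P w -> ((#|W0| + 3 * size segs)%:R <= w)%R -> z \in S ->
  {in segs, forall s, [/\ loose s.1 s.2, s.2 \in S & {subset s.1 <= S}]} ->
  exists ks, [/\ size ks = size segs,
    loose (flatten [seq link_block t.1 t.2 | t <- zip segs ks]) z,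
    uniq (flatten (map (@triple_seq V) ks)) &
    {in flatten (map (@triple_seq V) ks), forall v, (v \in P) && (v \notin W0)}].
Proof.
move=> hP + zS; elim: segs => [|s segs IH] hw hs; first by exists [::].
have [||ks [k1 k2 k3 k4]] := IH.
- by apply: le_trans hw; rewrite ler_nat leq_add2l leq_mul2l leqnSn orbT.
- by move=> t ht; apply: hs; rewrite inE ht orbT.
have [l1 l2 l3] := hs s (mem_head _ _).
set c := flatten _ in k2.
have hS : head z c \in S.
  have := hs; rewrite /c; case: (segs) (ks) k1 => [|[s1 s2] segs'] [|k ks'] //= _ h.
  have [|_ h2 h3] := h (s1, s2); first by rewrite !inE eqxx orbT.
  by rewrite /link_block /= -catA; case: (s1) h3 => [|v s1'] h3 //=; apply: h3; rewrite
      mem_head.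
have [|k [q1 q2 q3]] := hP s.2 (head z c) (W0 :|: [set:: flatten (map (@triple_seq V) ks)])
    l2 hS.
  apply: le_trans hw; rewrite ler_nat; apply: (leq_trans (leq_card_setU _ _)).
  rewrite leq_add2l cardsE; apply: (leq_trans (card_size _)).
  have -> : size (flatten (map (@triple_seq V) ks)) = 3 * size ks.
    by elim: (ks) => //= a l ->; rewrite mulnS.
  by rewrite k1 leq_mul2l leqnSn orbT.
exists (k :: ks); split.
- by rewrite /= k1.
- rewrite /= -/c -catA loose_cat ?(loose_even l1) //= l1 k2 andbT.
  by move: q1; rewrite /connects => /andP[-> ->].
- rewrite -[flatten _]/(triple_seq k ++ flatten (map (@triple_seq V) ks)).
  rewrite cat_uniq q2 k3 andbT.
  apply/hasPn=> v hv; apply/negP=> /q3; rewrite in_setU negb_or inE hv.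
  by rewrite !andbF.
- move=> v; rewrite -[flatten _]/(triple_seq k ++ flatten (map (@triple_seq V) ks)) mem_cat
    => /orP[/q3|/k4//].
  by rewrite in_setU negb_or => /and3P[-> ->].
Qed.

Definition absorber_block (t : septuple V) (k : V * (V * V)) := septuple_seq t ++ triple_seq k.

(** Same head and same connector as [absorber_block], and two more vertices: it can replace that
    block inside a path without changing parity or affecting the neighbouring blocks. *)
Definition absorbed_block (t : septuple V) (k : V * (V * V)) (x y : V) :=
  let: (v4, (v6, ((v3, v5), (v2, (v1, v7))))) := t in
  [:: v1; v3; v2; x; v4; y; v6; v5; v7] ++ triple_seq k.

Hypothesis es : sym3 e.

Lemma absorbed_loose S x y t k z : t \in absorber e S x y set0 ->
  loose (absorber_block t k) z -> loose (absorbed_block t k x y) z.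
Proof.
have [s1 s2] := es.
case: t => [v4 [v6 [[v3 v5] [v2 [v1 v7]]]]]; rewrite inE /=.
case/and4P=> _ /and3P[h1 h2 h3] h4 h5 /and5P[_ _ _ h6 h7].
by rewrite (s2 v1) h1 h4 h5 (s1 v6) h3 h6 h7.
Qed.

Lemma perm_absorbed x y t k :
  perm_eq (absorbed_block t k x y) (x :: y :: absorber_block t k).
Proof.
case: t => [v4 [v6 [[v3 v5] [v2 [v1 v7]]]]]; apply/permP=> p /=.
move: (nat_of_bool (p v7)) (nat_of_bool (p v1)) (nat_of_bool (p v2)) => a1 a2 a3.
move: (nat_of_bool (p v5)) (nat_of_bool (p v3)) (nat_of_bool (p v6)) => a4 a5 a6.
move: (nat_of_bool (p v4)) (nat_of_bool (p x)) (nat_of_bool (p y)) => a7 a8 a9.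
by move: (_ + (_ + (_ + 0)))%N => a10; clear; lia.
Qed.

(** [head z c = z] says that the path closes up. Keeping it as a list of blocks leaves the other
    absorbers visible after an exchange; each absorber spent costs every remaining pair at most one
    candidate. *)
Lemma absorb_pairs S (ps : seq (V * V)) (bs : seq (seq V)) (A : seq (septuple V)) (z : V) :
  {in bs, forall b, ~~ odd (size b)} -> loose (flatten bs) z -> head z (flatten bs) = z ->
  uniq A -> {in A, forall t, exists k, absorber_block t k \in bs} ->
  {in ps, forall p, size ps <= count (mem (absorber e S p.1 p.2 set0)) A} ->
  exists c, [/\ loose c z, head z c = z & 
     perm_eq c (flatten [seq [:: p.1; p.2] | p <- ps] ++ flatten bs)].
Proof.
elim: ps bs A => [|[x y] ps IH] bs A hev hl hh uA hA hps.
  by exists (flatten bs); split=> //=.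
have := hps (x, y) (mem_head _ _); rewrite /= => hc.
have /hasP[t tA tabs] : has (mem (absorber e S x y set0)) A.
  by rewrite has_count; apply: leq_trans hc.
have [k hk] := hA t tA.
case/splitPr: hk hev hl hh hA => b1 b2 hev hl hh hA.
set b := absorber_block t k; set b' := absorbed_block t k x y.
have szb : size b' = (size b).+2 by rewrite (perm_size (perm_absorbed x y t k)).
have evb : ~~ odd (size b) by apply: hev; rewrite mem_cat mem_head orbT.
have evb' : ~~ odd (size b') by rewrite szb /= negbK.
have ev1 : ~~ odd (size (flatten b1)).
  have : {in b1, forall b, ~~ odd (size b)} by move=> d hd; apply: hev; rewrite mem_cat hd.
  elim: (b1) => //= d l IHl h; rewrite size_cat oddD (negbTE (h d (mem_head _ _))) /=.
  by apply: IHl => f hf; apply: h; rewrite inE hf orbT.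
have hd0 z0 : head z0 b' = head z0 b.
  by rewrite /b /b'; case: (t) => [v4 [v6 [[v3 v5] [v2 [v1 v7]]]]].
have fE d : flatten (b1 ++ d :: b2) = flatten b1 ++ (d ++ flatten b2) by rewrite flatten_cat.
have hdbb z0 l : head z0 (b' ++ l) = head z0 (b ++ l) by rewrite (head_cat _ b') (head_cat _
    b) hd0.
have [||||||c [c1 c2 c3]] := IH (b1 ++ b' :: b2) (rem t A).
- move=> d; rewrite mem_cat inE => /or3P[h|/eqP->//|h]; apply: hev;
    by rewrite mem_cat ?h // inE h !orbT.
- move: hl; rewrite !fE !(loose_cat _ _ ev1) (loose_cat _ _ evb) (loose_cat _ _ evb') =>
    /and3P[q1 q2 q3].
  rewrite hdbb q1 q3 /= andbT; exact: absorbed_loose tabs q2.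
- by rewrite fE (head_cat _ (flatten b1)) hdbb -(head_cat _ (flatten b1)) -fE.
- exact: rem_uniq.
- move=> t'; rewrite mem_rem_uniq // inE => /andP[tt' t'A].
  have [k' hk'] := hA t' t'A; exists k'; move: hk'; rewrite !mem_cat !inE.
  case/or3P=> [->//|/eqP E|->]; last by rewrite !orbT.
  exfalso; move: tt'; move: E; rewrite /b /absorber_block.
  case: (t) (t') => [v4 [v6 [[v3 v5] [v2 [v1 v7]]]]] [u4 [u6 [[u3 u5] [u2 [u1 u7]]]]] /=.
  by case=> -> -> -> -> -> -> -> _; rewrite eqxx.
- move=> p hp; have := hps p; rewrite inE hp orbT => /(_ isT) /= h.
  have := perm_to_rem tA => /permP/(_ (mem (absorber e S p.1 p.2 set0))) /= E.
  rewrite E in h; move: h; case: (_ \in _) => //= h.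
  exact: ltnW.
exists c; split=> //; apply: (perm_trans c3).
rewrite !fE; apply/permP=> p; rewrite /= !(count_cat _ (flatten _)) !(count_cat _ b')
    !(count_cat _ b).
rewrite (permP (perm_absorbed x y t k) p) -/b /=; clear; lia.
Qed.
End Paths.

(** * Loose Hamilton cycles *)

Section Conversion.
Variables (V : finType) (c : seq V) (z : V).
Notation n := (size c).
Let p (i : nat) := nth z c (i %% n).

Lemma tripleE i : 3 <= n -> triple c i = [set p i; p i.+1; p i.+2].
Proof.
move=> n3; have n0 : 0 < n by apply: leq_trans n3.
rewrite /triple; set r := i %% n.
have rn : r < n by rewrite ltn_mod.
have nthE j : j < n -> nth z (rot r c) j = p (i + j).
  move=> jn; rewrite /p -modnDml -/r /rot nth_cat size_drop.
  case: ltnP => h.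
    by rewrite nth_drop modn_small //; move: h rn; clear; lia.
  rewrite nth_take; last by move: h rn jn; clear; lia.
  have -> : r + j = (j - (n - r)) + n by move: h rn; clear; lia.
  by rewrite modnDr modn_small //; move: h rn jn; clear; lia.
have := nthE 0 n0; have := nthE 1 (ltnW n3); have := nthE 2 n3.
have := size_rot r c; case: (rot r c) => [|v0 [|v1 [|v2 s]]] /= sz; try by move: n3; rewrite
    -sz.
rewrite addn0 addn1 addn2 => -> -> ->; apply/setP=> v.
by rewrite take0 !inE orbA.
Qed.

Hypothesis uc : uniq c.
Hypothesis n6 : 6 <= n.

Lemma p_inj i j : p i = p j -> i = j %[mod n].
Proof.
have n0 : 0 < n by apply: leq_trans n6.
by move=> /eqP; rewrite nth_uniq ?ltn_mod // => /eqP.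
Qed.

Lemma p_near i r s : r < n -> s < n -> (p (i + r) == p (i + s)) = (r == s).
Proof.
move=> hr hs; apply/eqP/eqP=> [/p_inj/eqP|->//].
by rewrite eqn_modDl !modn_small // => /eqP.
Qed.

Hypothesis en : ~~ odd n.

Lemma odd_p i j : p i = p j -> odd i = odd j.
Proof.
by move=> /p_inj/(congr1 odd); rewrite !odd_mod //; apply/negbTE.
Qed.

(** Consecutive edges are recognised by testing triples for membership, so a triple starting at an
    odd position must not equal an edge as a set. If [p i] were [p j.+1], the triple at [i] would be
    the one at [j.+1], which misses [p j] since [n] is at least 6. *)
Lemma triple_parity i j : triple c i = triple c j -> odd i = odd j.
Proof.
have n3 : 3 <= n by apply: leq_trans n6.
rewrite !tripleE // => E.
have : p i \in [set p j; p j.+1; p j.+2] by rewrite -E !inE eqxx.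
rewrite !inE -orbA => /or3P[/eqP/odd_p//|/eqP h|/eqP/odd_p]; last by rewrite /= negbK.
have pS k : p (i + k) = p (j.+1 + k).
  by have /eqP := p_inj h; rewrite -(eqn_modDr k) => /eqP E'; rewrite /p E'.
have : p j \in [set p i; p i.+1; p i.+2] by rewrite E !inE eqxx.
have k1 := pS 0; have k2 := pS 1; have k3 := pS 2.
rewrite !addn0 in k1; rewrite !addn1 in k2; rewrite !addn2 in k3.
have near k : 0 < k < n -> p j == p (j + k) = false.
  by move=> /andP[k0 kn]; rewrite -{1}(addn0 j) p_near ?(ltn_eqF k0) // (leq_trans _ n6).
have := near 3; have := near 2; have := near 1; rewrite addn1 addn2 addn3 /=.
rewrite !(leq_trans _ n6) // => /(_ isT) m1 /(_ isT) m2 /(_ isT) m3.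
by rewrite !inE k1 k2 k3 m1 m2 m3.
Qed.

Variable H : hypergraph3 V.
Let e x y z := [set x; y; z] \in edges H.
Hypothesis cH : c =i vertices H.
Hypothesis hl : loose e c z.
Hypothesis hz : head z c = z.

Lemma loose_nth i : i.*2 < n -> e (nth z c i.*2) (nth z c i.*2.+1) (nth z c i.*2.+2).
Proof.
elim: i (c) hl => [|i IH] [|x [|y c']] //= /andP[h1 h2] hi.
  by rewrite nth0.
by apply: IH.
Qed.

Lemma hamilton_of_loose : exists C : hypergraph3 V, loose_Hamilton_cycle H C.
Proof.
have n0 : 0 < n by apply: leq_trans n6.
have n3 : 3 <= n by apply: leq_trans n6.
have n5 : 5 <= n by apply: leq_trans n6.
pose E := [set triple c i.*2 | i : 'I_n & i.*2 < n].
have EH : E \subset edges H.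
  apply/subsetP=> _ /imsetP[i hi ->]; rewrite inE in hi.
  rewrite tripleE // /p modn_small // (modn_small (m := i.*2.+1)); last first.
    rewrite ltn_neqAle hi andbT; apply: contra en => /eqP <-.
    by rewrite /= odd_double.
  (* Only the last edge wraps around; there [nth] returns its default [z], which is the head of
     [c]. *)
  suff -> : nth z c (i.*2.+2 %% n) = nth z c i.*2.+2 by exact: loose_nth.
  case: (ltnP i.*2.+2 n) => h; first by rewrite modn_small.
  have -> : i.*2.+2 = n.
    apply/eqP; rewrite eqn_leq h andbT; move: hi en; clear; lia.
  by rewrite modnn [RHS]nth_default // nth0.
have EP f : f \in E -> f \subset vertices H /\ #|f| = 3.
  by move=> /(subsetP EH); apply: edgesP.
have memE i : ~~ odd i -> triple c i \in E.
  move=> hi; have hm : ~~ odd (i %% n) by rewrite odd_mod //; apply/negbTE.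
  have hlt : i %% n < n by rewrite ltn_mod.
  have hh : (i %% n)./2.*2 = i %% n by rewrite -[RHS]odd_double_half (negbTE hm).
  have hlt2 : (i %% n)./2 < n.
    by apply: leq_ltn_trans hlt; rewrite -{2}hh -addnn leq_addr.
  apply/imsetP; exists (Ordinal hlt2); rewrite ?inE /= hh //.
  by rewrite /triple modn_mod.
have Eeven i : triple c i \in E -> ~~ odd i.
  by move=> /imsetP[j _ /triple_parity ->]; rewrite odd_double.
exists (Hypergraph3 EP); split=> //=; exists c; split=> //=.
- move=> f /imsetP[i hi ->]; exists i.*2 => //; by rewrite inE in hi.
- move=> v; rewrite -cH => vc; pose i := index v c.
  have iE : v = p i by rewrite /p modn_small ?index_mem // nth_index.
  have [hi|hi] := boolP (odd i).
    exists (triple c i.-1); first by apply: memE; rewrite -subn1 oddB ?hi //; case: (i) hi.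
    have ip : i.-1.+1 = i by case: (i) hi.
    by rewrite tripleE // ip -iE !inE eqxx ?orbT.
  by exists (triple c i); [apply: memE|rewrite tripleE // -iE !inE eqxx].
move=> f g [fE gE _ [i [d [hi /andP[d0 dn] Ef Eg hk]]]].
have oi : ~~ odd i by apply: Eeven; rewrite -Ef.
have od : ~~ odd d.
  by have := Eeven (i + d); rewrite -Eg oddD (negbTE oi) /=; apply.
(* A larger even [d] would jump over the edge that starts at [i + 2]. *)
have d2 : d = 2.
  case: d d0 dn od Eg hk => [|[|[|d]]] // _ _ _ _ /(_ 2 isT) /negP[].
  by apply: memE; rewrite oddD (negbTE oi).
rewrite Ef Eg d2 addn2 !tripleE // (_ : _ :&: _ = [set p i.+2]) ?cards1 //.
apply/setP=> v; rewrite !inE.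
have neq r s : r < 5 -> s < 5 -> r != s -> p (i + r) == p (i + s) = false.
  by move=> hr hs rs; rewrite p_near ?(negbTE rs) // (leq_trans _ n5).
have := neq 0 2 isT isT isT; have := neq 0 3 isT isT isT; have := neq 0 4 isT isT isT.
have := neq 1 2 isT isT isT; have := neq 1 3 isT isT isT; have := neq 1 4 isT isT isT.
rewrite addn0 addn1 addn2 addn3 addn4 => a14 a13 a12 a04 a03 a02.
case: (eqVneq v (p i)) => [->|_]; first by rewrite a02 a03 a04.
case: (eqVneq v (p i.+1)) => [->|_]; first by rewrite a12 a13 a14.
by case: (v == p i.+2).
Qed.
End Conversion.

(** * Loose paths through tiles *)

(** The path runs [a c b d a' c' b'] and so on, with edges [a c b] and [b d a']: the vertices shared
    by consecutive edges alternate between the two small parts and the inner ones come from the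
    large part. This is the origin of 1 : 1 : 2; only the very last [d] is left over. *)
Lemma zigzag (V : finType) (e : V -> V -> V -> bool) t (al bl cl : seq V) :
  sym3 e -> size al = t.+1 -> size bl = t.+1 -> size cl = (2 * t.+1) ->
  (forall a b c, a \in al -> b \in bl -> c \in cl -> e a b c) ->
  exists s l d, [/\ loose e s l, perm_eq (s ++ [:: l; d]) (al ++ bl ++ cl) & head l s \in al].
Proof.
move=> [s1 s2]; elim: t al bl cl => [|t IH] [|a al] [|b bl] [|c [|d cl]] //.
  case: al bl cl => [|? ?] [|? ?] [|? ?] // _ _ _ h.
  exists [:: a; c], b, d; rewrite /= s2 h ?inE ?eqxx //; split=> //.
  by apply/permP=> q /=; clear; lia.
move=> /= [ha] [hb] hc h.
have h' x y w : x \in al -> y \in bl -> w \in cl -> e x y w.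
  by move=> hx hy hw; apply: h; rewrite !inE ?hx ?hy ?hw ?orbT.
have hc' : size cl = 2 * t.+1 by move: hc; clear; lia.
have [s [l [d' [q1 q2 q3]]]] := IH al bl cl ha hb hc' h'.
exists [:: a, c, b, d & s], l, d'; split=> /=.
- have -> : e a c b by rewrite s2; apply: h; rewrite !inE eqxx.
  by rewrite q1 s2 s1 h // !inE ?q3 ?eqxx ?orbT.
- apply/permP=> q; have := permP q2 q; rewrite /= !count_cat /= !count_cat /=; clear; lia.
- by rewrite inE eqxx.
Qed.

Lemma uniq_flatten_map (V : finType) (T : eqType) (F : T -> seq V) s :
  {in s, forall t, uniq (F t)} ->
  pairwise (fun t t' => [disjoint [set:: F t] & [set:: F t']]) s ->
  uniq (flatten (map F s)).
Proof.
elim: s => //= t s IH hu /andP[/allP h1 h2].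
rewrite cat_uniq hu ?mem_head //= IH // => [|t' ht']; last by apply: hu; rewrite inE ht' orbT.
rewrite andbT; apply/hasPn=> v /flatten_mapP[t' ht' hv]; apply/negP=> hv'.
have := h1 t' ht'; rewrite -setI_eq0 => /eqP/setP/(_ v).
by rewrite !inE hv hv'.
Qed.

Lemma even_pairs (V : eqType) (s : seq V) : ~~ odd (size s) ->
  exists2 ps, flatten [seq [:: p.1; p.2] | p <- ps] = s & size s = 2 * size ps.
Proof.
have [m] := ubnP (size s); elim: m s => // m IH [|x [|y s]] //= hm; first by exists [::].
rewrite negbK => h; have [|ps h1 h2] := IH s _ h; first exact: ltnW.
by exists ((x, y) :: ps); rewrite /= ?h1 // h2 mulnS.
Qed.

Lemma perm_link_blocks (V : finType) (segs : seq (seq V * V)) ks :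
  size ks = size segs ->
  perm_eq (flatten [seq link_block t.1 t.2 | t <- zip segs ks])
    (flatten [seq rcons s.1 s.2 | s <- segs] ++ flatten (map (@triple_seq V) ks)).
Proof.
elim: segs ks => [|s segs IH] [|k ks] // [/IH h].
apply/permP=> q; have := permP h q.
rewrite /= -cats1 !count_cat /= ?count_cat /=.
by clear; lia.
Qed.

Section Tiles.
Variables (V : finType) (e : V -> V -> V -> bool).
Hypothesis es : sym3 e.

Lemma tile_segment t Q : tile e t.+1 Q -> exists s : seq V * V,
  [/\ loose e s.1 s.2, uniq (rcons s.1 s.2),
    {subset rcons s.1 s.2 <= \bigcup_p Q p} & size (rcons s.1 s.2) + 1 = 4 * t.+1].
Proof.
move=> [h1 h2 h3]; pose i2 : 'I_4 := inord 2; pose i3 : 'I_4 := inord 3.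
have d (i j : 'I_4) v : i != j -> v \in Q i -> v \in Q j -> False.
  by move=> /h2 dij vi; rewrite (disjointFr dij vi).
have n01 : (0 != 1 :> 'I_4)%R by [].
have n02 : (0 != i2)%R by rewrite -val_eqE /= inordK.
have n03 : (0 != i3)%R by rewrite -val_eqE /= inordK.
have n12 : (1 != i2)%R by rewrite -val_eqE /= inordK.
have n13 : (1 != i3)%R by rewrite -val_eqE /= inordK.
have n23 : (i2 != i3) by rewrite -val_eqE /= !inordK.
pose cl := enum (Q i2) ++ enum (Q i3).
have [||||s [l [x [q1 q2 _]]]] := @zigzag V e t (enum (Q 0%R)) (enum (Q 1%R)) cl es.
- by rewrite -cardE h1.
- by rewrite -cardE h1.
- by rewrite size_cat -!cardE !h1 mul2n addnn.
- move=> a b c; rewrite /cl mem_cat !mem_enum => ha hb /orP[] hc;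
    by apply: (h3 a b c _ ha hb _ hc); rewrite inordK.
have us : uniq (s ++ [:: l; x]).
  rewrite (perm_uniq q2) !cat_uniq !enum_uniq /= andbT.
  apply/and3P; split.
  - apply/hasPn=> v; rewrite !mem_cat !mem_enum => hv; apply/negP=> h0.
    by case/or3P: hv => hv; [apply: d n01 h0 hv|apply: d n02 h0 hv|apply: d n03 h0 hv].
  - apply/hasPn=> v; rewrite !mem_cat !mem_enum => hv; apply/negP=> h0.
    by case/orP: hv => hv; [apply: d n12 h0 hv|apply: d n13 h0 hv].
  - apply/hasPn=> v; rewrite !mem_enum => hv; apply/negP=> h0; exact: d n23 h0 hv.
exists (s, l); split=> //=.
- by move: us; rewrite -cat_rcons cat_uniq => /and3P[].
- move=> v hv; have : v \in s ++ [:: l; x] by rewrite -cat_rcons mem_cat hv.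
  rewrite (perm_mem q2) !mem_cat !mem_enum => /or4P[] hv'; apply/bigcupP;
    [by exists 0%R|by exists 1%R|by exists i2|by exists i3].
- have := perm_size q2; rewrite !size_cat -!cardE !h1 size_rcons /= => E.
  by move: E; clear; lia.
Qed.

Lemma tiles_segments t k X : packs e t.+1 k X -> exists segs : seq (seq V * V),
  [/\ size segs = k, {in segs, forall s, loose e s.1 s.2},
    uniq (flatten [seq rcons s.1 s.2 | s <- segs]),
    {subset flatten [seq rcons s.1 s.2 | s <- segs] <= X} &
    size (flatten [seq rcons s.1 s.2 | s <- segs]) + k = 4 * (k * t.+1)].
Proof.
case=> f [f1 f2 f3].
have /fin_all_exists[g hg] : forall i, exists s : seq V * V,
  [/\ loose e s.1 s.2, uniq (rcons s.1 s.2),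
    {subset rcons s.1 s.2 <= \bigcup_p f i p} & size (rcons s.1 s.2) + 1 = 4 * t.+1].
  by move=> i; apply: tile_segment.
exists (map g (enum 'I_k)); split.
- by rewrite size_map -cardE card_ord.
- by move=> _ /mapP[i _ ->]; have [] := hg i.
- rewrite -map_comp; apply: uniq_flatten_map => [i _|]; first by have [] := hg i.
  have := enum_uniq 'I_k; elim: (enum _) => //= i s IH /andP[/negP his us].
  rewrite IH // andbT; apply/allP=> j js /=.
  have ij : i != j by apply: contraPneq his => ->.
  rewrite -setI_eq0; apply/eqP/setP=> v; rewrite !inE; apply/negP=> /andP[vi vj].
  have [_ _ hi _] := hg i; have [_ _ hj _] := hg j.
  have /bigcupP[p _ vp] := hi v vi; have /bigcupP[q _ vq] := hj v vj.
  by have := f2 i j p q ij => /disjointFr/(_ vp); rewrite vq.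
- move=> v /flatten_mapP[s /mapP[i _ ->] hv].
  have [_ _ hi _] := hg i; have /bigcupP[p _ vp] := hi v hv.
  exact: (subsetP (f3 i p)).
- have gen (l : seq 'I_k) : size (flatten [seq rcons s.1 s.2 | s <- map g l]) + size l = 4 *
    (size l * t.+1).
    elim: l => //= i l; rewrite size_cat; have [_ _ _] := hg i.
    by clear; nia.
  by have := gen (enum 'I_k); rewrite size_enum_ord.
Qed.
End Tiles.

(** * Degree conditions: deletion of vertices, passage from the hypergraph *)

Lemma mindeg_sub (R : realType) (V : finType) (e : V -> V -> V -> bool) (S W : {set V}) (D
    rho : R) :
  mindeg e S D -> (#|W|%:R <= rho * #|S|%:R)%R -> (0 <= D - 2 * rho)%R ->
  mindeg e (S :\: W) (D - 2 * rho)%R.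
Proof.
move=> hd hW D0 x /setDP[xS _].
have n0 : (0 <= #|S|%:R :> R)%R by [].
have h1 : #|link e S x| <= #|link e (S :\: W) x| + (#|W| * #|S| + #|S| * #|W|).
  rewrite -!cardsX; apply: leq_trans (_ : #|link e (S :\: W) x :|: (setX W S :|: setX S W)|
      <= _).
    apply: subset_leq_card; apply/subsetP=> -[a b]; rewrite !inE /= => /and3P[-> -> ->].
    by case: (a \in W); case: (b \in W).
  by apply: leq_trans (leq_card_setU _ _) _; rewrite leq_add2l leq_card_setU.
have {}h1 : (#|link e S x|%:R <= #|link e (S :\: W) x|%:R + 2 * (#|W|%:R * #|S|%:R) :> R)%R.
  rewrite -!natrM -natrD ler_nat; apply: (leq_trans h1); clear; nia.
have h2 : (#|W|%:R * #|S|%:R <= rho * #|S|%:R * #|S|%:R)%R by rewrite ler_wpM2r.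
have h3 : ((D - 2 * rho) * #|S :\: W|%:R ^+ 2 <= (D - 2 * rho) * #|S|%:R ^+ 2)%R.
  by apply: ler_wpM2l => //; apply: lerXn2r; rewrite ?nnegrE // ler_nat subset_leq_card //
      subsetDl.
apply: (le_trans h3); have := hd x xS; move: h1 h2; clear; rewrite expr2; lra.
Qed.

Section FromHypergraph.
Variables (V : finType) (H : hypergraph3 V).
Definition adj (x y z : V) := [set x; y; z] \in edges H.

Lemma adj_sym : sym3 adj.
Proof.
split=> x y z; rewrite /adj.
  have -> : [set x; y; z] = [set y; x; z]; last by [].
  by apply/setP=> v; rewrite !inE (orbC (v == x)).
have -> : [set x; y; z] = [set x; z; y]; last by [].
by apply/setP=> v; rewrite !inE -!orbA (orbC (v == y)).
Qed.

Lemma min_degree_le v : v \in vertices H -> min_degree H <= degree H v.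
Proof.
move=> hv; rewrite /min_degree.
have : v \in index_enum V by rewrite mem_index_enum.
elim: (index_enum V) => // x s IH; rewrite inE big_cons => /orP[/eqP <-|/IH h].
  by rewrite hv geq_minl.
case: ifP => // _; apply: leq_trans h; exact: geq_minr.
Qed.

(** The fibre of [phi] over an edge [{v, a, b}] contains both [(a, b)] and [(b, a)]. *)
Lemma link_degree v : 2 * degree H v <= #|link adj (vertices H) v|.
Proof.
pose L := link adj (vertices H) v.
pose phi (p : V * V) := [set v; p.1; p.2].
rewrite /degree mulnC -sum_nat_const.
rewrite -[leqRHS]sum1_card (bigID (fun p => phi p \in [set f in edges H | v \in f])) /=.
apply: leq_trans (leq_addr _ _).
rewrite (partition_big phi (fun f => f \in [set f in edges H | v \in f])) /=; last first.
  by move=> p /andP[].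
apply: leq_sum => f; rewrite inE => /andP[fE vf].
have [fV f3] := edgesP fE.
have : #|f :\ v| = 2 by have := cardsD1 v f; rewrite vf f3 add1n => -[].
move=> /eqP/cards2P[a [b [ab fab]]].
have af : a \in f :\ v by rewrite fab !inE eqxx.
have bf : b \in f :\ v by rewrite fab !inE eqxx orbT.
have fE' : f = [set v; a; b].
  by rewrite -(setD1K vf) fab; apply/setP=> x; rewrite !inE orbA.
have fE2 : f = [set v; b; a] by rewrite fE'; apply/setP=> x; rewrite !inE -!orbA (orbC (x ==
    a)).
have aV : a \in vertices H by apply: (subsetP fV); move: af; rewrite inE => /andP[].
have bV : b \in vertices H by apply: (subsetP fV); move: bf; rewrite inE => /andP[].
have : #|[set (a, b); (b, a)]| = 2 by rewrite cards2 xpair_eqE negb_and ab.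
move=> <-; rewrite -sum1_card big_mkcond [leqRHS]big_mkcond /=.
apply: leq_sum => p _; case hp : (p \in [set (a, b); (b, a)]) => //.
rewrite -andbA; suff -> : [&& p \in L, phi p \in [set f in edges H | v \in f] & phi p == f]
    by [].
move: hp; rewrite !inE => /orP[]/eqP-> /=; rewrite /phi /adj /= -?fE' -?fE2.
  by rewrite aV bV fE ?vf !eqxx.
by rewrite aV bV fE ?vf !eqxx.
Qed.

(** The lost [gamma / 2] pays for the difference between [2 * 'C(n, 2)] and [n ^ 2]. *)
Lemma mindeg_adj (R : realType) (gamma : R) : (0 < gamma)%R ->
  (2 * (7 / 16 + gamma) <= gamma * #|vertices H|%:R)%R ->
  ((7 / 16 + gamma) * 'C(#|vertices H|, 2)%:R < (min_degree H)%:R)%R ->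
  mindeg adj (vertices H) (7 / 16 + gamma / 2)%R.
Proof.
move=> g0 hn hd v vS.
have h1 : (2 * (min_degree H)%:R <= #|link adj (vertices H) v|%:R :> R)%R.
  rewrite -natrM ler_nat; apply: leq_trans (link_degree v).
  by rewrite leq_mul2l min_degree_le.
apply: le_trans h1; move: hn hd; move: #|vertices H| (min_degree H) => n d hn hd.
have hb : (2 * 'C(n, 2)%:R = n%:R * n%:R - n%:R :> R)%R.
  rewrite -natrM bin2 mul2n.
  have -> : (n * n.-1)./2.*2 = n * n.-1.
    rewrite -[RHS]odd_double_half oddM; case: n {hn hd} => //= n.
    by case: (odd n).
  by case: n {hn hd} => [|n] /=; rewrite ?mul0r ?subr0 // natrM -(natr1 n); ring.
have n0 : (0 <= n%:R :> R)%R by [].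
have hb2 : ((7 / 16 + gamma) * (2 * 'C(n, 2)%:R) <= 2 * d%:R :> R)%R.
  by rewrite mulrCA ler_pM2l // ltW.
apply: le_trans hb2; rewrite hb.
have : (2 * (7 / 16 + gamma) * n%:R <= gamma * n%:R * n%:R)%R by rewrite ler_wpM2r.
rewrite expr2; clear; lra.
Qed.
End FromHypergraph.

Local Open Scope ring_scope.

(** * Assembling the cycle *)

Definition septuple_segment (V : finType) (t : septuple V) : seq V * V :=
  let: (v4, (v6, ((v3, v5), (v2, (v1, v7))))) := t in ([:: v1; v2; v3; v4; v5; v6], v7).

Lemma rcons_septuple (V : finType) (t : septuple V) :
  rcons (septuple_segment t).1 (septuple_segment t).2 = septuple_seq t.
Proof. by case: t => [v4 [v6 [[v3 v5] [v2 [v1 v7]]]]]. Qed.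

Lemma link_block_septuple (V : finType) (t : septuple V) k :
  link_block (septuple_segment t) k = absorber_block t k.
Proof. by case: t => [v4 [v6 [[v3 v5] [v2 [v1 v7]]]]]. Qed.

Lemma absorber_segment (V : finType) (e : V -> V -> V -> bool) S x y (t : septuple V) :
  t \in absorber e S x y set0 ->
  [/\ loose e (septuple_segment t).1 (septuple_segment t).2, uniq (septuple_seq t) &
     {subset septuple_seq t <= S}].
Proof.
case: t => [v4 [v6 [[v3 v5] [v2 [v1 v7]]]]]; rewrite inE.
case/andP=> /andP[u /allP h] /andP[/and3P[h1 h2 h3] _].
have hp : perm_eq [:: v7; v1; v2; v5; v3; v6; v4] (septuple_seq (v4, (v6, ((v3, v5), (v2,
    (v1, v7)))))).
  apply/permP=> p /=.
  move: (nat_of_bool (p v7)) (nat_of_bool (p v1)) (nat_of_bool (p v2)) => a1 a2 a3.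
  move: (nat_of_bool (p v5)) (nat_of_bool (p v3)) (nat_of_bool (p v6)) => a4 a5 a6.
  by move: (nat_of_bool (p v4)) => a7; clear; lia.
split; first by rewrite /= h1 h2 h3.
  by rewrite -(perm_uniq hp).
by move=> v; rewrite -(perm_mem hp) => /h/andP[].
Qed.

Lemma disjoint_seq_uniq (V : finType) (s1 s2 : seq V) : uniq s1 -> uniq s2 ->
  (forall v, v \in s1 -> v \in s2 -> False) -> uniq (s1 ++ s2).
Proof.
move=> u1 u2 h; rewrite cat_uniq u1 u2 andbT; apply/hasPn=> v v2; apply/negP=> v1.
exact: h v1 v2.
Qed.

Theorem theorem1p3 (R : realType) (gamma : R) (gamma_gt0 : 0 < gamma) :
  exists n0 : nat, forall (n : nat) (V : finType) (H : hypergraph3 V),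
    #|vertices H| = n -> (n0 < n)%N -> ~~ odd n ->
    (7%:R / 16%:R + gamma) * 'C(n, 2)%:R < (min_degree H)%:R ->
    exists C : hypergraph3 V, loose_Hamilton_cycle H C.
Proof.
pose kap : R := 1 / 2000.
have kap0 : 0 < kap by rewrite divr_gt0.
have kap16 : kap / 16 <= kap / 4 by rewrite ler_pM2l // lef_pV2 ?posrE // ler_nat.
(* Absorbers, reservoir and absorber connectors take at most [epsA * #|S|] vertices each. Three
   times [kap / 16] fits the budget [kap / 2] of [connecting_all]; deleting all three costs degree
   [6 * epsA], less than [gamma / 4]. *)
pose epsA := Num.min (kap / 16) (gamma / 64).
have epsA0 : 0 < epsA by rewrite lt_min !divr_gt0.
have epsA1 : epsA <= kap / 16 by rewrite ge_min lexx.
have epsA2 : epsA <= gamma / 64 by rewrite ge_min lexx orbT.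
have epsA4 : epsA <= 1 / 2000 / 4.
  exact: le_trans epsA1 kap16.
have [betaA [nA [betaA0 hA]]] := absorber_family epsA0 epsA4.
pose epsP := Num.min epsA (betaA / 8).
have epsP0 : 0 < epsP by rewrite lt_min epsA0 divr_gt0.
have epsP1 : epsP <= epsA by rewrite ge_min lexx.
have epsP2 : epsP <= betaA / 8 by rewrite ge_min lexx orbT.
have [betaP [nP [betaP0 hP]]] := @reservoir R epsP epsP0.
have [nC nC0 hC] := connecting_all R.
(* Large tiles mean few tile paths: few enough to be linked within the budget [betaP], and for the
   one vertex missed in each tile to be absorbed within [betaA]. *)
have [t1 ht1] := @eventually_ge R 2 betaP betaP0.
have [t2 ht2] := @eventually_ge R 2 betaA betaA0.
pose t := (t1 + t2)%N.
have tP : 2 <= betaP * t.+1%:R by apply: ht1; rewrite leqW // leq_addr.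
have tA : 2 <= betaA * t.+1%:R by apply: ht2; rewrite leqW // leq_addl.
have gamma4 : 0 < gamma / 4 by rewrite divr_gt0.
have betaA8 : 0 < betaA / 8 by rewrite divr_gt0.
have [nT hT] := almost_tiling gamma4 betaA8 (ltn0Sn t).
have [n1 hn1] := @eventually_ge R (2 * (7 / 16 + gamma)) gamma gamma_gt0.
have [n2 hn2] := @eventually_ge R 6 betaP betaP0.
exists (nA + nP + nC + 2 * nT + n1 + n2 + 6)%N => n V H hn hlt en hdeg.
set S := vertices H in hn *.
have hnA : (nA <= #|S|)%N by move: hn hlt; clear; lia.
have hnP : (nP <= #|S|)%N by move: hn hlt; clear; lia.
have hnC : (nC <= #|S|)%N by move: hn hlt; clear; lia.
have hnT : (2 * nT <= #|S|)%N by move: hn hlt; clear; lia.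
have hn1' : (n1 <= #|S|)%N by move: hn hlt; clear; lia.
have hn2' : (n2 <= #|S|)%N by move: hn hlt; clear; lia.
have hn6 : (6 <= #|S|)%N by move: hn hlt; clear; lia.
have N0 : 0 < #|S|%:R :> R by rewrite ltr0n; apply: leq_trans hn6.
have hd : mindeg (adj H) S (7 / 16 + gamma / 2).
  by apply: mindeg_adj => //; [exact: hn1|rewrite -/S hn].
have hd0 : mindeg (adj H) S (7 / 16 : R).
  move=> x xS; apply: le_trans (hd x xS); rewrite ler_wpM2r ?exprn_ge0 //.
  by rewrite lerDl divr_ge0 // ltW.
have es := adj_sym H; set e := adj H in es hd hd0 *.
have [A [cA pA aA bA]] := hA V e S es hnA hd0.
have uA : uniq (flatten (map (@septuple_seq V) A)).
  apply: uniq_flatten_map => // x xA; have [y [y' hy]] := aA x xA.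
  by have [] := absorber_segment hy.
have sA x : x \in A -> {subset septuple_seq x <= S}.
  by move=> xA; have [y [y' hy]] := aA x xA; have [] := absorber_segment hy.
pose VA := [set:: flatten (map (@septuple_seq V) A)].
have cVA : #|VA|%:R <= epsA * #|S|%:R.
  apply: le_trans cA; rewrite ler_nat cardsE; apply: leq_trans (card_size _) _.
  rewrite eq_leq //; elim: (A) => //= x l; rewrite size_cat => ->.
  by case: x => [v4 [v6 [[v3 v5] [v2 [v1 v7]]]]]; rewrite mulnS.
have [|P [PS PVA cP conP]] := hP V e S VA es hnP hd0.
  by apply: (le_trans cVA); rewrite ler_pM2r // (le_trans epsA1).
have conS := hC V e S es hnC hd0.
(* Every pair has a positive number of absorbers in the family, so an absorber [a0] exists; it will
   open the second half of the cycle. *)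
case: A => [|a0 A] in cA pA aA bA uA sA VA cVA PVA *.
  have [x xS] : exists x, x \in S by apply/card_gt0P; apply: leq_trans hn6.
  have := bA x x xS xS; rewrite /= leNgt mulr_gt0 //.
pose seg := @septuple_segment V.
pose z1 := head (seg a0).2 (seg a0).1.
have z1S : z1 \in S.
  apply: (sA a0 (mem_head _ _)); rewrite /z1 /seg.
  by case: (a0) => [v4 [v6 [[v3 v5] [v2 [v1 v7]]]]]; rewrite /= mem_head.
have segP x : x \in a0 :: A -> [/\ loose e (seg x).1 (seg x).2, (seg x).2 \in S & {subset
    (seg x).1 <= S}].
  move=> xA; have [y [y' hy]] := aA x xA; have [h1 _ h3] := absorber_segment hy.
  rewrite -rcons_septuple -/(seg x) in h3; split=> //; first by apply: h3; rewrite mem_rcons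
      mem_head.
  by move=> v hv; apply: h3; rewrite mem_rcons inE hv orbT.
have sizeA : (3 * size (map seg A))%:R <= epsA * #|S|%:R.
  by apply: le_trans cA; rewrite ler_nat size_map /=; clear; lia.
have cP' : #|P|%:R <= epsA * #|S|%:R by apply: (le_trans cP); rewrite ler_pM2r.
(* First half: the absorbers other than [a0], linked through [S] and ending at [z1], the head of
   [a0]. Avoiding [VA :|: P] keeps the reservoir intact. *)
have [|s|ks1 [k1 k2 k3 k4]] := @join_segments V e R S S _ (map seg A) z1 (VA :|: P) conS _ z1S.
- rewrite natrD; apply: (@le_trans _ _ (#|VA|%:R + #|P|%:R + epsA * #|S|%:R)).
    by apply: lerD => //; rewrite -natrD ler_nat leq_card_setU.
  have : epsA * #|S|%:R <= kap / 16 * #|S|%:R by rewrite ler_pM2r.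
  move: cVA cP' N0; rewrite /kap; clear; lra.
- by move=> /mapP[x xA ->]; apply: segP; rewrite inE xA orbT.
set F1 := flatten [seq link_block _ _ | _ <- _] in k2.
set K1 := flatten _ in k3 k4.
pose W := VA :|: P :|: [set:: K1].
have cW : #|W|%:R <= 3 * epsA * #|S|%:R.
  have h1 : (#|W| <= #|VA| + #|P| + 3 * size (map seg A))%N.
    apply: leq_trans (leq_card_setU _ _) _; apply: leq_add; first exact: leq_card_setU.
    rewrite cardsE; apply: leq_trans (card_size _) _; rewrite -k1 /K1.
    by elim: (ks1) => //= a l; rewrite mulnS => h; rewrite !ltnS.
  have : #|W|%:R <= #|VA|%:R + #|P|%:R + (3 * size (map seg A))%:R :> R by rewrite -!natrD
      ler_nat.
  move: cVA cP' sizeA; clear; lra.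
pose S' := S :\: W.
have hd' : mindeg e S' (7 / 16 + gamma / 4).
  have D0 : 0 <= 7 / 16 + gamma / 2 - 2 * (3 * epsA).
    by move: epsA2 gamma_gt0; clear; lra.
  move=> x xS; apply: le_trans (mindeg_sub hd cW D0 xS).
  rewrite ler_wpM2r ?exprn_ge0 //; move: epsA2 gamma_gt0; clear; lra.
have cS' : (nT <= #|S'|)%N.
  rewrite -(ler_nat R); have := card_setD_ge R S W; rewrite -/S'.
  have : (2 * nT)%:R <= #|S|%:R :> R by rewrite ler_nat.
  have : epsA * #|S|%:R <= kap / 16 * #|S|%:R by rewrite ler_pM2r.
  rewrite natrM; move: cW N0; rewrite /kap; clear; lra.
have [kk pk hk] := hT V e S' es cS' hd'.
have [segs [g1 g2 g3 g4 g5]] := tiles_segments es pk.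
set F3 := flatten _ in g3 g4 g5.
have sF3 : (size F3 <= #|S'|)%N.
  by rewrite -(card_uniqP g3); apply: subset_leq_card; apply/subsetP=> v /g4.
have S'S : (#|S'| <= #|S|)%N by rewrite subset_leq_card // subsetDl.
(* A tile path misses one of [4 * t.+1] vertices, so it has at least [3 * t.+1]. *)
have kS : 3 * (kk%:R * t.+1%:R) <= #|S|%:R :> R.
  rewrite -!natrM ler_nat; move: g5 sF3 S'S; clear; nia.
have kP : 6 * kk%:R <= betaP * #|S|%:R.
  have : 2 * kk%:R <= betaP * t.+1%:R * kk%:R by rewrite ler_wpM2r.
  have : betaP * (3 * (kk%:R * t.+1%:R)) <= betaP * #|S|%:R by rewrite ler_pM2l.
  clear; lra.
have kA : 6 * kk%:R <= betaA * #|S|%:R.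
  have : 2 * kk%:R <= betaA * t.+1%:R * kk%:R by rewrite ler_wpM2r.
  have : betaA * (3 * (kk%:R * t.+1%:R)) <= betaA * #|S|%:R by rewrite ler_pM2l.
  clear; lra.
(* The second half must end where the first begins; this is [z1] if [a0] is the only absorber. *)
pose z2 := head z1 F1.
have z2S : z2 \in S.
  rewrite /z2 /F1; case: (A) (ks1) k1 segP => [|a1 A1] [|kx ks] //= _ hseg.
  have [|_ h2 h3] := hseg a1; first by rewrite !inE eqxx orbT.
  rewrite /link_block -catA; case: (seg a1).1 h3 => [|v l] h3 //=.
  by apply: h3; rewrite mem_head.
(* Second half: [a0] and the tile paths, linked through [P]. Nothing need be forbidden, as [P] is
   disjoint from the absorbers, their connectors and the tiles. *)
have [|s|ks2 [l1 l2 l3 l4]] := @join_segments V e R S P _ (seg a0 :: segs) z2 set0 conP _ z2S.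
- rewrite cards0 /= g1; have := hn2 _ hn2'; move: kP; clear.
  by rewrite add0n mulnS natrD natrM; lra.
- rewrite inE => /orP[/eqP->|hs]; first by apply: segP; rewrite mem_head.
  have hsub v : v \in rcons s.1 s.2 -> v \in S.
    move=> hv; have /g4/setDP[] // : v \in F3 by apply/flatten_mapP; exists s.
  split; [exact: g2|by apply: hsub; rewrite mem_rcons mem_head|].
  by move=> v hv; apply: hsub; rewrite mem_rcons inE hv orbT.
set B1 := [seq link_block _ _ | _ <- zip (map seg A) ks1] in F1 z2 k2 z2S l2 *.
set B2 := [seq link_block _ _ | _ <- zip _ ks2] in l2.
set K2 := flatten _ in l3 l4.
have pB1 := perm_link_blocks k1; have pB2 := perm_link_blocks l1.
rewrite -/B1 -/F1 in pB1; rewrite -/B2 in pB2.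
have segE l : flatten [seq rcons s.1 s.2 | s <- map seg l] = flatten (map (@septuple_seq V) l).
  by congr flatten; rewrite -map_comp; apply: eq_map => x; apply: rcons_septuple.
rewrite segE in pB1.
have headB2 : head z2 (flatten B2) = z1.
  rewrite /B2; case: (ks2) l1 => // kx ks _ /=; rewrite /z1 /seg.
  by case: (a0) => [v4 [v6 [[v3 v5] [v2 [v1 v7]]]]].
pose c0 := flatten (B1 ++ B2).
have c0E : c0 = F1 ++ flatten B2 by rewrite /c0 flatten_cat.
have loose_c0 : loose e c0 z2.
  by rewrite c0E loose_cat ?(loose_even k2) // headB2 k2.
have head_c0 : head z2 c0 = z2 by rewrite c0E head_cat headB2.
pose X := flatten (map (@septuple_seq V) (a0 :: A)).
have pB2' : perm_eq (flatten B2) (septuple_seq a0 ++ (F3 ++ K2)).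
  apply: (perm_trans pB2); rewrite -[flatten [seq _ | _ <- _ :: _]]/(rcons (seg a0).1 (seg
      a0).2 ++ F3).
  by rewrite rcons_septuple -catA.
have perm_c0 : perm_eq c0 (X ++ (K1 ++ (F3 ++ K2))).
  have XE : X = septuple_seq a0 ++ flatten (map (@septuple_seq V) A) by [].
  rewrite c0E XE; apply/permP=> q; rewrite (count_cat q F1) (permP pB1) (permP pB2').
  rewrite !count_cat -/K1 -/K2 -/F3; clearbody K1 K2 F3; clear; lia.
have W0 v : v \in X -> v \in VA by rewrite inE.
have XP v : v \in X -> v \in P -> False.
  by move=> /W0 hv hvP; have := disjointFr PVA hvP; rewrite hv.
have uc0 : uniq c0.
  rewrite (perm_uniq perm_c0); apply: disjoint_seq_uniq => //.
    apply: disjoint_seq_uniq => //.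
      apply: disjoint_seq_uniq => // v /g4/setDP[_ h1] /l4/andP[h2 _].
      by move: h1; rewrite /W !in_setU h2 orbT.
    move=> v v1; rewrite mem_cat => /orP[/g4/setDP[_]|/l4/andP[h2 _]].
      by rewrite /W !in_setU !negb_or inE v1 !andbF.
    by have /andP[_] := k4 v v1; rewrite in_setU h2 orbT.
  move=> v v1; rewrite !mem_cat => /or3P[/k4/andP[_]|/g4/setDP[_]|/l4/andP[h _]].
  - by rewrite in_setU W0.
  - by rewrite /W !in_setU W0.
  - exact: XP v1 h.
have sc0 : {subset c0 <= S}.
  move=> v; rewrite (perm_mem perm_c0) (mem_cat v X) (mem_cat v K1) (mem_cat v F3) =>
      /or4P[|/k4/andP[]//|/g4/setDP[]//|/l4/andP[/(subsetP PS)]//].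
  move=> hv; have /flatten_mapP[x xA hx] : v \in flatten (map (@septuple_seq V) (a0 :: A)) :=
      hv.
  exact: sA xA _ hx.
pose L := S :\: [set:: c0].
have sizec0 : #|[set:: c0]| = size c0 by rewrite cardsE; apply/card_uniqP.
have cL : (#|L| + size c0 = #|S|)%N.
  rewrite -sizec0 -(cardsID [set:: c0] S) addnC; congr (_ + _)%N.
  by rewrite (setIidPr _) //; apply/subsetP=> v; rewrite inE => /sc0.
have evB : {in B1 ++ B2, forall b : seq V, ~~ odd (size b)}.
  have ev ss ks : {in ss, forall s : seq V * V, loose e s.1 s.2} -> size ks = size ss ->
      {in [seq link_block s.1 s.2 | s <- zip ss ks], forall b : seq V, ~~ odd (size b)}.
    elim: ss ks => [|s ss IH] [|kx ks] //= hs [hsz] b; rewrite inE => /orP[/eqP->|].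
      rewrite /link_block size_cat oddD (negbTE (@loose_even V e s.1 s.2 _)) //.
      by apply: hs; rewrite mem_head.
    by apply: IH => // s' hs'; apply: hs; rewrite inE hs' orbT.
  move=> b; rewrite mem_cat => /orP[]; apply: ev => //.
    by move=> s /mapP[x xA ->]; have [|] := segP x; first by rewrite inE xA orbT.
  move=> s; rewrite inE => /orP[/eqP->|/g2//].
  by have [] := segP a0 (mem_head _ _).
have blockA : {in a0 :: A, forall x, exists kx, absorber_block x kx \in B1 ++ B2}.
  move=> x; rewrite inE => /orP[/eqP->|xA].
    rewrite /B2; case: (ks2) l1 => // kx ks _ /=; exists kx.
    by rewrite mem_cat inE -link_block_septuple eqxx orbT.
  suff [kx hx] : exists kx, absorber_block x kx \in B1 by exists kx; rewrite mem_cat hx.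
  rewrite /B1; move: xA k1; elim: (A) (ks1) => //= a1 A1 IH [|kx ks] //= hx [hs].
  move: hx; rewrite inE => /orP[/eqP->|/IH/(_ hs)[kx' hkx']].
    by exists kx; rewrite inE -link_block_septuple eqxx.
  by exists kx'; rewrite inE hkx' orbT.
have uAA : uniq (a0 :: A).
  apply: pairwise_uniq pA => x; apply/negbTE; rewrite -setI_eq0 setIid.
  by apply/set0Pn; case: x => [v4 [v6 [[v3 v5] [v2 [v1 v7]]]]]; exists v4; rewrite !inE eqxx
      !orbT.
have [|ps hps sps] := @even_pairs V (enum L).
  have := loose_even loose_c0; have := en; rewrite -cardE -hn -cL oddD.
  by case: (odd #|L|); case: (odd (size c0)).
(* The vertices left over come from [P], from the untiled part of [S'], and one from each tile: at
   most 1/8 + 1/8 + 1/6 of [betaA * #|S|]. *)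
have bL : #|L|%:R <= betaA * #|S|%:R.
  have h1 : (#|S| <= #|P| + size X + size K1 + #|S'|)%N.
    apply: leq_trans (_ : #|P :|: [set:: X] :|: [set:: K1] :|: S'| <= _)%N.
      apply: subset_leq_card; apply/subsetP=> v vS; rewrite in_setU.
      case vS' : (v \in S'); rewrite ?orbT // orbF.
      move: vS'; rewrite /S' in_setD vS andbT => /negbFE; rewrite /W !in_setU.
      by case/orP=> [/orP[|]|] ->; rewrite ?orbT.
    apply: leq_trans (leq_card_setU _ _) _; rewrite leq_add2r.
    apply: leq_trans (leq_card_setU _ _) _; apply: leq_add; last by rewrite cardsE; exact:
        card_size.
    apply: leq_trans (leq_card_setU _ _) _; apply: leq_add => //; by rewrite cardsE; exact:
        card_size.
  have h2 : (#|L| + size F3 <= #|P| + #|S'|)%N.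
    move: h1; rewrite -cL (perm_size perm_c0) (size_cat X) (size_cat K1) (size_cat F3).
    move: (size X) (size K1) (size F3) (size K2) #|L| #|P| #|S'|; clear; lia.
  have h3 : #|L|%:R + (4 * (kk * t.+1))%:R <= #|P|%:R + #|S'|%:R + kk%:R :> R.
    by rewrite -g5 -!natrD ler_nat addnA leq_add2r.
  have h4 : #|P|%:R <= betaA / 8 * #|S|%:R by apply: (le_trans cP); rewrite ler_pM2r.
  have h5 : betaA / 8 * #|S'|%:R <= betaA / 8 * #|S|%:R by rewrite ler_pM2l // ler_nat.
  have h6 : 0 <= betaA * #|S|%:R by rewrite mulr_ge0 // ltW.
  move: h3 h4 h5 h6 hk kA; clear; lra.
have hcount : {in ps, forall p, size ps <= count (mem (absorber e S p.1 p.2 set0)) (a0 :: A)}%N.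
  move=> p hp.
  have hpL v : v \in [:: p.1; p.2] -> v \in S.
    move=> hv; have : v \in enum L by rewrite -hps; apply/flatten_mapP; exists p.
    by rewrite mem_enum => /setDP[].
  rewrite -(ler_nat R); apply: le_trans (bA p.1 p.2 _ _); last first.
  - by apply: hpL; rewrite !inE eqxx orbT.
  - by apply: hpL; rewrite !inE eqxx.
  by apply: le_trans bL; rewrite ler_nat cardE sps leq_pmull.
have [c [c1 c2 c3]] := absorb_pairs es evB loose_c0 head_c0 uAA blockA hcount.
rewrite hps in c3.
have uc : uniq c.
  rewrite (perm_uniq c3); apply: disjoint_seq_uniq => //; first exact: enum_uniq.
  by move=> v; rewrite mem_enum inE => /andP[+ _] h; rewrite inE h.
have cS v : (v \in c) = (v \in S).
  rewrite (perm_mem c3) mem_cat mem_enum inE.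
  case vS : (v \in S); rewrite ?andbF /=; last by apply/negP=> /sc0; rewrite vS.
  by rewrite inE andbT orNb.
have sc : size c = #|S|.
  by rewrite -(card_uniqP uc); apply: eq_card.
by apply: (hamilton_of_loose uc _ _ cS c1 c2); rewrite sc // hn.
Qed.
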